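(* Let $k=1$, let $\tau>0$, and let a previous iterate $\varrho_h^n\in Q_h$ be given. Consider the two sub-systems of one step of the fixed-point iteration: (A) find $(\boldsymbol u_h^{n+1},\widehat{\boldsymbol u}_h^{n+1})\in\boldsymbol V_h\times\widehat{\boldsymbol V}_h$ such that for all $(\boldsymbol v_h,\widehat{\boldsymbol v}_h)\in\boldsymbol V_h\times\widehat{\boldsymbol V}_h$ $$a_h((\boldsymbol u_h^{n+1},\widehat{\boldsymbol u}_h^{n+1}),(\boldsymbol v_h,\widehat{\boldsymbol v}_h))=(\boldsymbol f,\boldsymbol v_h)+(\boldsymbol g,\varrho_h^n\boldsymbol v_h)+(p(\varrho_h^n),\mathrm{div}\,\boldsymbol v_h);$$ (B) with $\boldsymbol u_h^{n+1}$ from (A), find $\varrho_h^{n+1}\in Q_h$ such that for all $\lambda_h\in Q_h$ $$\tau^{-1}(\varrho_h^{n+1},\lambda_h)+c_h(\varrho_h^{n+1},\boldsymbol u_h^{n+1},\lambda_h)=\tau^{-1}(\varrho_h^n,\lambda_h).$$ Both sub-systems (A) and (B) are solvable. Moreover, if $\varrho_h^n>0$ and $(\varrho_h^n,1)=M$, then also $\varrho_h^{n+1}>0$ and $(\varrho_h^{n+1},1)=M$.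
   Context: Let $\Omega\subset\mathbb R^d$, $d\in\{2,3\}$, be a bounded Lipschitz domain with a regular quasi-uniform triangulation $\mathcal T$ into simplices $T$. Let $\mathcal F$ be the set of faces and $h$ the maximal cell diameter. Each face $F$ carries a unit normal $\boldsymbol n_F$ of fixed orientation, and $\boldsymbol n$ is the outward unit normal on $\partial T$. For an interior face $F=T_1\cap T_2$ with $\boldsymbol n_F$ pointing from $T_1$ to $T_2$ write $\varrho_{h,i}=\varrho_h|_{T_i}$. $(\cdot,\cdot)_\omega$ is the $L^2(\omega)$ inner product, $(\cdot,\cdot)=(\cdot,\cdot)_\Omega$. The tangential part is $\boldsymbol v_t:=\boldsymbol v-(\boldsymbol v\cdot\boldsymbol n)\boldsymbol n$. Data: $\nu>0$, $c_M>0$, $M>0$, $\boldsymbol g\in \boldsymbol L^\infty(\Omega)$, $\boldsymbol f\in\boldsymbol L^2(\Omega)$, equation of state $p(\varrho)=c_M\varrho$. Spaces: $\boldsymbol V_h:=\{\boldsymbol v_h\in H_0(\mathrm{div},\Omega): \boldsymbol v_h|_T\in [P_k(T)]^d\ \forall T\in\mathcal T\}$ (vanishing normal trace on $\partial\Omega$); $\widehat{\boldsymbol V}_h:=\{\widehat{\boldsymbol v}_h\in \boldsymbol L^2(\mathcal F): \widehat{\boldsymbol v}_h|_F\in[P_k(F)]^d,\ \widehat{\boldsymbol v}_h\cdot\boldsymbol n_F=0\ \forall F\in\mathcal F,\ \widehat{\boldsymbol v}_h=0\text{ on }\partial\Omega\}$; $Q_h:=\{\lambda_h\in L^2(\Omega):\lambda_h|_T\in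 P_{k-1}(T)\ \forall T\in\mathcal T\}$ (so piecewise constants for $k=1$). Forms: $$a_h((\boldsymbol u_h,\widehat{\boldsymbol u}_h),(\boldsymbol v_h,\widehat{\boldsymbol v}_h)):=\nu\sum_{T\in\mathcal T}\Big[(\nabla\boldsymbol u_h,\nabla\boldsymbol v_h)_T+(\nabla\boldsymbol u_h\boldsymbol n,(\widehat{\boldsymbol v}_h-\boldsymbol v_h)_t)_{\partial T}+(\nabla\boldsymbol v_h\boldsymbol n,(\widehat{\boldsymbol u}_h-\boldsymbol u_h)_t)_{\partial T}+\tfrac{\alpha k^2}{h}((\widehat{\boldsymbol u}_h-\boldsymbol u_h)_t,(\widehat{\boldsymbol v}_h-\boldsymbol v_h)_t)_{\partial T}\Big],$$ $$c_h(\varrho_h,\boldsymbol u_h,\lambda_h):=\sum_{T\in\mathcal T}\Big[-(\varrho_h\boldsymbol u_h,\nabla\lambda_h)_T+(\boldsymbol u_h\cdot\boldsymbol n\,\varrho_h^{up},\lambda_h)_{\partial T}\Big].$$ The upwind value on an interior face $F$ is $\varrho_h^{up}=\varrho_{h,1}$ if $\int_F\boldsymbol u_h\cdot\boldsymbol n_F\ge0$ and $\varrho_h^{up}=\varrho_{h,2}$ otherwise (on boundary faces $\boldsymbol u_h\cdot\boldsymbol n=0$). The parameter $\alpha>0$ is fixed and sufficiently large (for coercivity of $a_h$). *)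

(* Defs.v *)
From HB Require Import structures.
From mathcomp Require Import all_boot all_order all_algebra.
From mathcomp Require Import all_classical all_reals all_analysis.

Set Implicit Arguments.
Unset Strict Implicit.
Unset Printing Implicit Defensive.

Import Order.TTheory GRing.Theory Num.Theory.
Import numFieldNormedType.Exports.

Local Open Scope classical_set_scope.
Local Open Scope ring_scope.

(** * Lebesgue measure on R^n

    R^n is ['rV[R]_n] with the product sigma-algebra (generated by the
    coordinate maps); the measure is built by recursion on n as the image of
    the product measure under (x, y) |-> row_mx x y. *)

Definition rV_display : measure_display. Proof. exact (measure_tuple_display default_measure_display). Qed.

Section measurable_rV.
Variables (R : realType) (n : nat).

Let coors : 'I_n -> 'rV[R]_n -> measurableTypeR R := fun i x => x ord0 i.

Let rV_set0 : g_sigma_preimage coors set0.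
Proof. exact: sigma_algebra0. Qed.

Let rV_setC A : g_sigma_preimage coors A -> g_sigma_preimage coors (~` A).
Proof. exact: sigma_algebraC. Qed.

Let rV_bigcup (F : _^nat) : (forall i, g_sigma_preimage coors (F i)) ->
  g_sigma_preimage coors (\bigcup_i (F i)).
Proof. exact: sigma_algebra_bigcup. Qed.

HB.instance Definition _ := @isMeasurable.Build rV_display
  'rV[R]_n (g_sigma_preimage coors) rV_set0 rV_setC rV_bigcup.

End measurable_rV.

Lemma measurable_coord (R : realType) n (i : 'I_n) :
  measurable_fun setT ((fun x => x ord0 i) : 'rV[R]_n -> measurableTypeR R).
Proof.
move=> _ Y mY; rewrite setTI; apply: sub_sigma_algebra => /=.
rewrite -bigcup_seq/=; exists i => /=; first by rewrite mem_index_enum.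
by exists Y => //; rewrite setTI.
Qed.

Lemma measurable_fun_rVP (R : realType) n d (T : measurableType d)
    (f : T -> 'rV[R]_n) :
  (forall i, measurable_fun setT ((fun t => f t ord0 i) : T -> measurableTypeR R)) ->
  measurable_fun setT f.
Proof.
move=> mf.
have sub : g_sigma_preimage (fun i t => f t ord0 i : measurableTypeR R)
    `<=` measurable.
  apply: smallest_sub; first exact: sigma_algebra_measurable.
  rewrite -bigcup_seq => A [i /= _] [B mB <-]; exact: mf.
move=> _ A mA; apply: sub.
rewrite (g_sigma_preimage_comp
  (fun i (x : 'rV[R]_n) => x ord0 i : measurableTypeR R) f).
by exists A.
Qed.

Definition row_cons (R : realType) n (p : measurableTypeR R * 'rV[R]_n) :
  'rV[R]_n.+1 := row_mx (p.1 : R)%:M p.2.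

Definition row_uncons (R : realType) n (x : 'rV[R]_n.+1) :
  measurableTypeR R * 'rV[R]_n := (x ord0 ord0, @rsubmx R 1 1 n x).

Lemma row_consK (R : realType) n : cancel (@row_cons R n) (@row_uncons R n).
Proof.
move=> [x y]; rewrite /row_cons /row_uncons /=; congr (_, _).
  have /= := @row_mxEl R 1 1 n (x : R)%:M y ord0 ord0.
  rewrite [RHS]mxE ?eqxx mulr1n; apply: etrans.
  by congr (row_mx _ _ _ _); exact: val_inj.
exact: (@row_mxKr R 1 1 n).
Qed.

Lemma measurable_row_cons (R : realType) n :
  measurable_fun setT (@row_cons R n).
Proof.
apply: measurable_fun_rVP => i.
case: (@splitP 1 n i) => j ij.
- rewrite (_ : (fun t => _) = fst); first exact: measurable_fst.
  apply/funext => -[x y] /=.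
  have /= := @row_mxEl R 1 1 n (x : R)%:M y ord0 j.
  rewrite [RHS]mxE (ord1 j) ?eqxx mulr1n; apply: etrans.
  by congr (row_mx _ _ _ _); apply: val_inj; rewrite /= ij (ord1 j).
- rewrite (_ : (fun t => _) =
      (fun x : 'rV[R]_n => x ord0 j : measurableTypeR R) \o snd).
    by apply: measurableT_comp;
      [exact: measurable_coord|exact: measurable_snd].
  apply/funext => -[x y] /=.
  have /= := @row_mxEr R 1 1 n (x : R)%:M y ord0 j.
  by apply: etrans; congr (row_mx _ _ _ _); exact: val_inj.
Qed.

Lemma measurable_row_uncons (R : realType) n :
  measurable_fun setT (@row_uncons R n).
Proof.
apply: measurable_fun_pair; first exact: measurable_coord.
apply: measurable_fun_rVP => i.
rewrite (_ : (fun t => _) = fun x : 'rV[R]_n.+1 => x ord0 (rshift 1 i)).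
  exact: measurable_coord.
by apply/funext => x; rewrite mxE.
Qed.

Section lebesgue_rV_step.
Local Open Scope ereal_scope.
Variables (R : realType) (n : nat).
Variable m : {sigma_finite_measure set 'rV[R]_n -> \bar R}.

Definition lebesgue_rV_step : set 'rV[R]_n.+1 -> \bar R :=
  pushforward (lebesgue_measure \x m) (@row_cons R n).

Let mcons A : measurable A -> measurable (@row_cons R n @^-1` A).
Proof.
by move=> mA; rewrite -[X in measurable X]setTI; exact: measurable_row_cons.
Qed.

Let step0 : lebesgue_rV_step set0 = 0.
Proof. by rewrite /lebesgue_rV_step /pushforward preimage_set0 measure0. Qed.

Let step_ge0 A : 0 <= lebesgue_rV_step A.
Proof. by rewrite /lebesgue_rV_step /pushforward; apply: measure_ge0. Qed.

Let step_sigma_additive : semi_sigma_additive lebesgue_rV_step.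
Proof.
move=> F mF tF mUF; rewrite /lebesgue_rV_step /pushforward preimage_bigcup.
apply: measure_semi_sigma_additive.
- by move=> i; exact: mcons.
- apply/trivIsetP => /= i j _ _ ij; rewrite -preimage_setI.
  by move/trivIsetP : tF => /(_ _ _ _ _ ij) ->//; rewrite preimage_set0.
- by rewrite -preimage_bigcup; exact: mcons.
Qed.

HB.instance Definition _ := isMeasure.Build _ _ _
  lebesgue_rV_step step0 step_ge0 step_sigma_additive.

Let step_sigma_finite : sigma_finite setT lebesgue_rV_step.
Proof.
have /sigma_finiteP[F [TF ndF Foo]] := sigma_finiteT (@lebesgue_measure R).
have /sigma_finiteP[G [TG ndG Goo]] := sigma_finiteT m.
exists (fun i => @row_uncons R n @^-1` (F i `*` G i)).
  rewrite -preimage_bigcup -[LHS](preimage_setT (@row_uncons R n)).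
  congr (_ @^-1` _); rewrite -setXTT TF TG predeqE => -[x y]; split.
    move=> [/= [k _ Fkx] [l _ Gly]]; exists (maxn k l) => //; split.
    - by move: x Fkx; exact/subsetPset/ndF/leq_maxl.
    - by move: y Gly; exact/subsetPset/ndG/leq_maxr.
  by move=> [k _ []/= ? ?]; split; exists k.
move=> k; have [mF Fk] := Foo k; have [mG Gk] := Goo k.
have mFG : measurable (F k `*` G k) by exact: measurableX.
split.
  by rewrite -[X in measurable X]setTI; exact: measurable_row_uncons.
rewrite /lebesgue_rV_step /pushforward -comp_preimage.
rewrite (_ : _ \o _ = id); last by apply/funext => z; exact: row_consK.
by rewrite preimage_id product_measure1E// lte_mul_pinfty// ge0_fin_numE.
Qed.

HB.instance Definition _ := Measure_isSigmaFinite.Build _ _ _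
  lebesgue_rV_step step_sigma_finite.

End lebesgue_rV_step.

Fixpoint lebesgue_rV (R : realType) (n : nat) :
    {sigma_finite_measure set 'rV[R]_n -> \bar R} :=
  match n with
  | 0 => \d_ (0 : 'rV[R]_0)
  | n'.+1 => lebesgue_rV_step (lebesgue_rV R n')
  end.

Definition dotv (R : realType) d (u v : 'rV[R]_d) : R :=
  \sum_i u ord0 i * v ord0 i.

Definition norm2 (R : realType) d (u : 'rV[R]_d) : R := Num.sqrt (dotv u u).

Definition partial (R : realType) d (phi : 'rV[R]_d -> R) (i : 'I_d) :
  'rV[R]_d -> R := 'D_(delta_mx ord0 i) phi.

Definition grad (R : realType) d (phi : 'rV[R]_d -> R) (x : 'rV[R]_d) :
  'rV[R]_d := \row_i partial phi i x.

(* The library Jacobian acts on row vectors: ('J u x) i j is the i-th partial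
   derivative of u_j, i.e. the transpose of the usual matrix of grad u. *)
Definition gradv (R : realType) d (u : 'rV[R]_d -> 'rV[R]_d) (x : 'rV[R]_d) :
  'M[R]_d := ('J u x)^T.

Definition gradv_mul (R : realType) d (u : 'rV[R]_d -> 'rV[R]_d)
  (x n : 'rV[R]_d) : 'rV[R]_d := (gradv u x *m n^T)^T.

Definition divergence (R : realType) d (u : 'rV[R]_d -> 'rV[R]_d)
  (x : 'rV[R]_d) : R := \tr (gradv u x).

Definition ddot (R : realType) d (A B : 'M[R]_d) : R :=
  \sum_i \sum_j A i j * B i j.

Definition tangential (R : realType) d (n v : 'rV[R]_d) : 'rV[R]_d :=
  v - dotv v n *: n.

(* Polynomial functions of total degree at most k. *)
Definition poly_fun (R : realType) d (k : nat) (f : 'rV[R]_d -> R) : Prop :=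
  exists c : {ffun 'I_d -> 'I_k.+1} -> R, forall x,
    f x = \sum_(m : {ffun 'I_d -> 'I_k.+1} | (\sum_i m i <= k)%N)
            c m * \prod_i x ord0 i ^+ m i.

Definition poly_vfun (R : realType) d (k : nat)
  (u : 'rV[R]_d -> 'rV[R]_d) : Prop :=
  forall i, poly_fun k (fun x => u x ord0 i).

(** * Domains and function spaces on a domain *)

Definition bdry (R : realType) d (Om : set 'rV[R]_d) : set 'rV[R]_d :=
  closure Om `\` Om°.

(* Near each boundary point, Om is the strict epigraph, in some direction e, of
   a Lipschitz function g of the coordinates orthogonal to e; g is extended to
   R^d constantly along e. *)
Definition lipschitz_domain (R : realType) d (Om : set 'rV[R]_d) : Prop :=
  [/\ open Om, connected Om, Om !=set0, bounded_set Om &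
   forall x, bdry Om x ->
     exists (e : 'rV[R]_d) (g : 'rV[R]_d -> R) (L : R),
       [/\ dotv e e = 1,
           forall y z, `|g y - g z| <= L * `|y - z|,
           forall y s, g (y + s *: e) = g y &
           \forall y \near x, Om y <-> g y < dotv y e]].

Definition L2 (R : realType) d (Om : set 'rV[R]_d) (f : 'rV[R]_d -> R) :
  Prop :=
  measurable_fun Om (f : 'rV[R]_d -> measurableTypeR R) /\
  (\int[lebesgue_rV R d]_(x in Om) ((f x) ^+ 2)%:E < +oo)%E.

Definition Linfty (R : realType) d (Om : set 'rV[R]_d) (f : 'rV[R]_d -> R) :
  Prop :=
  measurable_fun Om (f : 'rV[R]_d -> measurableTypeR R) /\
  exists C : R, {ae lebesgue_rV R d, forall x, Om x -> `|f x| <= C}.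

Definition vL2 (R : realType) d (Om : set 'rV[R]_d)
  (f : 'rV[R]_d -> 'rV[R]_d) : Prop := forall i, L2 Om (fun x => f x ord0 i).

Definition vLinfty (R : realType) d (Om : set 'rV[R]_d)
  (f : 'rV[R]_d -> 'rV[R]_d) : Prop :=
  forall i, Linfty Om (fun x => f x ord0 i).

Definition C1 (R : realType) d (phi : 'rV[R]_d -> R) : Prop :=
  (forall x, differentiable phi x) /\ (forall i, continuous (partial phi i)).

(* H_0(div, Om): u has a divergence w in L^2(Om) and a vanishing normal trace.
   Both are expressed by Green's formula (u, grad phi) + (w, phi) = 0: for phi
   with compact support in Om it says that w is the weak divergence of u, and
   for all phi that are C^1 up to the boundary that the functional
   phi |-> (u, grad phi) + (div u, phi) on the boundary, which is the normal
   trace, vanishes. *)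
Definition H0div (R : realType) d (Om : set 'rV[R]_d)
  (u : 'rV[R]_d -> 'rV[R]_d) : Prop :=
  vL2 Om u /\
  exists2 w : 'rV[R]_d -> R, L2 Om w &
    forall phi : 'rV[R]_d -> R, C1 phi ->
      \int[lebesgue_rV R d]_(x in Om) dotv (u x) (grad phi x) +
      \int[lebesgue_rV R d]_(x in Om) (w x * phi x) = 0.

(** * Simplicial meshes *)

(* A cell (face) is given by its set of d.+1 (d) vertex indices; [nrm] is the
   unit normal n_F of fixed orientation of each face F. *)
Record mesh (R : realType) (d : nat) := Mesh {
  nverts : nat;
  vtx : 'I_nverts -> 'rV[R]_d;
  cells : {set {set 'I_nverts}};
  nrm : {set 'I_nverts} -> 'rV[R]_d
}.

Section mesh.
Variables (R : realType) (d : nat) (K : mesh R d).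
Local Notation vset := {set 'I_(nverts K)}.
Local Notation Rd := 'rV[R]_d.
Implicit Types (A T F : vset) (Om : set Rd).

Definition simplex A : set Rd :=
  [set x | exists c : 'I_(nverts K) -> R,
    [/\ forall i, 0 <= c i, \sum_(i in A) c i = 1 &
        x = \sum_(i in A) c i *: vtx i]].

Definition affinely_free A : Prop :=
  forall c : 'I_(nverts K) -> R,
    \sum_(i in A) c i = 0 -> \sum_(i in A) c i *: vtx i = 0 ->
    forall i, i \in A -> c i = 0.

Definition faces_of T : {set vset} :=
  [set F : vset | (F \subset T) && (#|F| == d)].

Definition faces : {set vset} := \bigcup_(T in cells K) faces_of T.

Definition unit_normal F (n : Rd) : Prop :=
  dotv n n = 1 /\
  forall i j, i \in F -> j \in F -> dotv n (vtx i - vtx j) = 0.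

Definition triangulation Om : Prop :=
  [/\ closure Om = \bigcup_(T in [set` cells K]) simplex T,
      forall T, T \in cells K -> #|T| = d.+1 /\ affinely_free T,
      forall T T', T \in cells K -> T' \in cells K ->
        simplex T `&` simplex T' = simplex (T :&: T') &
      forall F, F \in faces -> unit_normal F (nrm F)].

Definition diam (A : set Rd) : R :=
  sup [set r | exists x y, [/\ A x, A y & r = norm2 (x - y)]].

Definition mesh_size : R :=
  \big[Order.max/0]_(T in cells K) diam (simplex T).

Definition shape_regular (sigma : R) : Prop :=
  forall T, T \in cells K -> exists (z : Rd) (r : R),
    [/\ 0 <= r, [set y | norm2 (y - z) <= r] `<=` simplex T &
        diam (simplex T) <= sigma * (2 * r)].

Definition quasi_uniform (sigma : R) : Prop :=
  forall T, T \in cells K -> mesh_size <= sigma * diam (simplex T).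

Definition outer_normal T F : Rd :=
  xget 0 [set n | unit_normal F n /\
    forall i j, i \in T :\: F -> j \in F -> dotv n (vtx i - vtx j) < 0].

(** ** Integrals *)

Definition cell_int T (phi : Rd -> R) : R :=
  \int[lebesgue_rV R d]_(x in simplex T) phi x.

Definition ref_simplex : set 'rV[R]_d.-1 :=
  [set t | (forall i, 0 <= t ord0 i) /\ \sum_i t ord0 i <= 1].

Definition face_pt F (i : nat) : Rd := nth 0 [seq vtx j | j <- enum F] i.

Definition face_jac F : 'M[R]_(d.-1, d) :=
  \matrix_(i < d.-1) (face_pt F i.+1 - face_pt F 0).

(* Surface integral, by the affine parametrization of F over the reference
   simplex of dimension d-1. *)
Definition face_int F (phi : Rd -> R) : R :=
  Num.sqrt (\det (face_jac F *m (face_jac F)^T)) *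
  \int[lebesgue_rV R d.-1]_(t in ref_simplex)
     phi (face_pt F 0 + t *m face_jac F).

Definition bdry_int T (phi : vset -> Rd -> R) : R :=
  \sum_(F in faces_of T) face_int F (phi F).

(** ** Discrete spaces

    A discontinuous piecewise polynomial v_h is given by the family of the
    polynomials v_h|_T (polynomial functions on all of R^d, so that traces on
    faces and derivatives make sense); [broken v] is the function that it
    defines almost everywhere on the domain. *)

Definition broken (V : nmodType) (v : vset -> Rd -> V) (x : Rd) : V :=
  \sum_(T in cells K | x \in ((simplex T)° : set Rd)) v T x.

Definition in_Vh (k : nat) Om (v : vset -> Rd -> Rd) : Prop :=
  (forall T, T \in cells K -> poly_vfun k (v T)) /\ H0div Om (broken v).

Definition in_Vhat (k : nat) Om (v : vset -> Rd -> Rd) : Prop :=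
  forall F, F \in faces ->
    [/\ exists2 p, poly_vfun k p & forall x, simplex F x -> v F x = p x,
        forall x, simplex F x -> dotv (v F x) (nrm F) = 0 &
        simplex F `<=` bdry Om -> forall x, simplex F x -> v F x = 0].

Definition in_Qh (k : nat) (q : vset -> Rd -> R) : Prop :=
  forall T, T \in cells K -> poly_fun k.-1 (q T).

(** ** Forms *)

Definition form_a (k : nat) (alpha nu : R) (u uh v vh : vset -> Rd -> Rd) : R :=
  nu * \sum_(T in cells K)
   (cell_int T (fun x => ddot (gradv (u T) x) (gradv (v T) x))
    + bdry_int T (fun F x => let n := outer_normal T F in
        dotv (gradv_mul (u T) x n) (tangential n (vh F x - v T x)))
    + bdry_int T (fun F x => let n := outer_normal T F in
        dotv (gradv_mul (v T) x n) (tangential n (uh F x - u T x)))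
    + alpha * k%:R ^+ 2 / mesh_size *
      bdry_int T (fun F x => let n := outer_normal T F in
        dotv (tangential n (uh F x - u T x))
             (tangential n (vh F x - v T x)))).

(* The cell from which the upwind value on the face F of T is taken: the one
   that n_F (or -n_F, if the flux along n_F is negative) points out of. The
   default concerns boundary faces only, where u.n = 0. For u in V_h the flux
   is the same from both sides of F. *)
Definition upwind_cell (u : vset -> Rd -> Rd) T F : vset :=
  let s := if 0 <= face_int F (fun x => dotv (u T x) (nrm F))
           then nrm F else - nrm F in
  odflt T [pick T' in cells K | (F \subset T') && (outer_normal T' F == s)].

Definition form_c (rho : vset -> Rd -> R) (u : vset -> Rd -> Rd)
  (q : vset -> Rd -> R) : R :=
  \sum_(T in cells K)
   (- cell_int T (fun x => dotv (rho T x *: u T x) (grad (q T) x))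
    + bdry_int T (fun F x =>
        dotv (u T x) (outer_normal T F) * rho (upwind_cell u T F) x * q T x)).

Definition momentum_step (k : nat) Om (alpha nu cM : R) (f g : Rd -> Rd)
  (rhon : vset -> Rd -> R) (u uh : vset -> Rd -> Rd) : Prop :=
  [/\ in_Vh k Om u, in_Vhat k Om uh &
   forall v vh, in_Vh k Om v -> in_Vhat k Om vh ->
     form_a k alpha nu u uh v vh =
       \int[lebesgue_rV R d]_(x in Om) dotv (f x) (broken v x)
       + \int[lebesgue_rV R d]_(x in Om)
           dotv (g x) (broken rhon x *: broken v x)
       + \int[lebesgue_rV R d]_(x in Om)
           (cM * broken rhon x * broken (fun T => divergence (v T)) x)].

Definition density_step (k : nat) Om (tau : R) (u : vset -> Rd -> Rd)
  (rhon rho : vset -> Rd -> R) : Prop :=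
  in_Qh k rho /\
  forall q, in_Qh k q ->
    tau^-1 * \int[lebesgue_rV R d]_(x in Om) (broken rho x * broken q x)
    + form_c rho u q =
    tau^-1 * \int[lebesgue_rV R d]_(x in Om) (broken rhon x * broken q x).

Definition positive_density (rho : vset -> Rd -> R) : Prop :=
  forall T x, T \in cells K -> simplex T x -> 0 < rho T x.

Definition mass Om (rho : vset -> Rd -> R) : R :=
  \int[lebesgue_rV R d]_(x in Om) broken rho x.

End mesh.

(* Main.v *)
(* System (A) is a square linear system on a finite-dimensional space, so it is
   enough that its right-hand side vanishes on the kernel of a_h.  For alpha
   large, a_h bounds the broken gradients and the tangential jumps from below;
   hence a kernel element is piecewise constant with matching tangential traces.
   Membership in H_0(div) makes the normal traces match as well (Green's formula
   tested with bumps concentrated at a point of the face), so the constants of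
   neighbouring cells agree and those of boundary cells vanish.  A nonzero value
   would be taken on a set of cells without boundary; by the divergence theorem
   for the field x the volume of these cells would be 0.

   System (B) is a square system with one unknown per cell.  Summing the
   equations over the cells where rho < 0 leaves, by upwinding, only face terms
   of the good sign, so its matrix is inverse positive; summing over all cells
   cancels all fluxes, which is conservation of mass. *)

Require Import Defs.
From mathcomp Require Import all_boot all_order all_algebra.
From mathcomp Require Import all_classical all_reals all_analysis.
From mathcomp Require Import measurable_realfun ring lra.

Set Implicit Arguments.
Unset Strict Implicit.
Unset Printing Implicit Defensive.

Import Order.TTheory GRing.Theory Num.Theory.
Import numFieldNormedType.Exports.

Local Open Scope classical_set_scope.
Local Open Scope ring_scope.

(** * Lebesgue measure on R^n *)

(** Green's formula provides only some w in L^2, not tied to the cellwise divergence, so the term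
    with w has to be beaten by size. A bump of radius r in all directions weighs the normal jump
    with r^(d-1), while Cauchy-Schwarz bounds the w term by r^(d/2) only, too weak for d = 3. Bumps
    of width r along the face and thickness r^(d+1) across it keep the weight r^(d-1) and make the w
    term O(r^d).

    The unknowns of (A) are encoded redundantly: a face carries an affine field on the whole space,
    and every vertex set carries fields, cell or not. The matrix of a_h is therefore singular;
    solvability comes from a Fredholm argument, because the load sees the cell fields only.

    For k = 1 gradients are constant on cells, so the trace inequality behind the threshold for
    alpha is the identity |T| = c * height * |F| together with height >= h / sigma^2.

    Since the measure is defined by recursion on the dimension, the determinant formula for linear
    maps is derived from slicing, by Gaussian elimination. *)

Lemma lebesgue_measure_affine (R : realType) (a b : R) (X : set (measurableTypeR R)) :
  a != 0 -> measurable X ->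
  lebesgue_measure ((fun x : R => a * x + b) @^-1` X) =
  ((`|a|^-1)%R%:E * lebesgue_measure X)%E.
Proof.
have mf (c e : R) : measurable_fun setT
    ((fun x : R => c * x + e) : measurableTypeR R -> measurableTypeR R).
  by apply: measurable_funD => //; exact: measurable_funM.
move=> a0 mX.
have mP (c e : R) (Y : set (measurableTypeR R)) : measurable Y ->
    measurable ((fun x : R => c * x + e) @^-1` Y : set (measurableTypeR R)).
  by move=> mY; rewrite -[X in measurable X]setTI; exact: mf.
have pos (c e : R) (Y : set (measurableTypeR R)) : 0 < c -> measurable Y ->
    lebesgue_measure ((fun x : R => c * x + e) @^-1` Y) =
    (c^-1%:E * lebesgue_measure Y)%E.
  move=> c0 mY.
  have c0' : 0 <= c by exact: ltW.
  pose F : measurableTypeR R -> measurableTypeR R := fun x : R => c * x + e.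
  have mF : measurable_fun setT F by exact: mf.
  pose m1 : {measure set (measurableTypeR R) -> \bar R} :=
    pushforward (@lebesgue_measure R) F.
  pose m' : {measure set (measurableTypeR R) -> \bar R} :=
    mscale (NngNum c0') (m1 mF).
  (* [m'] is c times the image of Lebesgue measure under [F]. It has the right value on half-open
     intervals, and these values characterize Lebesgue measure. *)
  have -> : lebesgue_measure Y = m' Y.
    apply: lebesgue_measure_unique => // _ [[p q]] _ <-.
    transitivity (c%:E * lebesgue_measure (F @^-1` `]p, q]%classic))%E; last by [].
    rewrite (_ : _ @^-1` _ = `](p - e) / c, (q - e) / c]%classic); last first.
      apply/seteqP; split => x /=; rewrite !in_itv /= ltr_pdivrMr// ler_pdivlMr//;
        rewrite ![x * c]mulrC ltrBlDr lerBrDr //.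
    rewrite !lebesgue_measure_itv /= !lte_fin ltr_pM2r ?invr_gt0// ltrD2r.
    case: ifP => // _; rewrite ?mule0//.
    by rewrite -!EFinD -EFinM; congr EFin; field; exact: lt0r_neq0.
  rewrite -[m' Y]/(c%:E * lebesgue_measure (F @^-1` Y))%E muleA -EFinM mulVf ?mul1e//.
  exact: lt0r_neq0.
have [a_gt0|a_lt0|/esym a00] := ltrgt0P a.
- by rewrite pos.
- rewrite -(lebesgue_measureN mX) /pushforward.
  rewrite -(pos (- a) (- b)) ?oppr_gt0//; last first.
    by rewrite -[X in measurable X]setTI; exact: oppr_measurable.
  congr (lebesgue_measure _); apply/seteqP; split => x /=; 
    by rewrite mulNr -opprD opprK.
- by rewrite a00 eqxx in a0.
Qed.

(** * Slicing R^(n+1) along the first coordinate *)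

Section rV_slices.
Variable R : realType.
Notation mu1 := (@lebesgue_measure R).

Lemma measurable_mulmx n p (A : 'M[R]_(n, p)) (v : 'rV[R]_p) :
  measurable_fun setT (fun z : 'rV[R]_n => v + z *m A).
Proof.
apply: measurable_fun_rVP => i.
rewrite (_ : (fun t => _) = fun t : 'rV[R]_n => v ord0 i + \sum_j t ord0 j * A j i); last first.
  by apply/funext => t; rewrite !mxE.
apply: measurable_funD => //.
apply: measurable_sum => j.
by apply: measurable_funM => //; exact: measurable_coord.
Qed.

Lemma measurable_preimage d d' (T : measurableType d) (U : measurableType d')
  (f : T -> U) (S : set U) :
  measurable_fun setT f -> measurable S -> measurable (f @^-1` S).
Proof. by move=> mf mS; rewrite -[X in measurable X]setTI; exact: mf. Qed.

Lemma lebesgue_rV_slice n (S : set 'rV[R]_n.+1) :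
  lebesgue_rV R n.+1 S =
  (\int[mu1]_x lebesgue_rV R n [set y | S (row_cons (x, y))])%E.
Proof.
rewrite [LHS]/= /lebesgue_rV_step /pushforward /product_measure1.
by apply: eq_integral => x _ /=; congr (lebesgue_rV R n _); exact: xsectionE.
Qed.

(** The recursive definition integrates over the first coordinate last; the opposite order rests on
    the uniqueness of the product measure. It serves for shears of the first coordinate by the
    others and for null hyperplanes. *)
Lemma lebesgue_rV_slice2 n (S : set 'rV[R]_n.+1) : measurable S ->
  lebesgue_rV R n.+1 S =
  (\int[lebesgue_rV R n]_y mu1 [set x | S (row_cons (x, y))])%E.
Proof.
move=> mS.
rewrite [LHS]/= /lebesgue_rV_step /pushforward.
have mS' := measurable_preimage (@measurable_row_cons R n) mS.
rewrite (@product_measure_unique _ _ _ _ _ _ _ (product_measure2 (@lebesgue_measure R) (lebesgue_rV R n))) //.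
  by rewrite /product_measure2; apply: eq_integral => y _ /=; congr (mu1 _); exact: ysectionE.
by move=> A B mA mB; exact: product_measure2E.
Qed.

Lemma measurable_slice n (S : set 'rV[R]_n.+1) x : measurable S ->
  measurable [set y : 'rV[R]_n | S (row_cons (x, y))].
Proof.
move=> mS; apply: (@measurable_preimage _ _ _ _ (fun y => row_cons (x, y))) => //.
by apply: measurableT_comp; [exact: measurable_row_cons|exact: measurable_pair1].
Qed.

Lemma measurable_slice_fun n (S : set 'rV[R]_n.+1) : measurable S ->
  measurable_fun setT
    (fun x : measurableTypeR R => lebesgue_rV R n [set y : 'rV[R]_n | S (row_cons (x, y))]).
Proof.
move=> mS.
have mS' := measurable_preimage (@measurable_row_cons R n) mS.
have := @measurable_fun_xsection _ _ _ _ _ (lebesgue_rV R n) _ mS'.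
by congr measurable_fun; apply/funext => x /=; congr (lebesgue_rV R n _); exact: xsectionE.
Qed.

Lemma lebesgue_integral_affine (a b : R) (f : R -> \bar R) : a != 0 ->
  measurable_fun setT (f : measurableTypeR R -> \bar R) -> (forall x, 0 <= f x)%E ->
  (\int[mu1]_x f (a * x + b)%R = (`|a|^-1)%R%:E * \int[mu1]_x f x)%E.
Proof.
move=> a0 mf f0.
pose F : measurableTypeR R -> measurableTypeR R := fun x : R => a * x + b.
have mF : measurable_fun setT F by apply: measurable_funD => //; exact: measurable_funM.
transitivity (\int[pushforward mu1 F]_y f y)%E.
  by rewrite ge0_integral_pushforward //; exact: in1W.
have na : 0 <= `|a|^-1 by rewrite invr_ge0.
transitivity (\int[mscale (NngNum na) mu1]_y f y)%E.
  apply: eq_measure_integral => A mA _ /=.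
  by rewrite /mscale /= /pushforward (lebesgue_measure_affine b a0).
by rewrite ge0_integral_mscale.
Qed.

End rV_slices.

(** * Change of variables under translations and invertible linear maps *)

Section rV_linear.
Variable R : realType.
Notation mu1 := (@lebesgue_measure R).
Notation mu n := (lebesgue_rV R n).

Lemma row_consE n (x : R) (y : 'rV[R]_n) : row_cons (x, y) = row_mx x%:M y.
Proof. by []. Qed.

Lemma row_consD n (x x' : R) (y y' : 'rV[R]_n) :
  row_cons (x, y) + row_cons (x', y') = row_cons (x + x', y + y').
Proof.
rewrite !row_consE; apply: etrans (@add_row_mx _ 1 1 n _ _ _ _) _.
by rewrite /row_cons /= raddfD.
Qed.

Lemma row_cons_eta n (z : 'rV[R]_n.+1) : exists x y, z = row_cons (x, y).
Proof.
exists (z ord0 ord0), (@rsubmx R 1 1 n z).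
apply: etrans (esym (@hsubmxK R 1 1 n z)) _; rewrite row_consE; congr row_mx.
by apply/rowP => i; rewrite !mxE (ord1 i) eqxx mulr1n; congr (z _ _); exact: val_inj.
Qed.

Lemma measurable_affine_preimage n p (A : 'M[R]_(n, p)) v (S : set 'rV[R]_p) :
  measurable S -> measurable [set z : 'rV[R]_n | S (v + z *m A)].
Proof. by apply: measurable_preimage; exact: measurable_mulmx. Qed.

Lemma measurable_translate_preimage n v (S : set 'rV[R]_n) :
  measurable S -> measurable [set z : 'rV[R]_n | S (v + z)].
Proof.
move=> mS; have := measurable_affine_preimage 1%:M v mS.
by congr measurable; apply/seteqP; split => z /=; rewrite mulmx1.
Qed.

Lemma lebesgue_rV_translate n (v : 'rV[R]_n) (S : set 'rV[R]_n) : measurable S ->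
  mu n [set z | S (v + z)] = mu n S.
Proof.
elim: n v S => [|n IH] v S mS.
  congr (mu 0 _); apply/seteqP; split => z /=; congr (S _); apply/rowP => -[] //.
have [v0 [v' ->]] := row_cons_eta v.
rewrite !lebesgue_rV_slice.
transitivity (\int[mu1]_x mu n [set y | S (row_cons ((1 * x + v0)%R, y))])%E.
  apply: eq_integral => x _; rewrite -(IH v' [set y | S (row_cons ((1 * x + v0)%R, y))]); last first.
    exact: measurable_slice.
  by congr (mu n _); apply/seteqP; split => y /=; rewrite row_consD mul1r [v0 + x]addrC.
rewrite (@lebesgue_integral_affine R 1 v0 (fun x => mu n [set y | S (row_cons (x, y))])) ?oner_eq0//.
  by rewrite normr1 invr1 mul1e.
exact: measurable_slice_fun.
Qed.

(** Made a property of the matrix because it is stable under products, which is what elimination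
    requires. *)
Definition scales_lebesgue n (A : 'M[R]_n) := forall S : set 'rV[R]_n, measurable S ->
  (mu n [set z | S (z *m A)] = (`|\det A|^-1)%R%:E * mu n S)%E.

Lemma measurable_linear_preimage n p (A : 'M[R]_(n, p)) (S : set 'rV[R]_p) :
  measurable S -> measurable [set z : 'rV[R]_n | S (z *m A)].
Proof.
move=> mS; have := measurable_affine_preimage A 0 mS.
by congr measurable; apply/seteqP; split => z /=; rewrite add0r.
Qed.

Lemma scales_lebesgueM n (A B : 'M[R]_n) :
  scales_lebesgue A -> scales_lebesgue B -> scales_lebesgue (A *m B).
Proof.
move=> sA sB S mS.
transitivity (mu n [set z | [set y | S (y *m B)] (z *m A)]).
  by congr (mu n _); apply/seteqP; split => z /=; rewrite mulmxA.
rewrite sA; last exact: measurable_linear_preimage.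
by rewrite sB // muleA -EFinM det_mulmx normrM invfM.
Qed.

(** The map sends (x, y) to (a x, x b + y D). Over a fixed x the slice is a [D]-preimage of a
    translate, handled by translation invariance and the assumption on [D]; the remaining integral
    over x is rescaled by a. *)
Lemma scales_lebesgue_upper n (a : R) (b : 'rV[R]_n) (D : 'M[R]_n) : a != 0 ->
  scales_lebesgue D -> scales_lebesgue (block_mx a%:M b 0 D : 'M[R]_n.+1).
Proof.
move=> a0 sD S mS.
rewrite !lebesgue_rV_slice.
transitivity (\int[mu1]_x ((`|\det D|^-1)%R%:E * mu n [set y | S (row_cons ((a * x + 0)%R, y))]))%E.
  apply: eq_integral => x _.
  have mS' : measurable [set y | S (row_cons ((a * x + 0)%R, y))] by exact: measurable_slice.
  rewrite -(lebesgue_rV_translate (x *: b) mS') -sD; last exact: measurable_translate_preimage.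
  congr (mu n _); apply/seteqP; split => y /=;
   by rewrite (row_consE x y) (@mul_row_block _ 1 1 n 1 n) mulmx0 addr0 -scalar_mxM mul_scalar_mx addr0 mulrC.
have mS' := measurable_slice_fun mS.
rewrite ge0_integralZl //=; last first.
  have mf : measurable_fun setT (fun x : measurableTypeR R => (a * x + 0 : measurableTypeR R)).
    by apply: measurable_funD => //; exact: measurable_funM.
  exact: (measurableT_comp mS' mf).
rewrite (@lebesgue_integral_affine R a 0 (fun x => mu n [set y | S (row_cons (x, y))])) //.
rewrite muleA -EFinM; congr (_%:E * _)%E.
by rewrite (@det_ublock _ 1 n) det_scalar1 normrM invfM mulrC.
Qed.

(** The map sends (x, y) to (x + y c, y), so over a fixed y it is a translation of the line. *)
Lemma scales_lebesgue_lower n (c : 'cV[R]_n) :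
  scales_lebesgue (block_mx 1 0 c 1%:M : 'M[R]_n.+1).
Proof.
move=> S mS.
rewrite !lebesgue_rV_slice2 //; last exact: measurable_linear_preimage.
rewrite (@det_lblock _ 1 n) !det1 mulr1 normr1 invr1 mul1e.
apply: eq_integral => y _.
have mS' : measurable [set x : measurableTypeR R | S (row_cons (x, y))].
  apply: (@measurable_preimage _ _ _ _ (fun x => row_cons (x, y))) => //.
  by apply: measurableT_comp; [exact: measurable_row_cons|exact: measurable_pair2].
transitivity (mu1 ((fun x => 1 * x + (y *m c) ord0 ord0) @^-1` [set x | S (row_cons (x, y))])).
  have E x : (x + (y *m c) ord0 ord0)%:M = x%:M + y *m c :> 'M[R]_1.
    by rewrite raddfD /= -mx11_scalar.
  congr (mu1 _); apply/seteqP; split => x /=;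
    by rewrite (row_consE x y) (@mul_row_block _ 1 1 n 1 n) !mulmx1 mulmx0 add0r mul1r row_consE E.
by rewrite (lebesgue_measure_affine _ (oner_neq0 _)) // normr1 invr1 mul1e.
Qed.

(** Gaussian elimination by induction on the size. With a nonzero corner entry the matrix is a lower
    shear times a block triangular factor with the Schur complement [D]. If the corner vanishes,
    some other entry of the first column does not, and adding its row to the first row creates a
    pivot. *)
Lemma lebesgue_rV_linear n (A : 'M[R]_n) : A \in unitmx -> scales_lebesgue A.
Proof.
elim: n A => [|n IH] A uA.
  move=> S mS; rewrite det_mx00 normr1 invr1 mul1e.
  by congr (mu 0 _); apply/seteqP; split => z /=; congr (S _); apply/rowP => -[].
have pivot (B : 'M[R]_(1 + n)) : B \in unitmx -> ulsubmx B ord0 ord0 != 0 -> scales_lebesgue B.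
  move=> uB a0; set a := ulsubmx B ord0 ord0 in a0.
  have Ba : ulsubmx B = a%:M by rewrite [LHS]mx11_scalar.
  pose c := a^-1 *: dlsubmx B.
  pose D := drsubmx B - c *m ursubmx B.
  have BE : B = (block_mx 1 0 c 1%:M : 'M[R]_(1 + n)) *m block_mx a%:M (ursubmx B) 0 D.
    rewrite (@mulmx_block _ 1 n 1 n 1 n) !mul1mx !mul0mx !addr0 -[in LHS](submxK B).
    rewrite Ba; congr block_mx.
      by rewrite mul_mx_scalar /c scalerA divff // scale1r.
    by rewrite /D addrC subrK.
  rewrite BE; apply: scales_lebesgueM; first exact: scales_lebesgue_lower.
  apply: scales_lebesgue_upper => //; apply: IH.
  by move: uB; rewrite !unitmxE BE det_mulmx (@det_lblock _ 1 n) !det1 mulr1 mul1r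
    (@det_ublock _ 1 n) det_scalar1 unitrM => /andP[].
have [a0|a0] := eqVneq ((ulsubmx (A : 'M[R]_(1 + n))) ord0 ord0) 0; last exact: pivot.
have [i ci] : exists i, (dlsubmx (A : 'M[R]_(1 + n))) i ord0 != 0.
  apply: contrapT => /forallNP c0.
  have : dlsubmx (A : 'M[R]_(1 + n)) = 0.
    by apply/matrixP => i j; rewrite (ord1 j) [RHS]mxE; move: (c0 i) => /negP; rewrite negbK => /eqP.
  move=> dl0; move: uA; rewrite unitmxE -(submxK (A : 'M[R]_(1 + n))) dl0 (@det_ublock _ 1 n).
  by rewrite [ulsubmx _]mx11_scalar a0 det_scalar1 mul0r unitr0.
pose U (s : R) : 'M[R]_(1 + n) := block_mx 1 (s *: delta_mx ord0 i) 0 1%:M.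
have AE : A = U (- 1) *m (U 1 *m (A : 'M[R]_(1 + n))).
  rewrite mulmxA (_ : U (-1) *m U 1 = 1%:M) ?mul1mx// /U.
  rewrite (@mulmx_block _ 1 n 1 n 1 n) !mul1mx !mul0mx !mulmx0 !mulmx1 !addr0 !add0r.
  by rewrite scale1r scaleN1r subrr -scalar_mx_block.
have sU s : scales_lebesgue (U s).
  apply: scales_lebesgue_upper; first exact: oner_neq0.
  by apply: IH; exact: unitmx1.
have detU s : \det (U s) = 1 by rewrite (@det_ublock _ 1 n) !det1 mulr1.
rewrite AE; apply: scales_lebesgueM => //; apply: pivot.
  by rewrite unitmxE det_mulmx detU mul1r -unitmxE.
rewrite -{1}(submxK (A : 'M[R]_(1 + n))) /U (@mulmx_block _ 1 n 1 n 1 n) block_mxKul !mul1mx scale1r.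
rewrite mxE a0 add0r mxE (bigD1 i) //= big1 ?addr0; last first.
  by move=> j ji; rewrite mxE (negbTE ji) andbF mul0r.
by rewrite !mxE !eqxx mul1r; move: ci; rewrite !mxE.
Qed.

End rV_linear.

(** * Measurability of open sets and of continuous functions *)

Section rV_topology.
Variable R : realType.

Lemma nbhs_rVP n (x : 'rV[R]_n) (U : set 'rV[R]_n) :
  nbhs x U <-> exists2 r : R, 0 < r & forall y : 'rV[R]_n, (forall i, `|y ord0 i - x ord0 i| < r) -> U y.
Proof.
split.
  move=> /nbhs_ballP[r /= r0 rU]; exists r => // y xy; apply: rU; split; [exact: r0|move=> i j].
  by rewrite (ord1 i) /ball /= distrC.
move=> [r r0 rU]; apply/nbhs_ballP; exists r => //= y [_ xy]; apply: rU => i.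
by have := xy ord0 i; rewrite /ball /= distrC.
Qed.

Lemma eq_measurable d (T : measurableType d) (A B : set T) :
  A = B -> measurable B -> measurable A.
Proof. by move=> ->. Qed.

Lemma measurable_cube n (c : 'rV[R]_n) (r : R) :
  measurable [set y : 'rV[R]_n | forall i, `|y ord0 i - c ord0 i| < r].
Proof.
apply: (@eq_measurable _ _ _ (\bigcap_(i in [set: 'I_n]) [set y : 'rV[R]_n | `|y ord0 i - c ord0 i| < r])).
  by apply/seteqP; split => y /= h i; [move=> _; exact: h|exact: h].
apply: fin_bigcap_measurable => // i _.
have mf : measurable_fun setT (fun y : 'rV[R]_n => `|y ord0 i - c ord0 i|).
  apply: measurableT_comp => //.
  by apply: measurable_funB => //; exact: measurable_coord.
apply: (@eq_measurable _ _ _ ((fun y : 'rV[R]_n => `|y ord0 i - c ord0 i|) @^-1` `]-oo, r[%classic)).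
  by apply/seteqP; split => y /=; rewrite in_itv.
exact: measurable_preimage.
Qed.

(** The sigma-algebra is generated by the coordinates, not by the topology, so an open set is
    written as the countable union of the cubes with rational centre and radius 1/(k+1) that it
    contains. *)
Lemma open_measurable_rV n (U : set 'rV[R]_n) : open U -> measurable U.
Proof.
move=> oU.
pose B (p : 'rV[rat]_n * nat) :=
  [set y : 'rV[R]_n | forall i, `|y ord0 i - ratr (p.1 ord0 i)| < p.2.+1%:R^-1].
have mB p : measurable (B p).
  have := measurable_cube (\row_i ratr (p.1 ord0 i)) p.2.+1%:R^-1.
  by congr measurable; apply/seteqP; split => y /= h i; have := h i; rewrite mxE.
apply: (@eq_measurable _ _ _ (\bigcup_(p in [set p | B p `<=` U]) B p)); last first.
  pose F k := if unpickle k is Some p then (if `[< B p `<=` U >] then B p else set0) else set0.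
  rewrite (_ : \bigcup_(p in _) _ = \bigcup_k F k).
    by apply: bigcup_measurable => k _; rewrite /F; case: unpickle => // p; case: ifP.
  apply/seteqP; split => y /= [].
    by move=> p pU By; exists (pickle p) => //; rewrite /F pickleK; case: asboolP.
  move=> k _; rewrite /F; case: unpickle => // p; case: asboolP => // pU By; by exists p.
apply/seteqP; split => [y Uy|y [p pU] /pU //].
have /nbhs_rVP[r r0 rU] : nbhs y U by exact: open_nbhs_nbhs.
(* The radius 1/(k+1) lies below r/2: a cube of this radius that contains y then stays within
   distance r of y. *)
pose k := Num.bound (r^-1 * 2).
have k0 : 0 < k.+1%:R^-1 :> R by rewrite invr_gt0.
have kr : k.+1%:R^-1 * 2 < r.
  have : r^-1 * 2 < k.+1%:R.
    have := archi_boundP (_ : 0 <= r^-1 * 2); rewrite mulr_ge0 ?invr_ge0 ?(ltW r0)// => /(_ isT) h.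
    by apply: lt_trans h _; rewrite ltr_nat.
  by rewrite mulrC ltr_pdivrMl // ltr_pdivrMr // mulrC.
have qi i : exists q : rat, `|y ord0 i - ratr q| < k.+1%:R^-1.
  have := @rat_in_itvoo R (y ord0 i - k.+1%:R^-1) (y ord0 i + k.+1%:R^-1).
  rewrite ltrBlDr -addrA ltrDl addr_gt0 // => /(_ isT)[q]; rewrite in_itv /= => /andP[q1 q2].
  by exists q; rewrite ltr_distlC q1.
have [q qP] := choice qi.
exists (\row_i q i, k); last by move=> i; rewrite mxE.
move=> z Bz; apply: rU => i.
have := Bz i; rewrite /= mxE => h1; have h2 := qP i.
rewrite -[_ - _](subrKA (ratr (q i))); apply: le_lt_trans (ler_normD _ _) _.
apply: lt_trans kr; rewrite mulr_natr mulr2n ltrD //.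
by rewrite distrC.
Qed.

Lemma continuous_measurable_rV n (f : 'rV[R]_n -> R) : continuous f ->
  measurable_fun setT (f : 'rV[R]_n -> measurableTypeR R).
Proof.
move=> cf; apply: (measurability _ (RGenOInfty.measurableE R)) => //.
move=> /= _ [_ [a ->] <-]; rewrite setTI; apply: open_measurable_rV.
by move/continuousP: cf; apply; exact: interval_open.
Qed.

End rV_topology.

(** * Cubes, locally bounded functions and their integrals *)

Section rV_integral.
Variable R : realType.
Notation mu n := (lebesgue_rV R n).
Notation mu1 := (@lebesgue_measure R).

Definition cube n (c : 'rV[R]_n) (r : R) : set 'rV[R]_n :=
  [set y : 'rV[R]_n | forall i, `|y ord0 i - c ord0 i| < r].

Lemma row_mx0l n (x : R) (y : 'rV[R]_n) : row_cons (x, y) ord0 ord0 = x.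
Proof.
have := @row_mxEl R 1 1 n x%:M y ord0 ord0; rewrite [X in _ = X]mxE eqxx mulr1n.
by apply: etrans; rewrite row_consE; congr (row_mx _ _ _ _); exact: val_inj.
Qed.

Lemma row_mx0r n (x : R) (y : 'rV[R]_n) i : row_cons (x, y) ord0 (lift ord0 i) = y ord0 i.
Proof.
have := @row_mxEr R 1 1 n x%:M y ord0 i.
by apply: etrans; rewrite row_consE; congr (row_mx _ _ _ _); exact: val_inj.
Qed.

Lemma lebesgue_cube0 n (r : R) : 0 < r -> mu n (cube 0 r) = ((2 * r) ^+ n)%:E.
Proof.
move=> r0; elim: n => [|n IH].
  rewrite expr0 /= /dirac /= indicE mem_set // => -[] //.
rewrite lebesgue_rV_slice.
transitivity (\int[mu1]_x (((2 * r) ^+ n)%:E * (\1_(`]- r, r[%classic : set (measurableTypeR R)) x)%:E))%E.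
  apply: eq_integral => x _; rewrite indicE; case: (boolP (x \in `]- r, r[%classic)) => [/set_mem|/negP] /=.
    rewrite in_itv /= -ltr_norml => xr; rewrite mule1 -IH; congr (mu n _).
    apply/seteqP; split => y /= h i; first by have := h (lift ord0 i); rewrite row_mx0r !mxE.
    case: (unliftP ord0 i) => [j ->|->]; first by have := h j; rewrite row_mx0r !mxE.
    by rewrite row_mx0l !mxE subr0.
  move=> xr; rewrite mule0 (_ : [set _ | _] = set0) ?measure0 //.
  apply/seteqP; split => y //= h; apply: xr; apply/mem_set => /=.
  by have := h ord0; rewrite row_mx0l !mxE subr0 ltr_norml in_itv.
rewrite ge0_integralZl //=; last 2 first.
  exact/measurable_EFinP/measurable_indic.
  by rewrite lee_fin exprn_ge0 // mulr_ge0 // ltW.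
rewrite integral_indic //= setIT lebesgue_measure_itv /= lte_fin.
rewrite gtrN // -EFinD -EFinM exprS; congr EFin; ring.
Qed.

Lemma lebesgue_cube n c (r : R) : 0 < r -> mu n (cube c r) = ((2 * r) ^+ n)%:E.
Proof.
move=> r0; rewrite -lebesgue_cube0 // -(lebesgue_rV_translate (- c) (measurable_cube 0 r)).
by congr (mu n _); apply/seteqP; split => y /= h i; have := h i; rewrite !mxE subr0 addrC.
Qed.

Definition box_bounded n (S : set 'rV[R]_n) := exists r : R, S `<=` cube 0 r.

Lemma box_boundedS n (S S' : set 'rV[R]_n) : S `<=` S' -> box_bounded S' -> box_bounded S.
Proof. by move=> SS [r S'r]; exists r; exact: subset_trans S'r. Qed.

Lemma cubeS n (c : 'rV[R]_n) r r' : r <= r' -> cube c r `<=` cube c r'.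
Proof. by move=> rr z h i; exact: lt_le_trans (h i) rr. Qed.

Lemma box_boundedP n (S : set 'rV[R]_n) : box_bounded S -> exists2 r : R, 0 < r & S `<=` cube 0 r.
Proof.
move=> [r Sr]; exists (Num.max r 1); first by rewrite lt_max ltr01 orbT.
by apply: subset_trans Sr _; apply: cubeS; rewrite le_max lexx.
Qed.

Lemma box_bounded_cube n (c : 'rV[R]_n) r : box_bounded (cube c r).
Proof.
exists (r + \sum_i `|c ord0 i|) => z zc i; rewrite mxE subr0 -(subrK (c ord0 i) (z ord0 i)).
apply: le_lt_trans (ler_normD _ _) _; apply: ltr_leD (zc i) _.
by rewrite (bigD1 i) //= lerDl sumr_ge0.
Qed.

Lemma box_bounded_lty n (S : set 'rV[R]_n) : measurable S -> box_bounded S -> (mu n S < +oo)%E.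
Proof.
move=> mS /box_boundedP[r r0 Sr].
apply: (@le_lt_trans _ _ (mu n (cube 0 r))).
  by apply: le_measure => //; apply/mem_set => //; exact: measurable_cube.
by rewrite lebesgue_cube // ltry.
Qed.

(** A class closed under sums, products, affine substitution and cutting off by a measurable set,
    whose members are integrable on every bounded measurable set. All integrands built from discrete
    fields belong to it, which reduces integrability to closure rules. *)
Definition mbounded n (f : 'rV[R]_n -> R) :=
  measurable_fun setT (f : 'rV[R]_n -> measurableTypeR R) /\
  forall r : R, exists C : R, forall z, cube 0 r z -> `|f z| <= C.

Lemma mbounded_cst n (a : R) : mbounded (fun _ : 'rV[R]_n => a).
Proof. by split => // r; exists `|a|. Qed.

Lemma mbounded_coord n i : mbounded (fun x : 'rV[R]_n => x ord0 i).
Proof.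
split; first exact: measurable_coord.
by move=> r; exists r => z /(_ i); rewrite mxE subr0 => /ltW.
Qed.

Lemma mboundedD n (f g : 'rV[R]_n -> R) :
  mbounded f -> mbounded g -> mbounded (fun x => f x + g x).
Proof.
move=> [mf bf] [mg bg]; split; first exact: measurable_funD.
move=> r; have [C fC] := bf r; have [C' gC] := bg r; exists (C + C') => z zr.
by apply: le_trans (ler_normD _ _) _; apply: lerD; [exact: fC|exact: gC].
Qed.

Lemma mboundedM n (f g : 'rV[R]_n -> R) :
  mbounded f -> mbounded g -> mbounded (fun x => f x * g x).
Proof.
move=> [mf bf] [mg bg]; split; first exact: measurable_funM.
move=> r; have [C fC] := bf r; have [C' gC] := bg r; exists (C * C') => z zr.
by rewrite normrM; apply: ler_pM => //; [exact: fC|exact: gC].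
Qed.

Lemma mboundedZ n a (f : 'rV[R]_n -> R) : mbounded f -> mbounded (fun x => a * f x).
Proof. by apply: mboundedM; exact: mbounded_cst. Qed.

Lemma mboundedN n (f : 'rV[R]_n -> R) : mbounded f -> mbounded (fun x => - f x).
Proof. by move=> /(mboundedZ (-1)); congr mbounded; apply/funext => x; rewrite mulN1r. Qed.

Lemma mboundedB n (f g : 'rV[R]_n -> R) :
  mbounded f -> mbounded g -> mbounded (fun x => f x - g x).
Proof. by move=> mf /mboundedN; exact: mboundedD. Qed.

Lemma mbounded_sum n I (r : seq I) (P : pred I) (F : I -> 'rV[R]_n -> R) :
  (forall i, P i -> mbounded (F i)) -> mbounded (fun x => \sum_(i <- r | P i) F i x).
Proof.
move=> mF; elim: r => [|i r IH].
  by rewrite (_ : (fun x => _) = fun=> 0); [exact: mbounded_cst|apply/funext => x; rewrite big_nil].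
have [Pi|Pi] := boolP (P i); last first.
  by move: IH; congr mbounded; apply/funext => x; rewrite big_cons (negbTE Pi).
have := mboundedD (mF i Pi) IH.
by congr mbounded; apply/funext => x; rewrite big_cons Pi.
Qed.

Lemma mbounded_affine_comp n p (f : 'rV[R]_p -> R) v (A : 'M[R]_(n, p)) :
  mbounded f -> mbounded (fun z => f (v + z *m A)).
Proof.
move=> [mf bf]; split.
  exact: (measurableT_comp mf (measurable_mulmx A v)).
move=> r.
(* A radius that exceeds every coordinate of v + z A for z in the cube of radius r; the summand 1
   makes the inequality strict. *)
have [C fC] := bf (\sum_j `|v ord0 j| + `|r| * (\sum_j \sum_i `|A i j|) + 1).
exists C => z zr; apply: fC => j.
rewrite !mxE subr0; apply: le_lt_trans (_ : _ <= `|v ord0 j| + `|r| * \sum_i `|A i j|) _.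
  apply: le_trans (ler_normD _ _) _; rewrite lerD2l.
  apply: le_trans (ler_norm_sum _ _ _) _; rewrite mulr_sumr; apply: ler_sum => i _.
  rewrite normrM ler_wpM2r //; have := zr i; rewrite mxE subr0 => /ltW zi.
  by apply: le_trans zi _; exact: ler_norm.
rewrite ltr_pwDr //; apply: lerD.
  by rewrite (bigD1 j) //= lerDl sumr_ge0.
rewrite ler_wpM2l // [leRHS](bigD1 j) //= lerDl; apply: sumr_ge0 => k _; exact: sumr_ge0.
Qed.

Lemma mbounded_continuous n (f : 'rV[R]_n -> R) : continuous f -> mbounded f.
Proof.
move=> cf; split; first exact: continuous_measurable_rV.
move=> r.
have cK : compact [set y : 'rV[R]_n | forall i, `[- r, r]%classic (y ord0 i)].
  exact: (@rV_compact _ n (fun=> `[- r, r]%classic) (fun=> @segment_compact R (- r) r)).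
have /compact_bounded[M [_ hM]] : compact (f @` [set y : 'rV[R]_n | forall i, `[- r, r]%classic (y ord0 i)]).
  by apply: continuous_compact => //; exact: continuous_subspaceT.
exists (`|M| + 1) => z zr; apply: (hM (`|M| + 1)).
  by apply: le_lt_trans (ler_norm M) _; rewrite ltrDl.
exists z => //= i; have := zr i; rewrite mxE subr0 ltr_norml in_itv /= => /andP[z1 z2].
by rewrite !ltW.
Qed.

Lemma mbounded_indic n (S : set 'rV[R]_n) (f : 'rV[R]_n -> R) : measurable S ->
  mbounded f -> mbounded (fun x => if x \in S then f x else 0).
Proof.
move=> mS mf.
have -> : (fun x => if x \in S then f x else 0) = (fun x => \1_S x * f x).
  by apply/funext => x; rewrite indicE; case: ifP => _; rewrite ?mul1r ?mul0r.
apply: mboundedM => //; split; first exact: measurable_indic.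
by move=> r; exists 1 => z _; rewrite indicE; case: (_ \in _); rewrite ?normr1 ?normr0.
Qed.

Lemma mbounded_integrable n (S : set 'rV[R]_n) f : measurable S -> box_bounded S ->
  mbounded f -> (mu n).-integrable S (EFin \o f).
Proof.
move=> mS bS [mf bf]; apply: measurable_bounded_integrable => //.
- exact: box_bounded_lty.
- exact: measurable_funTS.
- have [r Sr] := bS; have [C fC] := bf r; exists C; split; first exact: num_real.
  move=> M CM z Sz.
  by apply: le_trans (ltW CM); apply: fC; exact: Sr.
Qed.

Lemma lebesgue_rV_affine n v (A : 'M[R]_n) S : A \in unitmx -> measurable S ->
  (mu n [set z | S (v + z *m A)%R] = (`|\det A|^-1)%R%:E * mu n S)%E.
Proof.
move=> uA mS; rewrite -(lebesgue_rV_translate v mS) -(lebesgue_rV_linear uA) //.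
exact: measurable_translate_preimage.
Qed.

Lemma ge0_integral_affine n v (A : 'M[R]_n) S (f : 'rV[R]_n -> \bar R) :
  A \in unitmx -> measurable S -> measurable_fun setT f -> (forall x, 0 <= f x)%E ->
  (\int[mu n]_(z in [set z | S (v + z *m A)%R]) f (v + z *m A)%R =
  (`|\det A|^-1)%R%:E * \int[mu n]_(x in S) f x)%E.
Proof.
move=> uA mS mf f0.
have na : 0 <= `|\det A|^-1 by rewrite invr_ge0.
transitivity (\int[pushforward (mu n) (fun z => v + z *m A)%R]_(x in S) f x)%E.
  rewrite ge0_integral_pushforward //; first exact: measurable_mulmx.
  exact: measurable_funTS.
transitivity (\int[mscale (NngNum na) (mu n)]_(x in S) f x)%E.
  apply: eq_measure_integral; first exact: measurable_mulmx.
  move=> mF B mB _; exact: lebesgue_rV_affine.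
by rewrite ge0_integral_mscale //; exact: measurable_funTS.
Qed.

(** Positive and negative parts are transformed separately; integrability of f keeps their
    difference finite. *)
Lemma Rintegral_affine n v (A : 'M[R]_n) S (f : 'rV[R]_n -> R) :
  A \in unitmx -> measurable S -> measurable_fun setT (f : 'rV[R]_n -> measurableTypeR R) ->
  (mu n).-integrable S (EFin \o f) ->
  \int[mu n]_(z in [set z | S (v + z *m A)]) f (v + z *m A) =
  `|\det A|^-1 * \int[mu n]_(x in S) f x.
Proof.
move=> uA mS mf intf.
have mf' : measurable_fun setT (EFin \o f) by exact/measurable_EFinP.
rewrite /Rintegral integralE [in RHS]integralE.
under eq_integral do rewrite (funepos_comp (EFin \o f) (fun z => v + z *m A)) /=.
under [X in (_ - X)%E]eq_integral do rewrite (funeneg_comp (EFin \o f) (fun z => v + z *m A)) /=.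
rewrite (ge0_integral_affine v uA mS (measurable_funepos mf')) //.
rewrite (ge0_integral_affine v uA mS (measurable_funeneg mf')) //.
have fp := integrable_fin_num mS (integrable_funepos mS intf).
have fn := integrable_fin_num mS (integrable_funeneg mS intf).
rewrite -muleBr //; last by apply: fin_num_adde_defl; rewrite fin_numN.
by rewrite fineM // fin_numB fp fn.
Qed.

Lemma Rintegral_gt0 n (S : set 'rV[R]_n) f c r e : measurable S ->
  (mu n).-integrable S (EFin \o f) -> (forall x, S x -> 0 <= f x) ->
  0 < r -> 0 < e -> cube c r `<=` S -> (forall x, cube c r x -> e <= f x) ->
  0 < \int[mu n]_(x in S) f x.
Proof.
move=> mS intf f0 r0 e0 cS ef.
have mc := measurable_cube c r.
apply: (@lt_le_trans _ _ (\int[mu n]_(x in cube c r) e)).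
  rewrite Rintegral_cst // mulr_gt0 //.
  by rewrite [ltRHS](congr1 fine (lebesgue_cube c r0)) exprn_gt0 // mulr_gt0.
apply: (@le_trans _ _ (\int[mu n]_(x in cube c r) f x)).
  apply: le_Rintegral => //.
    by apply: mbounded_integrable => //; [exact: box_bounded_cube|exact: mbounded_cst].
  exact: integrableS intf.
rewrite -(setDUK cS) Rintegral_setU //.
- by rewrite lerDl Rintegral_ge0 // => x [Sx _]; exact: f0.
- exact: measurableD.
- by rewrite setDUK.
- by apply/disj_setPS => x [? []].
Qed.

End rV_integral.

Lemma Rintegral_sum d (X : measurableType d) (R : realType) (m : {measure set X -> \bar R}) (S : set X) J (r : seq J) (P : pred J) (F : J -> X -> R) :
  measurable S -> (forall k, P k -> m.-integrable S (EFin \o F k)) ->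
  \int[m]_(x in S) (\sum_(k <- r | P k) F k x) = \sum_(k <- r | P k) \int[m]_(x in S) F k x.
Proof.
move=> mS iF.
have i0 s : m.-integrable S (EFin \o (fun x => \sum_(k <- s | P k) F k x)).
  have := @integrable_sum _ _ _ m S mS _ s P (fun k => EFin \o F k) iF.
  by congr (_.-integrable _ _); apply/funext => x /=; rewrite sumEFin.
elim: r => [|k r IH].
  rewrite big_nil (@eq_Rintegral _ _ _ _ _ (fun=> 0)) ?Rintegral_cst ?mul0r // => x _.
  by rewrite big_nil.
rewrite big_cons; case: ifPn => Pk.
  rewrite -IH -RintegralD //; last exact: iF.
  by apply: eq_Rintegral => x _; rewrite big_cons Pk.
by rewrite -IH; apply: eq_Rintegral => x _; rewrite big_cons (negbTE Pk).
Qed.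

Lemma bounded_set_box (R : realType) n (S : set 'rV[R]_n) : bounded_set S -> box_bounded S.
Proof.
move=> [M [_ hM]]; exists (`|M| + 2) => x Sx i.
have : ball 0 (`|M| + 2) x.
  rewrite -ball_normE /ball_ /= sub0r normrN.
  apply: (@le_lt_trans _ _ (`|M| + 1)); last by rewrite ltrD2l ltr1n.
  apply: hM => //; apply: le_lt_trans (ler_norm M) _; by rewrite ltrDl.
move=> [_ /(_ ord0 i)]; by rewrite /ball /= distrC.
Qed.

(** * Simplices *)

Section dotv.
Variables (R : realType) (d : nat).
Implicit Types u v w : 'rV[R]_d.

Lemma dotvE u v : dotv u v = (u *m v^T) ord0 ord0.
Proof. by rewrite mxE; apply: eq_bigr => i _; rewrite mxE. Qed.

Lemma dotvC u v : dotv u v = dotv v u.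
Proof. by apply: eq_bigr => i _; rewrite mulrC. Qed.

Lemma dotvDl u v w : dotv (u + v) w = dotv u w + dotv v w.
Proof. by rewrite -big_split; apply: eq_bigr => i _; rewrite mxE mulrDl. Qed.

Lemma dotvZl (a : R) u v : dotv (a *: u) v = a * dotv u v.
Proof. by rewrite /dotv mulr_sumr; apply: eq_bigr => i _; rewrite mxE mulrA. Qed.

Lemma dotvDr u v w : dotv w (u + v) = dotv w u + dotv w v.
Proof. by rewrite !(dotvC w) dotvDl. Qed.

Lemma dotvZr (a : R) u v : dotv u (a *: v) = a * dotv u v.
Proof. by rewrite !(dotvC u) dotvZl. Qed.

Lemma dotvNl u v : dotv (- u) v = - dotv u v.
Proof. by rewrite -scaleN1r dotvZl mulN1r. Qed.

Lemma dotvNr u v : dotv u (- v) = - dotv u v.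
Proof. by rewrite dotvC dotvNl dotvC. Qed.

Lemma dotvBl u v w : dotv (u - v) w = dotv u w - dotv v w.
Proof. by rewrite dotvDl dotvNl. Qed.

Lemma dotvBr u v w : dotv w (u - v) = dotv w u - dotv w v.
Proof. by rewrite dotvDr dotvNr. Qed.

Lemma dotv0l u : dotv 0 u = 0.
Proof. by rewrite -(scale0r 0) dotvZl mul0r. Qed.

Lemma dotv0r u : dotv u 0 = 0.
Proof. by rewrite dotvC dotv0l. Qed.

Lemma dotv_suml I (r : seq I) (P : pred I) (F : I -> 'rV[R]_d) u :
  dotv (\sum_(i <- r | P i) F i) u = \sum_(i <- r | P i) dotv (F i) u.
Proof. by elim/big_rec2: _ => [|i x y _ <-]; rewrite ?dotv0l ?dotvDl. Qed.

Lemma dotv_sumr I (r : seq I) (P : pred I) (F : I -> 'rV[R]_d) u :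
  dotv u (\sum_(i <- r | P i) F i) = \sum_(i <- r | P i) dotv u (F i).
Proof. by rewrite dotvC dotv_suml; apply: eq_bigr => i _; rewrite dotvC. Qed.

Lemma dotv_ge0 u : 0 <= dotv u u.
Proof. by apply: sumr_ge0 => i _; rewrite -expr2 sqr_ge0. Qed.

Lemma dotv_eq0 u : (dotv u u == 0) = (u == 0).
Proof.
apply/eqP/eqP => [uu|->]; last by rewrite dotv0l.
apply/rowP => i; rewrite mxE.
move/eqP: uu; rewrite psumr_eq0 => [/allP /(_ i (mem_index_enum _)) /=|j _].
  by rewrite mulf_eq0 orbb => /eqP.
by rewrite -expr2 sqr_ge0.
Qed.

Lemma dotv_gt0 u : (0 < dotv u u) = (u != 0).
Proof. by rewrite lt_def dotv_ge0 andbT dotv_eq0. Qed.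

Lemma norm2_gt0 u : (0 < norm2 u) = (u != 0).
Proof. by rewrite sqrtr_gt0 dotv_gt0. Qed.

Lemma norm2_sqr u : norm2 u ^+ 2 = dotv u u.
Proof. by rewrite sqr_sqrtr // dotv_ge0. Qed.

Lemma mul_dotv m (A : 'M[R]_(m, d)) u k :
  (A *m u^T) k ord0 = dotv (row k A) u.
Proof. by rewrite mxE; apply: eq_bigr => i _; rewrite !mxE. Qed.

Lemma continuous_sum (I : Type) (r : seq I) (P : pred I) (F : I -> 'rV[R]_d -> R) :
  (forall i, continuous (F i)) -> continuous (fun x => \sum_(i <- r | P i) F i x).
Proof.
move=> cF; elim: r => [|i r IH] x.
  rewrite (_ : (fun x => _) = fun=> 0); last by apply/funext => y; rewrite big_nil.
  exact: cst_continuous.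

have [Pi|Pi] := boolP (P i).
  rewrite (_ : (fun x => _) = fun x => F i x + \sum_(i <- r | P i) F i x).
    by apply: continuousD; [exact: cF|exact: IH].
  by apply/funext => y; rewrite big_cons Pi.
rewrite (_ : (fun x => _) = fun x => \sum_(i <- r | P i) F i x); first exact: IH.
by apply/funext => y; rewrite big_cons (negbTE Pi).
Qed.

Lemma continuous_dotv u : continuous (dotv u).
Proof.
apply: continuous_sum => i x; apply: continuousM; first exact: cst_continuous.
exact: coord_continuous.
Qed.

End dotv.

(** * Barycentric coordinates of a cell *)

Section barycentric.
Variables (R : realType) (n : nat) (K : mesh R n.+1).
Local Notation I := 'I_(nverts K).
Local Notation vset := {set I}.
Local Notation Rd := 'rV[R]_n.+1.
Implicit Types (T F : vset) (i j : I) (x y : Rd).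

Definition cell_like T := #|T| = n.+2 /\ affinely_free (K := K) T.

Lemma sum_over_enum (V : nmodType) (A : vset) (g : I -> V) m i0 : #|A| = m ->
  \sum_(i in A) g i = \sum_(k < m) g (nth i0 (enum A) k).
Proof. by move=> <-; rewrite -big_enum (big_nth i0) big_mkord -cardE. Qed.

(** The rows are (1, v) for the vertices v of T, so the barycentric coordinates of x form the row y
    that solves y B = (1, x). They are ordered as in [enum T], whence the [index] in [bary]. *)
Definition bary_mx T : 'M[R]_(1 + n.+1) :=
  \matrix_(k < n.+2) (row_mx (1 : 'M[R]_1) (nth 0 [seq vtx i | i <- enum T] k)).

Definition bary T i x : R :=
  (row_mx (1 : 'M[R]_1) x *m invmx (bary_mx T)) ord0 (inord (index i (enum T))).

(** A barycentric coordinate is affine in x; the lower block of the inverse matrix holds its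
    constant gradient. *)
Definition bary_grad T i : Rd :=
  \row_k dsubmx (invmx (bary_mx T)) k (inord (index i (enum T))).

Lemma card_gt0_witness T m : #|T| = m.+1 -> exists i, i \in T.
Proof. by move=> cT; apply/card_gt0P; rewrite cT. Qed.

Lemma nth_vtx (A : vset) i0 k : (k < #|A|)%N ->
  nth 0 [seq vtx i | i <- enum A] k = vtx (nth i0 (enum A) k).
Proof. by move=> kA; rewrite (nth_map i0) // -cardE. Qed.

Lemma mul_bary_mx T (c : I -> R) (y : 'rV[R]_n.+2) : #|T| = n.+2 ->
  (forall i, i \in T -> y ord0 (inord (index i (enum T))) = c i) ->
  y *m bary_mx T = row_mx (\sum_(i in T) c i)%:M (\sum_(i in T) c i *: vtx i).
Proof.
move=> cT yc.
have [i0 _] := card_gt0_witness cT.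
have yk (k : 'I_n.+2) : y ord0 k = c (nth i0 (enum T) k).
  have kT : (k < size (enum T))%N by rewrite -cardE cT.
  rewrite -yc; last by rewrite -mem_enum mem_nth.
  by rewrite index_uniq ?enum_uniq // inord_val.
rewrite mulmx_sum_row !(sum_over_enum _ i0 cT).
rewrite (eq_bigr (fun k : 'I_n.+2 => row_mx (c (nth i0 (enum T) k))%:M (c (nth i0 (enum T) k) *: vtx (nth i0 (enum T) k)))).
  elim/big_rec3: _ => [|k r s t _ ->]; first by rewrite raddf0 row_mx0.
  by rewrite add_row_mx raddfD.
move=> k _; rewrite yk rowK (@nth_vtx _ i0) ?cT //.
rewrite scale_row_mx; congr row_mx.
by rewrite -mul_scalar_mx mulmx1.
Qed.

(** A row in the left kernel is a family of coefficients with zero sum and zero combination of the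
    vertices, which affine independence excludes. *)
Lemma bary_mx_unit T : cell_like T -> bary_mx T \in unitmx.
Proof.
move=> [cT fT]; rewrite -row_free_unit -kermx_eq0; apply/eqP/row_matrixP => k.
have : row k (kermx (bary_mx T)) *m bary_mx T = 0 by apply/sub_kermxP; exact: row_sub.
set y := row k _ => y0; rewrite row0.
have [i0 _] := card_gt0_witness cT.
pose c i := y ord0 (inord (index i (enum T))).
have E := @mul_bary_mx T c y cT (fun _ _ => erefl).
rewrite y0 -[LHS]row_mx0 in E; have [c1 c2] := eq_row_mx E.
have {}c1 : \sum_(i in T) c i = 0.
  by move/matrixP: c1 => /(_ ord0 ord0); rewrite !mxE eqxx mulr1n.
have c0 := fT c c1 (esym c2).
apply/rowP => l; rewrite [RHS]mxE.
have lT : (l < size (enum T))%N by rewrite -cardE cT.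
have : nth i0 (enum T) l \in T by rewrite -mem_enum mem_nth.
by move=> /c0; rewrite /c (index_uniq i0 lT (enum_uniq _)) inord_val => ->.
Qed.

Lemma bary_sum T x : cell_like T ->
  \sum_(i in T) bary T i x = 1 /\ \sum_(i in T) bary T i x *: vtx i = x.
Proof.
move=> cT.
have := @mul_bary_mx T (bary T ^~ x) (row_mx (1 : 'M[R]_1) x *m invmx (bary_mx T)) cT.1 (fun _ _ => erefl).
rewrite mulmxKV; last exact: bary_mx_unit.
move=> /eq_row_mx[c1 c2]; split; last by [].
by move/matrixP: c1 => /(_ ord0 ord0); rewrite !mxE eqxx mulr1n.
Qed.

Lemma baryE T (c : I -> R) i : cell_like T -> \sum_(j in T) c j = 1 -> i \in T ->
  bary T i (\sum_(j in T) c j *: vtx j) = c i.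
Proof.
move=> cT c1 iT; have [i0 _] := card_gt0_witness cT.1.
pose y : 'rV[R]_n.+2 := \row_k c (nth i0 (enum T) k).
have yc j : j \in T -> y ord0 (inord (index j (enum T))) = c j.
  move=> jT; rewrite mxE inordK ?nth_index ?mem_enum //.
  by rewrite -cT.1 cardE index_mem mem_enum.
have := @mul_bary_mx T c y cT.1 yc; rewrite c1 => E.
by rewrite /bary -E mulmxK ?bary_mx_unit // yc.
Qed.

Lemma bary_affine T i x y : bary T i x - bary T i y = dotv (bary_grad T i) (x - y).
Proof.
rewrite /bary -[invmx _](@vsubmxK _ 1 n.+1) !mul_row_col.
rewrite [X in X - _ = _]mxE [X in _ - X = _]mxE opprD addrACA subrr add0r.
rewrite dotvC /dotv !mxE -sumrB.
by apply: eq_bigr => k _; rewrite !mxE mulrBl.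
Qed.

Lemma baryB T i x y : bary T i x = bary T i y + dotv (bary_grad T i) (x - y).
Proof. by rewrite -bary_affine addrC subrK. Qed.

Lemma bary_vtx T i j : cell_like T -> i \in T -> j \in T -> bary T i (vtx j) = (i == j)%:R.
Proof.
move=> cT iT jT; rewrite -(@baryE T (fun k => (k == j)%:R) i cT) //.
  congr bary; rewrite (bigD1 j) //= eqxx scale1r big1 ?addr0 // => k /andP[_ /negbTE ->].
  by rewrite scale0r.
by rewrite (bigD1 j) //= eqxx big1 ?addr0 // => k /andP[_ /negbTE ->].
Qed.

Lemma bary_grad_vtx T i j k : cell_like T -> i \in T -> j \in T -> k \in T ->
  dotv (bary_grad T i) (vtx j - vtx k) = (i == j)%:R - (i == k)%:R.
Proof. by move=> cT iT jT kT; rewrite -bary_affine !bary_vtx. Qed.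

Lemma continuous_bary T i : continuous (bary T i).
Proof.
have -> : bary T i = fun x => bary T i 0 + dotv (bary_grad T i) x.
  by apply/funext => x; rewrite (baryB T i x 0) subr0.
move=> x; apply: (@continuousD _ _ _ (fun=> bary T i 0) (dotv (bary_grad T i))).
  exact: cst_continuous.
exact: continuous_dotv.
Qed.

Lemma simplexE T : cell_like T ->
  simplex T = [set x | forall i, i \in T -> 0 <= bary T i x].
Proof.
move=> cT; apply/seteqP; split => x /=.
  by move=> [c [c0 c1 ->]] i iT; rewrite baryE.
move=> x0; have [s1 sx] := bary_sum x cT.
exists (fun i => if i \in T then bary T i x else 0); split.
- by move=> i; case: ifP => // /x0.
- by rewrite -[RHS]s1; apply: eq_bigr => i ->.
- by rewrite -[LHS]sx; apply: eq_bigr => i ->.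
Qed.

Lemma near_bary_gt0 T i x : 0 < bary T i x -> \forall y \near x, 0 < bary T i y.
Proof.
move=> i0; have := @continuous_bary T i x.
move=> /cvgrPdist_lt /(_ _ i0); apply: filterS => y.
rewrite ltr_distlC => /andP[+ _]; by rewrite subrr.
Qed.

Lemma open_bary_gt0 T (A : vset) : open [set x | forall i, i \in A -> 0 < bary T i x].
Proof.
rewrite openE => x /= hx; apply: (@filter_forall _ _ (fun i y => i \in A -> 0 < bary T i y) (nbhs x)) => i.
have [iA|iA] := boolP (i \in A).
  by apply: filterS (near_bary_gt0 (hx i iA)) => y.
by apply: nearW => y.
Qed.

Lemma interior_simplex T : cell_like T ->
  (simplex T)° = [set x | forall i, i \in T -> 0 < bary T i x].
Proof.
move=> cT; apply/seteqP; split => x.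
  rewrite simplexE // => xT i iT /=.
  rewrite lt_def; apply/andP; split; last by have := nbhs_singleton xT; exact.
  apply/negP => /eqP xi.
  (* If the i-th coordinate vanishes at x, it equals -s at x + s (x - v_i), so the point leaves the
     simplex as soon as it moves away from the vertex v_i. *)
  have : \forall s \near (0 : R), [set x | forall i, i \in T -> 0 <= bary T i x] (x + s *: (x - vtx i)).
    have c : {for 0, continuous (fun s : R => x + s *: (x - vtx i))}.
      apply: continuousD; first exact: cst_continuous.
      exact: scalel_continuous.
    by apply: c; rewrite scale0r addr0.
  move=> /nbhs_ballP[e /= e0 h]; have := h (e / 2).
  rewrite /ball /= sub0r normrN gtr0_norm ?divr_gt0 // ltr_pdivrMr // ltr_pMr // ltr1n => /(_ isT i iT).
  rewrite (baryB T i _ x) [x + _]addrC addrK dotvZr -(bary_affine T i) xi bary_vtx // eqxx add0r sub0r mulrN1.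
  by rewrite oppr_ge0 leNgt divr_gt0.
move=> xT; apply: (@filterS _ _ _ [set x | forall i, i \in T -> 0 < bary T i x]).
  by rewrite simplexE // => y h i iT; exact/ltW/h.
by apply: open_nbhs_nbhs; split => //; exact: open_bary_gt0.
Qed.

Lemma measurable_simplex T : cell_like T -> measurable (simplex T).
Proof.
move=> cT; rewrite simplexE //.
apply: (@eq_measurable _ _ _ (\bigcap_(i in [set` T]) (bary T i @^-1` `[0, +oo[%classic))).
  apply/seteqP; split => x /= h i iT; have := h i iT; by rewrite /= ?in_itv /= ?andbT.
apply: fin_bigcap_measurable => // i _.
apply: measurable_preimage; last exact: measurable_itv.
exact: (mbounded_continuous (@continuous_bary T i)).1.
Qed.

Lemma closed_simplex T : cell_like T -> closed (simplex T).
Proof.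
move=> cT; rewrite simplexE // => x xT i iT.
rewrite leNgt; apply/negP => xi.
have : \forall y \near x, bary T i y < 0.
  have := @continuous_bary T i x.
  move=> /cvgrPdist_lt /(_ (- bary T i x)); rewrite oppr_gt0 => /(_ xi); apply: filterS => y.
  by rewrite ltr_distlC => /andP[_]; rewrite subrr.
move=> /xT[y [/(_ i iT) yi]]; by rewrite ltNge yi.
Qed.

Lemma box_bounded_simplex T : box_bounded (simplex T).
Proof.
exists (\sum_j \sum_(i in T) `|vtx i ord0 j| + 1) => x [c [c0 c1 ->]] j.
rewrite mxE subr0 summxE; apply: le_lt_trans (ler_norm_sum _ _ _) _.
rewrite ltr_pwDr //; apply: (@le_trans _ _ (\sum_(i in T) `|vtx i ord0 j|)).
  apply: ler_sum => i iT; rewrite mxE normrM ler_piMl // ger0_norm //.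
  by rewrite -c1 (bigD1 i) //= lerDl sumr_ge0.
by rewrite [leRHS](bigD1 j) //= lerDl; apply: sumr_ge0 => k _; exact: sumr_ge0.
Qed.

End barycentric.

(** * The reference simplex *)

Section reference_simplex.
Variable R : realType.
Notation mu n := (lebesgue_rV R n).

Lemma measurable_ref_simplex n : measurable (@ref_simplex R n.+1).
Proof.
apply: (@eq_measurable _ _ _ ((\bigcap_(i in [set: 'I_n]) ((fun t : 'rV[R]_n => t ord0 i) @^-1` `[0, +oo[%classic)) `&`
  ((fun t : 'rV[R]_n => \sum_i t ord0 i) @^-1` `]-oo, 1]%classic))).
  apply/seteqP; split => t /=.
    by move=> [t0 t1]; split; [move=> i _; rewrite /= in_itv /= t0|rewrite in_itv].
  move=> [t0 t1]; split; last by move: t1; rewrite in_itv.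
  by move=> i; have := t0 i I; rewrite /= in_itv /= andbT.
apply: measurableI.
  apply: fin_bigcap_measurable => // i _.
  by apply: measurable_preimage; [exact: measurable_coord|exact: measurable_itv].
apply: measurable_preimage; last exact: measurable_itv.
by apply: measurable_sum => i; exact: measurable_coord.
Qed.

Lemma box_bounded_ref_simplex n : box_bounded (@ref_simplex R n.+1).
Proof.
exists 2 => t [t0 t1] i; rewrite mxE subr0 ger0_norm //.
apply: le_lt_trans (_ : _ <= 1) _; last by rewrite ltr1n.
by apply: le_trans t1; rewrite (bigD1 i) //= lerDl sumr_ge0.
Qed.

Lemma cube_ref_simplex n : exists c r, 0 < r /\ cube c r `<=` @ref_simplex R n.+1.
Proof.
(* In the cube with centre (r, ..., r) and radius r every coordinate lies between 0 and 1/(n+1), so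
   n of them sum to at most 1. Dividing by n+1 covers n = 0 as well. *)
pose r : R := (2 * n.+1%:R)^-1.
have r0 : 0 < r by rewrite invr_gt0 mulr_gt0.
have rr : r + r = n.+1%:R^-1.
  by rewrite /r invfM -mulrDl -[2^-1]div1r -splitr mul1r.
exists (const_mx r), r; split => // t tr.
have ti i : 0 < t ord0 i < n.+1%:R^-1.
  have := tr i; rewrite mxE ltr_distl subrr => /andP[-> /= h].
  by rewrite -rr.
split; first by move=> i; have /andP[/ltW] := ti i.
apply: le_trans (_ : \sum_(i < n) n.+1%:R^-1 <= 1).
  by apply: ler_sum => i _; have /andP[_ /ltW] := ti i.
rewrite sumr_const card_ord -[_ *+ n]mulr_natl ler_pdivrMr // mul1r ler_nat leqnSn //.
Qed.

(** The volume 1/n! of the unit simplex of R^n, kept as an unevaluated constant. The index shifts: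
    [ref_simplex] at n.+1 has dimension n. *)
Definition ref_vol n : R := fine (mu n (@ref_simplex R n.+1)).

Lemma ref_vol_gt0 n : 0 < ref_vol n.
Proof.
have [c [r [r0 cr]]] := cube_ref_simplex n.
have := @Rintegral_gt0 R n (@ref_simplex R n.+1) (fun=> 1) c r 1 (@measurable_ref_simplex n).
rewrite Rintegral_cst; last exact: measurable_ref_simplex.
rewrite mul1r; apply => //.
apply: mbounded_integrable; [exact: measurable_ref_simplex|exact: box_bounded_ref_simplex|exact: mbounded_cst].
Qed.

End reference_simplex.

(** * Edge frames: affine parametrization of a cell adapted to one of its faces *)

Section frames.
Variables (R : realType) (n : nat) (K : mesh R n.+1).
Local Notation I := 'I_(nverts K).
Local Notation vset := {set I}.
Local Notation Rd := 'rV[R]_n.+1.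
Notation mu n := (lebesgue_rV R n).
Implicit Types (T F : vset) (i j o : I) (x y : Rd).

Lemma face_enum F : #|F| = n.+1 -> exists e : 'I_n.+1 -> I,
  [/\ injective e, forall k, e k \in F, forall k : 'I_n.+1, face_pt F k = vtx (e k) &
      forall (V : nmodType) (g : I -> V), \sum_(i in F) g i = \sum_k g (e k)].
Proof.
move=> cF; have [i0 _] := card_gt0_witness cF.
have sz : size (enum F) = n.+1 by rewrite -cardE.
exists (fun k => nth i0 (enum F) k); split.
- move=> k l /eqP; rewrite nth_uniq ?enum_uniq ?sz // => /eqP; exact: val_inj.
- by move=> k; rewrite -mem_enum mem_nth // sz.
- by move=> k; rewrite /face_pt (@nth_vtx _ _ _ _ i0) // cF.
- by move=> V g; exact: sum_over_enum.
Qed.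

(** Edges from the first vertex of F, the one to the opposite vertex o in the first row. In these
    coordinates the first one is the barycentric coordinate of o, and F lies in the hyperplane where
    it vanishes. *)
Definition frame o F : 'M[R]_(1 + n, n.+1) :=
  col_mx (vtx o - face_pt F 0) (face_jac F).

Lemma facesP T F : #|T| = n.+2 -> F \in faces_of T ->
  #|F| = n.+1 /\ exists o, [/\ o \in T, o \notin F & T = o |: F].
Proof.
move=> cT; rewrite inE => /andP[FT /eqP cF]; split => //.
have : (0 < #|T :\: F|)%N.
  by rewrite cardsD (finset.setIidPr FT) cT cF subSnn.
case/card_gt0P => o; rewrite inE => /andP[oF oT]; exists o; split => //.
apply/eqP; rewrite eq_sym eqEcard finset.subUset finset.sub1set oT FT /= cardsU1 oF cF cT.
by [].
Qed.

(** The barycentric gradients are dual to the edges: put as columns into [A] they give an inverse of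
    the frame, and they identify the frame coordinates with the barycentric ones, except for the
    base vertex, whose coordinate is 1 minus the sum of the others. *)
Lemma frame_inverse T F o : cell_like T -> #|F| = n.+1 -> o \in T -> o \notin F -> T = o |: F ->
  frame o F \in unitmx /\
  forall z, simplex T (face_pt F 0 + z *m frame o F) <-> @ref_simplex R n.+2 z.
Proof.
move=> cT cF oT oF TF; have [e [e_inj eF pe sumF]] := face_enum cF.
have eT k : e k \in T by rewrite TF inE eF orbT.
have oe k : (o == e k) = false by apply/negP => /eqP oek; rewrite oek eF in oF.
pose idx (l : 'I_(1 + n)) : I := match fintype.split l with inl _ => o | inr k => e (lift ord0 k) end.
have idxT l : idx l \in T by rewrite /idx; case: fintype.split.
have idx0 l : (idx l == e ord0) = false.
  rewrite /idx; case: fintype.split => k; first exact: oe.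
  by apply/negP => /eqP/e_inj/eqP; rewrite eq_sym (negbTE (neq_lift _ _)).
have idx_inj k l : (idx k == idx l) = (k == l).
  apply/eqP/eqP => [|-> //]; rewrite /idx.
  case: (@splitP 1 n k) => k' kk'; case: (@splitP 1 n l) => l' ll'.
  - by move=> _; apply: val_inj; rewrite /= kk' ll' (ord1 k') (ord1 l').
  - by move/eqP; rewrite oe.
  - by move/esym/eqP; rewrite oe.
  - move/e_inj/lift_inj => kl; apply: val_inj; by rewrite /= kk' ll' kl.
have p0 : face_pt F 0 = vtx (e ord0) by exact: (pe ord0).
have row_frame l : row l (frame o F) = vtx (idx l) - vtx (e ord0).
  rewrite /frame /idx; apply/rowP => j; rewrite mxE mxE.
  case: (@splitP 1 n l) => k lk; first by rewrite p0 (ord1 k).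
  by rewrite mxE !mxE (pe (lift ord0 k)) p0.
pose A : 'M[R]_(n.+1, 1 + n) := \matrix_(k, l) bary_grad T (idx l) ord0 k.
have MA : frame o F *m A = 1%:M.
  apply/matrixP => k l.
  have -> : (frame o F *m A) k l = dotv (bary_grad T (idx l)) (row k (frame o F)).
    by rewrite mxE; apply: eq_bigr => j _; rewrite !mxE mulrC.
  rewrite row_frame bary_grad_vtx // idx0 subr0 idx_inj mxE eq_sym //.
split; first by have [] := mulmx1_unit MA.
move=> z; pose x := face_pt F 0 + z *m frame o F.
have bz l : bary T (idx l) x = z ord0 l.
  rewrite (baryB T _ _ (face_pt F 0)) /x (addrC (face_pt F 0)) addrK p0 bary_vtx // idx0 add0r.
  have -> : z ord0 l = (z *m frame o F *m A) ord0 l by rewrite -mulmxA MA mulmx1.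
  by rewrite [RHS]mxE; apply: eq_bigr => j _; rewrite [A j l]mxE mulrC.
have sumT (g : I -> R) : \sum_(i in T) g i = g (e ord0) + \sum_l g (idx l).
  rewrite TF big_setU1 //= sumF big_ord_recl addrCA; congr (_ + _).
  rewrite (@big_split_ord _ _ _ 1 n) /= big_ord1; congr (_ + _).
    by rewrite /idx (unsplitK (inl ord0)).
  by apply: eq_bigr => k _; rewrite /idx (unsplitK (inr k)).
have b0 : bary T (e ord0) x = 1 - \sum_l z ord0 l.
  have [<- _] := bary_sum x cT; rewrite sumT.
  by rewrite (eq_bigr (fun l => z ord0 l)) ?addrK // => l _; rewrite bz.
rewrite -/x simplexE //=; split.
  move=> h; split; first by move=> l; rewrite -bz h.
  by rewrite -subr_ge0 -b0 h.
move=> [z0 z1] i; rewrite {1}TF in_setU1 => /orP[/eqP ->|].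
  have oE : o = idx (lshift n ord0) by rewrite /idx (unsplitK (inl ord0)).
  by rewrite [X in bary T X]oE bz z0.
move=> iF.
have [k ->] : exists k, i = e k.
  apply: contrapT => /forallNP h.
  have := sumF R (fun j => (j == i)%:R); rewrite (bigD1 i) //= eqxx big1 => [|j /andP[_ /negbTE -> //]].
  rewrite big1 => [|k _]; last by case: eqP => // eki; case: (h k).
  by move/eqP; rewrite addr0 oner_eq0.
case: (unliftP ord0 k) => [l ->|->]; last by rewrite b0 subr_ge0.
have -> : e (lift ord0 l) = idx (rshift 1 l) by rewrite /idx (unsplitK (inr l)).
by rewrite bz z0.
Qed.

Definition vol T : R := fine (mu n.+1 (simplex T)).

(** The surface measure of F, that is, [face_int] of the constant 1: the Gram factor times the
    volume of the reference simplex of dimension d - 1. *)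
Definition area F : R :=
  Num.sqrt (\det (face_jac F *m (face_jac F)^T)) * ref_vol R n.

Lemma vol_frame T F o : cell_like T -> #|F| = n.+1 -> o \in T -> o \notin F -> T = o |: F ->
  vol T = `|\det (frame o F)| * ref_vol R n.+1.
Proof.
move=> cT cF oT oF TF.
have [uM zT] := frame_inverse cT cF oT oF TF.
have := lebesgue_rV_affine (face_pt F 0) uM (measurable_simplex cT).
rewrite (_ : [set z | _] = @ref_simplex R n.+2); last first.
  by apply/seteqP; split => z /=; rewrite -zT.
have fT : mu n.+1 (simplex T) \is a fin_num.
  rewrite ge0_fin_numE //; apply: box_bounded_lty; last exact: box_bounded_simplex.
  exact: measurable_simplex.
rewrite /ref_vol => ->; rewrite fineM // mulrA divff ?mul1r //.
by rewrite normr_eq0 -unitfE -unitmxE.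
Qed.

End frames.

(** * Normals, heights and volumes *)

Section normals.
Variables (R : realType) (n : nat) (K : mesh R n.+1).
Local Notation I := 'I_(nverts K).
Local Notation vset := {set I}.
Local Notation Rd := 'rV[R]_n.+1.
Notation mu n := (lebesgue_rV R n).
Implicit Types (T F : vset) (i j o : I) (x y m : Rd).

Lemma face_pt0 F : #|F| = n.+1 -> exists2 i, i \in F & face_pt F 0 = vtx i.
Proof. by move=> /face_enum[e [_ eF pe _]]; exists (e ord0) => //; exact: (pe ord0). Qed.

Lemma face_jac_orth F m : #|F| = n.+1 ->
  (forall i j, i \in F -> j \in F -> dotv m (vtx i - vtx j) = 0) ->
  face_jac F *m m^T = 0.
Proof.
move=> cF mF; have [e [_ eF pe _]] := face_enum cF.
apply/matrixP => k l; rewrite (ord1 l) mul_dotv [RHS]mxE.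
have -> : row k (face_jac F) = vtx (e (lift ord0 k)) - vtx (e ord0).
  by apply/rowP => j; rewrite !mxE (pe (lift ord0 k)) (pe ord0).
by rewrite dotvC mF.
Qed.

Lemma frame_mul F o m : (frame o F) *m m^T =
  col_mx (dotv (vtx o - face_pt F 0) m)%:M (face_jac F *m m^T).
Proof.
rewrite /frame mul_col_mx; congr col_mx.
by rewrite [LHS]mx11_scalar -dotvE.
Qed.

Lemma bary_face_pt T F o : cell_like T -> #|F| = n.+1 -> o \in T -> o \notin F -> T = o |: F ->
  bary T o (face_pt F 0) = 0.
Proof.
move=> cT cF oT oF TF; have [i iF ->] := face_pt0 cF.
rewrite bary_vtx //; last by rewrite TF in_setU1 iF orbT.
by case: eqP => // oi; rewrite oi iF in oF.
Qed.

Lemma bary_grad_orth T F o i j : cell_like T -> T = o |: F -> o \notin F ->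
  i \in F -> j \in F -> dotv (bary_grad T o) (vtx i - vtx j) = 0.
Proof.
move=> cT TF oF iF jF.
have inT k : k \in F -> k \in T by move=> kF; rewrite TF in_setU1 kF orbT.
have oT : o \in T by rewrite TF in_setU1 eqxx.
rewrite (bary_grad_vtx cT oT (inT _ iF) (inT _ jF)).
case: eqP => [oi|_]; first by rewrite oi iF in oF.
by case: eqP => [oj|_]; [rewrite oj jF in oF|rewrite subrr].
Qed.

Lemma bary_grad_opp T F o : cell_like T -> #|F| = n.+1 -> T = o |: F -> o \notin F ->
  dotv (bary_grad T o) (vtx o - face_pt F 0) = 1.
Proof.
move=> cT cF TF oF; have oT : o \in T by rewrite TF in_setU1 eqxx.
by rewrite -bary_affine bary_vtx // (bary_face_pt cT cF oT oF TF) eqxx subr0.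
Qed.

(** Since the frame is invertible, a vector is determined by its products with the edges; both sides
    have product 0 with the edges of F and the same product with the edge to o. *)
Lemma orth_face T F o m : cell_like T -> #|F| = n.+1 -> T = o |: F -> o \notin F ->
  (forall i j, i \in F -> j \in F -> dotv m (vtx i - vtx j) = 0) ->
  m = dotv m (vtx o - face_pt F 0) *: bary_grad T o.
Proof.
move=> cT cF TF oF mF.
have oT : o \in T by rewrite TF in_setU1 eqxx.
have [uM _] := frame_inverse cT cF oT oF TF.
apply: trmx_inj; apply: (can_inj (mulKmx uM)); rewrite !frame_mul face_jac_orth //.
rewrite [in RHS]face_jac_orth //.
  by rewrite dotvZr [X in _ * X]dotvC (bary_grad_opp cT cF TF oF) mulr1 dotvC.
by move=> i j iF jF; rewrite dotvZl (bary_grad_orth cT TF oF iF jF) mulr0.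
Qed.

Lemma bary_grad_neq0 T F o : cell_like T -> #|F| = n.+1 -> T = o |: F -> o \notin F ->
  bary_grad T o != 0.
Proof.
move=> cT cF TF oF; apply/negP => /eqP g0.
by have := bary_grad_opp cT cF TF oF; rewrite g0 dotv0l => /eqP; rewrite eq_sym oner_eq0.
Qed.

Lemma unit_normal_face T F o m : cell_like T -> #|F| = n.+1 -> T = o |: F -> o \notin F ->
  unit_normal F m -> exists2 s : R, s = 1 \/ s = -1 &
   m = (s / norm2 (bary_grad T o)) *: bary_grad T o.
Proof.
move=> cT cF TF oF [m1 mF].
have mE := orth_face cT cF TF oF mF.
set k := dotv m _ in mE.
have g0 := bary_grad_neq0 cT cF TF oF.
have ng : 0 < norm2 (bary_grad T o) by rewrite norm2_gt0.
exists (k * norm2 (bary_grad T o)).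
  have : (k * norm2 (bary_grad T o)) ^+ 2 = 1.
    by rewrite exprMn norm2_sqr -m1 [in RHS]mE dotvZl dotvZr mulrA expr2.
  by move/eqP; rewrite sqrf_eq1 => /orP[] /eqP ->; [left|right].
by rewrite mulfK ?lt0r_neq0.
Qed.

(** The barycentric coordinate of o drops from 1 at o to 0 on F, so minus its normalized gradient
    points outwards. This vector shows that the choice in [outer_normal] is not void, and the sign
    condition leaves no other one. *)
Lemma outer_normalP T F o : cell_like T -> #|F| = n.+1 -> T = o |: F -> o \notin F ->
  outer_normal T F = - (norm2 (bary_grad T o))^-1 *: bary_grad T o
  /\ unit_normal F (outer_normal T F).
Proof.
move=> cT cF TF oF.
have g0 := bary_grad_neq0 cT cF TF oF.
have ng : 0 < norm2 (bary_grad T o) by rewrite norm2_gt0.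
pose m := - (norm2 (bary_grad T o))^-1 *: bary_grad T o.
have TFo : T :\: F = [set o]%SET.
  by rewrite TF finset.setDUl finset.setDv finset.setU0; apply/finset.setDidPl; rewrite finset.disjoints1.
pose P := [set m | unit_normal F m /\
    forall i j, i \in T :\: F -> j \in F -> dotv m (vtx i - vtx j) < 0].
have oT : o \in T by rewrite TF in_setU1 eqxx.
have inT k : k \in F -> k \in T by move=> kF; rewrite TF in_setU1 kF orbT.
have oj j : j \in F -> dotv (bary_grad T o) (vtx o - vtx j) = 1.
  move=> jF; rewrite (bary_grad_vtx cT oT oT (inT _ jF)) eqxx; case: eqP => [oj|_]; last by rewrite subr0.
  by rewrite oj jF in oF.
have Pm : P m.
  split; first split.
  - by rewrite dotvZl dotvZr -norm2_sqr mulrA -expr2 sqrrN -exprMn mulVf ?expr1n // lt0r_neq0.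
  - by move=> i j iF jF; rewrite dotvZl (bary_grad_orth cT TF oF iF jF) mulr0.
  - move=> i j; rewrite TFo finset.in_set1 => /eqP -> jF.
    by rewrite dotvZl oj // mulr1 oppr_lt0 invr_gt0.
have [un neg] : P (outer_normal T F) by exact: xgetI Pm.
split => //.
have [s s1 mE] := unit_normal_face cT cF TF oF un.
have [j jF _] := face_pt0 cF.
have := neg o j; rewrite TFo finset.in_set1 eqxx => /(_ isT jF).
rewrite [in X in X -> _]mE dotvZl oj // mulr1.
case: s1 mE => -> -> ; last by rewrite mulN1r.
by rewrite mul1r invr_lt0 ltNge ltW.
Qed.

(** This is |T| = c * height * |F|, with height 1/|g| for g the gradient of the barycentric
    coordinate of o. The edge e to o equals g/|g|^2 plus a tangential vector, which a shear
    removes. *)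
Lemma frame_height T F o : cell_like T -> #|F| = n.+1 -> T = o |: F -> o \notin F ->
  vol T = (norm2 (bary_grad T o))^-1 * area F * (ref_vol R n.+1 / ref_vol R n).
Proof.
move=> cT cF TF oF.
have oT : o \in T by rewrite TF in_setU1 eqxx.
have [uM _] := frame_inverse cT cF oT oF TF.
rewrite (vol_frame cT cF oT oF TF) /area.
have g0 := bary_grad_neq0 cT cF TF oF.
have ng : 0 < norm2 (bary_grad T o) by rewrite norm2_gt0.
set g := bary_grad T o in g0 ng *; pose J : 'M[R]_(n, n.+1) := face_jac F; rewrite -[face_jac F]/J; set e := vtx o - face_pt F 0.
have Jg : J *m g^T = 0.
  apply: face_jac_orth => // i j iF jF; exact: bary_grad_orth cT TF oF iF jF.
have eg : dotv e g = 1 by rewrite dotvC; exact: bary_grad_opp.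
have [y eE] : exists y : 'rV[R]_n, e = (norm2 g ^- 2) *: g + y *m J.
  pose w := g *m invmx (frame o F).
  have wE : g = lsubmx w *m e + rsubmx w *m J.
    by rewrite -mul_row_col hsubmxK /w mulmxKV.
  have w0 : lsubmx w = (norm2 g ^+ 2)%:M.
    rewrite [LHS]mx11_scalar; congr _%:M.
    rewrite norm2_sqr [in RHS]dotvE {1}wE mulmxDl -!mulmxA Jg mulmx0 addr0.
    by rewrite [e *m _]mx11_scalar -dotvE eg mulmx1.
  have gE : g = norm2 g ^+ 2 *: e + rsubmx w *m J by rewrite -mul_scalar_mx -w0 -wE.
  have gE' : norm2 g ^- 2 *: g = e + norm2 g ^- 2 *: (rsubmx w *m J).
    rewrite [X in _ *: X = _]gE scalerDr scalerA mulVf ?scale1r //.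
    by rewrite expf_neq0 // lt0r_neq0.
  exists (- (norm2 g ^- 2) *: rsubmx w).
  by rewrite gE' -scalemxAl scaleNr addrK.
(* After the shear the rows are g/|g|^2 and the edges of F, orthogonal to each other, so the Gram
   matrix is block diagonal and its determinant factors. *)
have detE : \det (frame o F) ^+ 2 = (norm2 g ^- 2) * \det (J *m J^T).
  pose U : 'M[R]_(1 + n) := block_mx 1 y 0 1%:M.
  have -> : frame o F = U *m col_mx (norm2 g ^- 2 *: g) J.
    by rewrite /U /frame mul_block_col mul0mx !mul1mx add0r -/e -/J -eE.
  rewrite det_mulmx (@det_ublock _ 1 n) !det1 !mul1r expr2.
  rewrite -[X in _ * X]det_tr -det_mulmx tr_col_mx mul_col_row.
  rewrite linearZ /= -!scalemxAr -!scalemxAl.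
  have gJ : g *m J^T = 0 by apply: trmx_inj; rewrite trmx_mul trmxK Jg trmx0.
  rewrite Jg gJ !scaler0 (@det_ublock _ 1 n) scalerA detZ expr1; congr (_ * _).
  rewrite [g *m _]mx11_scalar -dotvE det_scalar1 -norm2_sqr -mulrA mulVf ?mulr1 // expf_neq0 //.
  exact: lt0r_neq0.
have -> : `|\det (frame o F)| = (norm2 g)^-1 * Num.sqrt (\det (J *m J^T)).
  rewrite -sqrtr_sqr detE -exprVn sqrtrM ?sqr_ge0 // sqrtr_sqr ger0_norm // invr_ge0.
  exact: ltW.
rewrite -!mulrA; congr (_ * (_ * _)).
by rewrite mulrCA divff ?mulr1 // lt0r_neq0 // ref_vol_gt0.
Qed.

Lemma vol_gt0 T : cell_like T -> 0 < vol T.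
Proof.
move=> cT.
have [p pT] := card_gt0_witness cT.1.
have cF : #|T :\ p| = n.+1 by have := cardsD1 p T; rewrite cT.1 pT => -[].
have oF : p \notin T :\ p by rewrite !inE eqxx.
have TF : T = p |: (T :\ p) by rewrite finset.setD1K.
rewrite (vol_frame cT cF pT oF TF) mulr_gt0 ?ref_vol_gt0 // normr_gt0 -unitfE -unitmxE.
by have [] := frame_inverse cT cF pT oF TF.
Qed.

End normals.

(** * Local geometry of the triangulation and integrals of broken functions *)

Section triangulations.
Variables (R : realType) (n : nat) (K : mesh R n.+1).
Local Notation I := 'I_(nverts K).
Local Notation vset := {set I}.
Local Notation Rd := 'rV[R]_n.+1.
Notation mu n := (lebesgue_rV R n).
Implicit Types (T F : vset) (i j o : I) (x y m : Rd) (Om : set Rd).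

Lemma nbhs_segment x y (P : set Rd) : nbhs x P ->
  exists2 e : R, 0 < e & forall s, `|s| < e -> P (x + s *: y).
Proof.
move=> xP.
have c : {for 0, continuous (fun s : R => x + s *: y)}.
  by apply: continuousD; [exact: cst_continuous|exact: scalel_continuous].
have : \forall s \near (0 : R), P (x + s *: y) by apply: c; rewrite scale0r addr0.
move=> /nbhs_ballP[e /= e0 h]; exists e => // s se; apply: h.
by rewrite /ball /= sub0r normrN.
Qed.

Lemma lipschitz_cont (g : Rd -> R) (L : R) :
  (forall y z : Rd, `|g y - g z| <= L * `|y - z|) -> continuous g.
Proof.
move=> gL y; apply/(@cvgrPdist_lt _ _ _ (nbhs y) (nbhs_filter y)) => d d0.
have L0 : 0 < `|L| + 1 by rewrite ltr_pwDr.
have e0 : 0 < d / (`|L| + 1) by rewrite divr_gt0.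
apply: filterS (nbhsx_ballx y _ e0) => z; rewrite -ball_normE /ball_ /= => yz.
apply: le_lt_trans (gL _ _) _.
apply: (@le_lt_trans _ _ (`|L| * `|y - z|)); first by rewrite ler_wpM2r // ler_norm.
apply: (@le_lt_trans _ _ ((`|L| + 1) * `|y - z|)); first by rewrite ler_wpM2r // lerDl.
by rewrite -ltr_pdivlMl // mulrC.
Qed.

Lemma triangulation_cell Om T : triangulation K Om -> T \in cells K -> cell_like T.
Proof. by case=> _ h _ _ /h. Qed.

(** The point lies in the simplex over the common vertices. As an interior point of T it has all
    coordinates positive, so every vertex of T is common, and cardinalities agree. *)
Lemma interior_simplex_disjoint Om T T' x : triangulation K Om ->
  T \in cells K -> T' \in cells K -> (simplex T)° x -> simplex T' x -> T = T'.
Proof.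
move=> tri TK TK' xT xT'.
have cT := triangulation_cell tri TK; have cT' := triangulation_cell tri TK'.
have [_ _ cap _] := tri.
have : (simplex T `&` simplex T') x by split => //; exact: interior_subset.
rewrite (cap _ _ TK TK') => -[c [c0 c1 xE]].
pose c' i := if i \in T' then c i else 0.
have sub (V : nmodType) (g : I -> V) : \sum_(i in T :&: T') g i = \sum_(i in T) (if i \in T' then g i else 0).
  by rewrite -big_mkcondr; apply: eq_bigl => i; rewrite inE.
have bx i : i \in T -> bary T i x = c' i.
  move=> iT; rewrite xE sub (eq_bigr (fun i => c' i *: vtx i)).
    by rewrite baryE // -c1 sub.
  by move=> j _; rewrite /c'; case: ifP; rewrite ?scale0r.
apply/eqP; rewrite eqEcard cT.1 cT'.1 leqnn andbT; apply/fintype.subsetP => i iT.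
move: xT; rewrite interior_simplex // => /(_ i iT); rewrite bx // /c'.
by case: ifP => //; rewrite ltxx.
Qed.

(** The mesh covers the closure of Om, so a slit could cross a cell; the Lipschitz condition rules
    this out. Below the graph of g, arbitrarily near a boundary point, there are open sets outside
    Om, whereas the interior of T lies in the closure of Om. *)
Lemma interior_simplex_sub Om T : lipschitz_domain Om -> triangulation K Om ->
  T \in cells K -> (simplex T)° `<=` Om.
Proof.
move=> [oOm _ _ _ lip] tri TK x xT; apply: contrapT => xOm.
have clT : simplex T `<=` closure Om.
  by have [-> _ _ _] := tri; move=> y Ty; exists T.
have xb : bdry Om x by split; [by apply: clT; exact: interior_subset|by move=> /interior_subset].
have [e [g [L [e1 gL gs nx]]]] := lip x xb.
have gx : dotv x e <= g x.
  by rewrite leNgt; apply/negP => /(nbhs_singleton nx).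
have /(nbhs_segment (- e))[r r0 hr] : nbhs x ((simplex T)° `&` [set y | Om y <-> g y < dotv y e]°).
  by apply: filterI; exact: nbhs_interior.
have [] := hr (r / 2); first by rewrite gtr0_norm ?divr_gt0 // ltr_pdivrMr // ltr_pMr // ltr1n.
(* Moving along -e leaves g unchanged and lowers the height, so y is strictly below the graph and
   still in T. *)
set y := _ + _ => /interior_subset/clT clOm ny.
have gy : dotv y e < g y.
  rewrite /y scalerN -scaleNr gs dotvDl dotvZl e1 mulr1.
  by apply: lt_le_trans gx; rewrite gtrDl oppr_lt0 divr_gt0.
have cg : {for y, continuous g} by apply: lipschitz_cont gL y.
have ngy : \forall z \near y, ~ Om z.
  have h : \forall z \near y, 0 < g z - dotv e z.
    have : {for y, continuous (fun z => g z - dotv e z)}.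
      by apply: continuousB => //; exact: continuous_dotv.
    rewrite dotvC in gy.
    have gy' : 0 < g y - dotv e y by rewrite subr_gt0.
    move=> /cvgrPdist_lt /(_ _ gy'); apply: filterS => z.
    by rewrite ltr_distlC subrr => /andP[].
  move: h; apply: filterS2 ny => z [h _] hz /h; rewrite dotvC.
  by apply/negP; rewrite -leNgt ltW // -subr_gt0.
by have [z []] := clOm _ ngy.
Qed.

(** The relative interior of F. Near such a point only the cells that contain F are present, and
    membership in one of them is decided by the sign of a single barycentric coordinate. *)
Definition relint F : set Rd := [set b | exists c : I -> R,
  [/\ forall i, i \in F -> 0 < c i, \sum_(i in F) c i = 1 & b = \sum_(i in F) c i *: vtx i]].

Lemma bary_sub T F (c : I -> R) i : cell_like T -> F \subset T -> i \in T ->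
  \sum_(j in F) c j = 1 ->
  bary T i (\sum_(j in F) c j *: vtx j) = if i \in F then c i else 0.
Proof.
move=> cT FT iT c1.
have sub (V : nmodType) (g : I -> V) : \sum_(i in F) g i = \sum_(i in T) (if i \in F then g i else 0).
  rewrite -big_mkcondr; apply: eq_bigl => j.
  by case: (boolP (j \in F)) => jF; rewrite ?andbT ?andbF // (fintype.subsetP FT).
rewrite sub (eq_bigr (fun j => (if j \in F then c j else 0) *: vtx j)).
  by rewrite (@baryE _ _ _ T (fun j => if j \in F then c j else 0)) // -c1 sub.
by move=> j _; case: ifP; rewrite ?scale0r.
Qed.

Lemma simplexS T F : cell_like T -> F \subset T -> simplex F `<=` simplex T.
Proof.
move=> cT FT x [c [c0 c1 ->]]; rewrite simplexE // => i iT.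
by rewrite bary_sub //; case: ifP.
Qed.

Lemma relint_simplex F : relint F `<=` simplex F.
Proof.
move=> x [c [c0 c1 ->]]; exists (fun i => if i \in F then c i else 0); split.
- by move=> i; case: ifP => // /c0/ltW.
- by rewrite -[RHS]c1; apply: eq_bigr => i ->.
- by apply: eq_bigr => i ->.
Qed.

Lemma relint_bary T F b i : cell_like T -> F \subset T -> relint F b -> i \in T ->
  (i \in F -> 0 < bary T i b) /\ (i \notin F -> bary T i b = 0).
Proof.
move=> cT FT [c [c0 c1 ->]] iT; rewrite bary_sub //.
by split => iF; [rewrite iF c0|rewrite (negbTE iF)].
Qed.

Lemma near_relint_in T F o b : cell_like T -> T = o |: F -> o \notin F -> relint F b ->
  \forall x \near b, 0 < bary T o x -> (simplex T)° x.
Proof.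
move=> cT TF oF bF; rewrite interior_simplex //.
have FT : F \subset T by rewrite TF finset.subsetUr.
have : \forall x \near b, forall i, i \in F -> 0 < bary T i x.
  apply: (@filter_forall _ _ (fun i y => i \in F -> 0 < bary T i y) (nbhs b)) => i.
  have [iF|iF] := boolP (i \in F); last by apply: nearW.
  have [h _] := relint_bary cT FT bF (fintype.subsetP FT _ iF).
  by apply: filterS (near_bary_gt0 (h iF)) => y.
apply: filterS => x h xo i; rewrite {1}TF in_setU1 => /orP[/eqP -> //|]; exact: h.
Qed.

(** Some vertex of F is missing in T', while b has a positive coordinate there; hence b is not in
    the simplex over the common vertices, and T' is closed. *)
Lemma near_relint_out Om T T' F b : triangulation K Om -> T \in cells K -> T' \in cells K ->
  F \subset T -> relint F b -> ~~ (F \subset T') -> \forall x \near b, ~ simplex T' x.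
Proof.
move=> tri TK TK' FT bF FT'.
have cT := triangulation_cell tri TK; have cT' := triangulation_cell tri TK'.
have : ~ simplex T' b.
  move=> bT'; have bT : simplex T b by exact/(simplexS cT FT)/relint_simplex.
  have [_ _ cap _] := tri.
  have : simplex (T :&: T') b by rewrite -cap.
  move=> [c [c0 c1 bE]].
  case/fintype.subsetPn: FT' => i iF iT'.
  have [h _] := relint_bary cT FT bF (fintype.subsetP FT _ iF).
  move: (h iF); rewrite bE bary_sub ?finset.subsetIl ?(fintype.subsetP FT) //.
  by rewrite inE (negbTE iT') andbF ltxx.
move=> bT'; apply: open_nbhs_nbhs; split => //.
exact: closed_openC (closed_simplex cT').
Qed.

Lemma bary_outer_normal T F o x : cell_like T -> #|F| = n.+1 -> T = o |: F -> o \notin F ->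
  bary T o x = norm2 (bary_grad T o) * dotv (outer_normal T F) (face_pt F 0 - x).
Proof.
move=> cT cF TF oF.
have [-> _] := outer_normalP cT cF TF oF.
have oT : o \in T by rewrite TF in_setU1 eqxx.
have ng : 0 < norm2 (bary_grad T o) by rewrite norm2_gt0; exact: bary_grad_neq0 cT cF TF oF.
rewrite (baryB T o x (face_pt F 0)) (bary_face_pt cT cF oT oF TF) add0r.
rewrite dotvZl mulrA mulrN divff ?lt0r_neq0 // mulN1r -dotvNr opprB //.
Qed.

Lemma relint_opp T F o b (s : R) : cell_like T -> T = o |: F -> o \notin F -> relint F b ->
  bary T o (b + s *: (vtx o - b)) = s.
Proof.
move=> cT TF oF bF; have oT : o \in T by rewrite TF in_setU1 eqxx.
have FT : F \subset T by rewrite TF finset.subsetUr.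
have [_ h] := relint_bary cT FT bF oT.
rewrite (baryB T o _ b) (addrC b) addrK dotvZr -bary_affine bary_vtx // eqxx h // subr0 mulr1 add0r //.
Qed.

Lemma relint_nonempty F : #|F| = n.+1 -> exists b, relint F b.
Proof.
move=> cF; exists (\sum_(i in F) (n.+1%:R^-1 : R) *: vtx i); exists (fun=> n.+1%:R^-1); split => //.
by rewrite sumr_const cF -[_ *+ n.+1]mulr_natl divff // pnatr_eq0.
Qed.

(** Both normals are orthogonal to F, hence equal up to sign. If they were equal, a small step from
    the face into T would also enter the interior of T', so that T = T'. *)
Lemma opposite_normals Om T T' F : triangulation K Om -> T \in cells K -> T' \in cells K ->
  F \in faces_of T -> F \in faces_of T' -> T <> T' ->
  outer_normal T' F = - outer_normal T F.
Proof.
move=> tri TK TK' FT FT' TT'.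
have cT := triangulation_cell tri TK; have cT' := triangulation_cell tri TK'.
have [cF [p [pT pF TF]]] := facesP cT.1 FT.
have [_ [q [qT qF TF']]] := facesP cT'.1 FT'.
have [E un] := outer_normalP cT cF TF pF.
have [E' un'] := outer_normalP cT' cF TF' qF.
have ng : 0 < norm2 (bary_grad T p) by rewrite norm2_gt0; exact: bary_grad_neq0 cT cF TF pF.
have ng' : 0 < norm2 (bary_grad T' q) by rewrite norm2_gt0; exact: bary_grad_neq0 cT' cF TF' qF.
have [s [] -> E''] := unit_normal_face cT cF TF pF un'.
  by rewrite E'' E scaleNr opprK div1r.
exfalso; apply: TT'.
have NN : outer_normal T' F = outer_normal T F by rewrite E'' E mulN1r.
have [b bF] := relint_nonempty cF.
have [r r0 hr] := nbhs_segment (vtx p - b) (filterI (near_relint_in cT TF pF bF) (near_relint_in cT' TF' qF bF)).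
have r2 : 0 < r / 2 by rewrite divr_gt0.
have [] := hr (r / 2); first by rewrite gtr0_norm // ltr_pdivrMr // ltr_pMr // ltr1n.
have := relint_opp (r / 2) cT TF pF bF; set x := _ + _ => bx.
rewrite bx => /(_ r2) xT /(_ _) xT'.
apply: (interior_simplex_disjoint tri TK TK' xT); apply: interior_subset; apply: xT'.
rewrite (bary_outer_normal x cT' cF TF' qF) NN mulr_gt0 //.
by move: r2; rewrite -bx (bary_outer_normal x cT cF TF pF) pmulr_rgt0.
Qed.

(** If a relative interior point of F were in Om, so would be nearby points across F from T, but no
    cell covers them. Any other point of F is a limit of relative interior points, and Om is
    open. *)
Lemma simplex_face_bdry Om T F : lipschitz_domain Om -> triangulation K Om -> T \in cells K ->
  F \in faces_of T -> (forall T', T' \in cells K -> F \in faces_of T' -> T' = T) ->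
  simplex F `<=` bdry Om.
Proof.
move=> lip tri TK FT T1.
have cT := triangulation_cell tri TK.
have [cF [p [pT pF TF]]] := facesP cT.1 FT.
have [oOm _ _ _ _] := lip.
have clE : closure Om = \bigcup_(T in [set` cells K]) simplex T by case: tri.
have relint_out b : relint F b -> ~ Om b.
  move=> bF bOm.
  have far : \forall x \near b, forall T', T' \in cells K -> T' != T -> ~ simplex T' x.
    apply: (@filter_forall _ _ (fun T' x => T' \in cells K -> T' != T -> ~ simplex T' x) (nbhs b)) => T'.
    have [T'K|T'K] := boolP (T' \in cells K); last by apply: nearW.
    have [->|T'T] := eqVneq T' T; first by apply: nearW.
    have FT' : ~~ (F \subset T').
      apply/negP => FT'; move/eqP: T'T; apply; apply: T1 => //.
      by rewrite inE FT' cF eqxx.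
    have FT0 : F \subset T by rewrite TF finset.subsetUr.
    by apply: filterS (near_relint_out tri TK T'K FT0 bF FT') => x.
  have bOm' : nbhs b Om by exact: open_nbhs_nbhs.
  have [r r0 hr] := nbhs_segment (vtx p - b) (filterI far bOm').
  have r2 : 0 < r / 2 by rewrite divr_gt0.
  (* The negative step moves away from the vertex p, to the far side of F. *)
  have [] := hr (- (r / 2)); first by rewrite normrN gtr0_norm // ltr_pdivrMr // ltr_pMr // ltr1n.
  have := relint_opp (- (r / 2)) cT TF pF bF; set x := _ + _ => bx xfar /(@subset_closure _ Om).
  rewrite clE => -[T' /= T'K].
  have [->|/(xfar _ T'K)//] := eqVneq T' T.
  by rewrite simplexE // => /(_ p pT); rewrite bx oppr_ge0 leNgt r2.
have FT0 : F \subset T by rewrite TF finset.subsetUr.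
move=> x xF; split.
  by rewrite clE; exists T => //; exact: simplexS xF.
move=> /interior_subset xOm.
have [b bF] := relint_nonempty cF.
have /(nbhs_segment (b - x))[r r0 hr] : nbhs x Om by exact: open_nbhs_nbhs.
(* s < r keeps the point in Om, s <= 1 keeps the combination convex, and s > 0 makes all its
   coefficients positive. *)
pose s := Num.min (r / 2) 1.
have s0 : 0 < s by rewrite lt_min divr_gt0 // ltr01.
have s1 : s <= 1 by rewrite ge_min lexx orbT.
have /hr : `|s| < r.
  rewrite gtr0_norm // gt_min ltr_pdivrMr // ltr_pMr // ltr1n //.
apply: relint_out.
have [c [c0 c1 bE]] := bF; have [c' [c'0 c'1 xE]] := xF.
exists (fun i => (1 - s) * c' i + s * c i); split.
- move=> i iF; apply: ltr_wpDl; first by rewrite mulr_ge0 // subr_ge0.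
  by rewrite mulr_gt0 // c0.
- by rewrite big_split /= -!mulr_sumr c1 c'1 !mulr1 subrK.
- rewrite bE xE scalerBr addrCA -{1}[\sum_(i in F) c' i *: _]scale1r -scalerBl addrC.
  rewrite !scaler_sumr -big_split; apply: eq_bigr => i _ /=.
  by rewrite !scalerA scalerDl.
Qed.

Lemma mbounded_broken_cell T (q : Rd -> R) : cell_like T -> mbounded q ->
  mbounded (fun x => if x \in ((simplex T)° : set Rd) then q x else 0).
Proof.
move=> cT; apply: mbounded_indic; apply: open_measurable_rV; exact: open_interior.
Qed.

Lemma brokenE (V : nmodType) (q : vset -> Rd -> V) x :
  broken q x = \sum_(T in cells K) if x \in ((simplex T)° : set Rd) then q T x else 0.
Proof. by rewrite /broken big_mkcondr. Qed.

Lemma broken_in (V : nmodType) Om (q : vset -> Rd -> V) T x : triangulation K Om ->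
  T \in cells K -> (simplex T)° x -> broken q x = q T x.
Proof.
move=> tri TK xT; rewrite brokenE (bigD1 T) //= mem_set // big1 ?addr0 // => T' /andP[T'K T'T].
case: ifP => // /set_mem xT'; move: T'T.
by rewrite (interior_simplex_disjoint tri TK T'K xT (interior_subset xT')) eqxx.
Qed.

Lemma broken_out (V : nmodType) (q : vset -> Rd -> V) x :
  (forall T, T \in cells K -> ~ (simplex T)° x) -> broken q x = 0.
Proof.
move=> xT; rewrite brokenE big1 // => T TK; case: ifP => // /set_mem /xT; exact.
Qed.

Lemma brokenP x : (exists2 T, T \in cells K & (simplex T)° x) \/
  (forall T, T \in cells K -> ~ (simplex T)° x).
Proof.
have [h|h] := pselect (exists2 T, T \in cells K & (simplex T)° x); [by left|right].
by move=> T TK xT; apply: h; exists T.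
Qed.

Lemma broken_op2 (U V W : nmodType) (f : U -> V -> W) Om (p : vset -> Rd -> U) (q : vset -> Rd -> V) x :
  triangulation K Om -> f 0 0 = 0 ->
  f (broken p x) (broken q x) = broken (fun T x => f (p T x) (q T x)) x.
Proof.
move=> tri f0; have [[T TK xT]|h] := brokenP x; first by rewrite !(broken_in _ tri TK xT).
by rewrite !broken_out.
Qed.

Lemma mbounded_broken Om (q : vset -> Rd -> R) : triangulation K Om ->
  (forall T, T \in cells K -> mbounded (q T)) -> mbounded (broken q).
Proof.
move=> tri mq.
have := @mbounded_sum R _ _ (index_enum _) (fun T => T \in cells K)
  (fun T x => if x \in ((simplex T)° : set Rd) then q T x else 0).
move=> /(_ (fun T TK => mbounded_broken_cell (triangulation_cell tri TK) (mq T TK))).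
by congr mbounded; apply/funext => x; rewrite brokenE.
Qed.

Lemma measurable_bary_eq0 T i : measurable [set x | bary T i x = 0].
Proof.
apply: (@eq_measurable _ _ _ (bary T i @^-1` [set 0])) => //.
apply: measurable_preimage; last exact: measurable_set1.
exact: (mbounded_continuous (@continuous_bary _ _ _ T i)).1.
Qed.

(** In the frame of the face opposite to i this set is the coordinate hyperplane z_0 = 0, whose
    slices along the first axis are single points. *)
Lemma simplex_boundary_null T i : cell_like T -> i \in T -> 
  mu n.+1 [set x | bary T i x = 0] = 0%E.
Proof.
move=> cT iT.
have cF : #|T :\ i| = n.+1 by have := cardsD1 i T; rewrite cT.1 iT => -[].
have iF : i \notin T :\ i by rewrite !inE eqxx.
have TF : T = i |: (T :\ i) by rewrite finset.setD1K.
have [uM _] := frame_inverse cT cF iT iF TF.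
have mH := measurable_bary_eq0 T i.
have := lebesgue_rV_affine (face_pt (T :\ i) 0) uM mH.
have -> : [set z | [set x | bary T i x = 0] (face_pt (T :\ i) 0 + z *m frame i (T :\ i))] =
    [set z : 'rV[R]_n.+1 | z ord0 ord0 = 0].
  have bz (z : 'rV[R]_n.+1) : bary T i (face_pt (T :\ i) 0 + z *m frame i (T :\ i)) = z ord0 ord0.
    rewrite (baryB T i _ (face_pt (T :\ i) 0)) (addrC (face_pt _ 0)) addrK.
    rewrite (bary_face_pt cT cF iT iF TF) add0r dotvC dotvE -mulmxA frame_mul.
    rewrite face_jac_orth // => [|j k jF kF]; last exact: bary_grad_orth cT TF iF jF kF.
    rewrite dotvC (bary_grad_opp cT cF TF iF) -[z](@hsubmxK _ 1 1 n) (@mul_row_col R 1 1 n 1).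
    rewrite mulmx0 addr0 mulmx1.
    by rewrite mxE hsubmxK; congr (z _ _); exact: val_inj.
  by apply/seteqP; split => z /=; rewrite bz.
have mZ : measurable [set z : 'rV[R]_n.+1 | z ord0 ord0 = 0].
  apply: (@eq_measurable _ _ _ ((fun z : 'rV[R]_n.+1 => z ord0 ord0) @^-1` [set 0])) => //.
  by apply: measurable_preimage; [exact: measurable_coord|exact: measurable_set1].
rewrite (lebesgue_rV_slice2 mZ) integral0_eq; last first.
  move=> y _; rewrite (_ : [set x | _] = [set 0]) ?lebesgue_measure_set1 //.
  by apply/seteqP; split => x /=; rewrite row_mx0l.
move/esym/eqP; rewrite mule_eq0 => /orP[|/eqP //].
by rewrite eqe invr_eq0 normr_eq0 => /eqP d0; move: uM; rewrite unitmxE d0 unitr0.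
Qed.

Lemma simplex_interior_null T : cell_like T -> mu n.+1 (simplex T `\` (simplex T)°) = 0%E.
Proof.
move=> cT; apply: measure_negligible.
  apply: measurableD; first exact: measurable_simplex.
  by apply: open_measurable_rV; exact: open_interior.
rewrite interior_simplex //.
apply: (@negligibleS _ _ _ _ (\big[setU/set0]_(i in T) [set x | bary T i x = 0])).
  move=> x [xT nx].
  have [i [iT xi]] : exists i, i \in T /\ bary T i x <= 0.
    apply: contrapT => h; apply: nx => i iT /=; rewrite ltNge; apply/negP => xi.
    by apply: h; exists i.
  rewrite -bigcup_seq_cond; exists i => /=; first by rewrite mem_index_enum.
  apply/eqP; rewrite eq_le xi /=; move: xT; rewrite simplexE //; exact.
elim/big_ind: _ => [|A B hA hB|i iT]; first exact: negligible_set0.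
  exact: negligibleU.
by apply/negligibleP; [exact: measurable_bary_eq0|exact: simplex_boundary_null].
Qed.

Lemma Rintegral_interior_simplex T f : cell_like T -> mbounded f ->
  \int[mu n.+1]_(x in (simplex T)°) f x = cell_int T f.
Proof.
move=> cT mf.
have mT := measurable_simplex cT.
have mi : measurable ((simplex T)° : set Rd) by apply: open_measurable_rV; exact: open_interior.
rewrite /cell_int /Rintegral (@negligible_integral _ _ _ (mu n.+1) (simplex T) (simplex T `\` (simplex T)°)) //.
- by rewrite setDD (setIidr (@interior_subset _ (simplex T))).
- exact: measurableD.
- by apply: mbounded_integrable => //; exact: box_bounded_simplex.
- exact: simplex_interior_null.
Qed.

(** [broken] vanishes off the open cells by definition, so the integral splits over them; they lie
    in Om, and their boundaries are null sets. *)
Lemma Rintegral_broken Om (q : vset -> Rd -> R) : lipschitz_domain Om -> triangulation K Om ->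
  (forall T, T \in cells K -> mbounded (q T)) ->
  \int[mu n.+1]_(x in Om) broken q x = \sum_(T in cells K) cell_int T (q T).
Proof.
move=> lip tri mq.
have [oOm _ _ bOm _] := lip.
have mOm : measurable Om by exact: open_measurable_rV.
rewrite (@eq_Rintegral _ _ _ _ _ (fun x => \sum_(T in cells K) if x \in ((simplex T)° : set Rd) then q T x else 0)); last first.
  by move=> x _; rewrite brokenE.
rewrite Rintegral_sum //; last first.
  move=> T TK; apply: mbounded_integrable => //; last first.
    by apply: mbounded_broken_cell; [exact: triangulation_cell tri TK|exact: mq].
  exact: bounded_set_box.
apply: eq_bigr => T TK.
have cT := triangulation_cell tri TK.
rewrite -(Rintegral_interior_simplex cT (mq T TK)).
transitivity (\int[mu n.+1]_(x in Om `&` (simplex T)°) q T x).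
  by rewrite Rintegral_mkcondr.
by rewrite setIidr //; exact: interior_simplex_sub lip tri TK.
Qed.

End triangulations.

(** * Normal continuity of H_0(div) fields *)

Section continuous_functions.
Variables (R : realType) (d : nat).
Implicit Types f g : 'rV[R]_d -> R.

Lemma contB f g : continuous f -> continuous g -> continuous (fun x => f x - g x).
Proof. by move=> cf cg x; exact: (continuousB (cf x) (cg x)). Qed.

Lemma contM f g : continuous f -> continuous g -> continuous (fun x => f x * g x).
Proof. by move=> cf cg x; exact: (continuousM (cf x) (cg x)). Qed.

Lemma contC (a : R) : continuous (fun _ : 'rV[R]_d => a).
Proof. exact: cst_continuous. Qed.

Lemma cont_sum I (r : seq I) (F : I -> 'rV[R]_d -> R) :
  (forall i, continuous (F i)) -> continuous (fun x => \sum_(i <- r) F i x).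
Proof. by move=> cF; exact: (@continuous_sum _ _ _ r xpredT F cF). Qed.

End continuous_functions.

(** * Ellipsoidal C^1 bump functions *)

Section bump.
Variables (R : realType).

(** A quadratic remainder bound suits [sqpos], which has no second derivative at 0 but satisfies
    such a bound everywhere. *)
Lemma is_derive_quadratic (V : normedModType R) (f : V -> R) x v (l C : R) :
  (forall h : R, `|h| <= 1 -> `|f (h *: v + x) - f x - l * h| <= C * h ^+ 2) ->
  is_derive x v f l.
Proof.
move=> hf.
have cv : h^-1 *: (f (h *: v + x) - f x) @[h --> 0^'] --> l.
  apply/cvgrPdist_lt => e e0.
  have C0 : 0 < `|C| + 1 by rewrite ltr_pwDr.
  have d0 : 0 < Num.min 1 (e / (`|C| + 1)) by rewrite lt_min ltr01 divr_gt0.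
  exists (Num.min 1 (e / (`|C| + 1))) => //= h; rewrite /= sub0r normrN lt_min => /andP[h1 he] h0.
  have nh : 0 < `|h| by rewrite normr_gt0.
  rewrite -(@ltr_pM2l _ `|h|) // -normrM mulrBr /GRing.scale /= mulrA divff // mul1r -normrN opprB.
  rewrite [h * l]mulrC; apply: le_lt_trans (hf h (ltW h1)) _.
  apply: (@le_lt_trans _ _ ((`|C| + 1) * h ^+ 2)).
    by rewrite ler_wpM2r ?sqr_ge0 // (le_trans (ler_norm _)) // lerDl.
  rewrite -real_normK ?num_real // expr2 mulrCA ltr_pM2l //.
  by rewrite mulrC -ltr_pdivlMr.
split; first by apply/cvg_ex; exists l.
exact: cvg_lim.
Qed.

(** Squaring the positive part gives a function that is just C^1, enough for the test functions in
    [H0div], with an explicit derivative. *)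
Definition sqpos (t : R) : R := (Num.max 0 t) ^+ 2.

Lemma sqpos_quad (t k : R) :
  `|sqpos (t + k) - sqpos t - 2 * Num.max 0 t * k| <= k ^+ 2.
Proof.
rewrite /sqpos; have [t0|t0] := lerP 0 t; have [k0|k0] := lerP 0 (t + k);
  rewrite ler_norml; apply/andP; split; nra.
Qed.

Lemma is_derive_sqpos (t : R) : is_derive t 1 sqpos (2 * Num.max 0 t).
Proof.
apply: (@is_derive_quadratic _ _ _ _ _ 1) => h _.
by rewrite mul1r [h *: _]mulr1 (addrC h) sqpos_quad.
Qed.

Lemma differentiable_sqpos (t : R) : differentiable sqpos t.
Proof. by apply/derivable1_diffP; have [] := is_derive_sqpos t. Qed.

Variables (d : nat) (b : 'rV[R]_d) (C : 'M[R]_d).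
Let z (x : 'rV[R]_d) := (x - b) *m C.

(** Supported in the ellipsoid of the x with |(x - b) C| <= 1, centred at b; the matrix C sets its
    shape. *)
Definition bumpfun (x : 'rV[R]_d) : R := sqpos (1 - dotv (z x) (z x)).

(** The square root of the bump in rescaled coordinates; it is also the scalar factor in the
    gradient of the bump. *)
Definition bump_weight (y : 'rV[R]_d) : R := Num.max 0 (1 - dotv y y).

Lemma is_derive_bump x v : is_derive x v bumpfun (- 4 * bump_weight (z x) * dotv (z x) (v *m C)).
Proof.
set be := dotv (z x) (v *m C); set ga := dotv (v *m C) (v *m C).
pose m := bump_weight (z x).
apply: (@is_derive_quadratic _ _ _ _ _ ((2 * `|be| + `|ga|) ^+ 2 + 2 * m * `|ga|)) => h h1.
rewrite /bumpfun.
have zh : z (h *: v + x) = z x + h *: (v *m C).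
  by rewrite /z -addrA addrC mulmxDl -scalemxAl.
rewrite zh !dotvDl !dotvDr !dotvZl !dotvZr [dotv (v *m C) (z x)]dotvC -/be -/ga.
set al := dotv (z x) (z x).
pose k := - (2 * h * be) - h ^+ 2 * ga.
have -> : 1 - (al + h * be + (h * be + h * (h * ga))) = (1 - al) + k by rewrite /k; ring.
have := sqpos_quad (1 - al) k.
have -> : - 4 * bump_weight (z x) * be * h = 2 * m * k + 2 * m * ga * h ^+ 2.
  by rewrite /k /m; ring.
have m0 : 0 <= m by rewrite le_max lexx.
rewrite -[Num.max 0 (1 - al)]/m => H.
have hb : k ^+ 2 <= (2 * `|be| + `|ga|) ^+ 2 * h ^+ 2.
  rewrite -(real_normK (num_real k)) -(real_normK (num_real h)) -exprMn.
  rewrite ler_sqr ?nnegrE ?mulr_ge0 ?addr_ge0 ?mulr_ge0 //.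
  apply: le_trans (ler_normB _ _) _; rewrite normrN !normrM mulrDl; apply: lerD.
    by rewrite ger0_norm // -!mulrA ler_wpM2l // mulrC.
  by rewrite [leRHS]mulrC -mulrA ler_wpM2l // -[leRHS]mul1r ler_wpM2r.
rewrite opprD addrA [leRHS]mulrDl; apply: le_trans (ler_normB _ _) _; apply: lerD.
  exact: le_trans H hb.
by rewrite !normrM [`|2|]ger0_norm // (ger0_norm m0) -[`|h| * _]expr2 real_normK // num_real.
Qed.

Lemma grad_bump x v : dotv v (grad bumpfun x) = - 4 * bump_weight (z x) * dotv (z x) (v *m C).
Proof.
rewrite {1}/dotv; under eq_bigr => i _.
  rewrite mxE /partial; have [_ ->] := is_derive_bump x (delta_mx ord0 i).
  over.
rewrite [in RHS](row_sum_delta v) mulmx_suml dotv_sumr mulr_sumr.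
by apply: eq_bigr => i _; rewrite -scalemxAl dotvZr mulrCA.
Qed.

Lemma continuous_zk k : continuous (fun x => z x ord0 k).
Proof.
have -> : (fun x => z x ord0 k) = fun x : 'rV[R]_d => \sum_j (x ord0 j - b ord0 j) * C j k.
  by apply/funext => x; rewrite mxE; apply: eq_bigr => j _; rewrite !mxE.
apply: cont_sum => j; apply: contM; last exact: contC.
by apply: contB; [exact: coord_continuous|exact: contC].
Qed.

Lemma differentiable_zk k x : differentiable (fun x => z x ord0 k) x.
Proof.
have -> : (fun x => z x ord0 k) = \sum_j (fun x : 'rV[R]_d => (x ord0 j - b ord0 j) * C j k).
  by apply/funext => y; rewrite mxE fct_sumE; apply: eq_bigr => j _; rewrite !mxE.
apply: differentiable_sum => j; apply: differentiableM; last exact: differentiable_cst.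
apply: differentiableB; [exact: differentiable_coord|exact: differentiable_cst].
Qed.

Lemma bump_C1 : C1 bumpfun.
Proof.
have cw : continuous (fun x => bump_weight (z x)).
  have c1 : continuous (fun x => 1 - dotv (z x) (z x)).
    apply: contB; first exact: contC.
    by apply: cont_sum => k; apply: contM; exact: continuous_zk.
  move=> x; exact: (@continuous_max R _ (fun=> 0) (fun x => 1 - dotv (z x) (z x)) x (@contC _ _ _ x) (c1 x)).
split.
  move=> x; apply: (@differentiable_comp _ _ _ _ (fun x => 1 - dotv (z x) (z x)) sqpos).
    apply: differentiableB; first exact: differentiable_cst.
    have -> : (fun x => dotv (z x) (z x)) = \sum_k (fun x => z x ord0 k * z x ord0 k).
      by apply/funext => y; rewrite fct_sumE.
    by apply: differentiable_sum => k; apply: differentiableM; exact: differentiable_zk.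
  exact: differentiable_sqpos.
move=> i.
have -> : partial bumpfun i = fun x => - 4 * bump_weight (z x) * \sum_k z x ord0 k * ((delta_mx ord0 i : 'rV[R]_d) *m C) ord0 k.
  by apply/funext => x; have [_ E] := is_derive_bump x (delta_mx ord0 i).
apply: contM; first by apply: contM; [exact: contC|exact: cw].
by apply: cont_sum => k; apply: contM; [exact: continuous_zk|exact: contC].
Qed.

End bump.

(** * An entrywise matrix norm for crude estimates *)

Section mnorm.
Variable R : realType.

(** The sum of absolute entries is submultiplicative for all shapes, so rows, columns and square
    matrices are estimated by the same rules. *)
Definition mnorm m p (A : 'M[R]_(m, p)) : R := \sum_i \sum_j `|A i j|.

Lemma mnorm_ge0 m p (A : 'M[R]_(m, p)) : 0 <= mnorm A.
Proof. by apply: sumr_ge0 => i _; apply: sumr_ge0. Qed.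

Lemma mnormD m p (A B : 'M[R]_(m, p)) : mnorm (A + B) <= mnorm A + mnorm B.
Proof.
rewrite /mnorm -big_split; apply: ler_sum => i _ /=; rewrite -big_split; apply: ler_sum => j _ /=.
by rewrite mxE ler_normD.
Qed.

Lemma mnormZ m p a (A : 'M[R]_(m, p)) : mnorm (a *: A) = `|a| * mnorm A.
Proof.
rewrite /mnorm mulr_sumr; apply: eq_bigr => i _; rewrite mulr_sumr; apply: eq_bigr => j _.
by rewrite mxE normrM.
Qed.

Lemma mnorm_entry m p (A : 'M[R]_(m, p)) i j : `|A i j| <= mnorm A.
Proof.
rewrite /mnorm (bigD1 i) //= (bigD1 j) //= -addrA lerDl addr_ge0 ?sumr_ge0 // => k _.
exact: sumr_ge0.
Qed.

Lemma mnormM m p q (A : 'M[R]_(m, p)) (B : 'M[R]_(p, q)) : mnorm (A *m B) <= mnorm A * mnorm B.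
Proof.
rewrite /mnorm mulr_suml; apply: ler_sum => i _.
apply: (@le_trans _ _ (\sum_k \sum_j `|A i j| * `|B j k|)).
  apply: ler_sum => k _; rewrite mxE; apply: le_trans (ler_norm_sum _ _ _) _.
  by apply: ler_sum => j _; rewrite normrM.
rewrite exchange_big mulr_suml; apply: ler_sum => j _ /=; rewrite -mulr_sumr ler_wpM2l //.
by rewrite [leRHS](bigD1 j) //= lerDl; apply: sumr_ge0 => k _; exact: sumr_ge0.
Qed.

Lemma mnorm_tr m p (A : 'M[R]_(m, p)) : mnorm A^T = mnorm A.
Proof.
rewrite /mnorm exchange_big; apply: eq_bigr => i _; apply: eq_bigr => j _; by rewrite mxE.
Qed.

Lemma dotv_mnorm d (u v : 'rV[R]_d) : `|dotv u v| <= mnorm u * mnorm v.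
Proof. by rewrite dotvE -(mnorm_tr v); apply: le_trans (mnorm_entry _ _ _) (mnormM _ _). Qed.

Lemma mnorm_cube d (z : 'rV[R]_d) : cube 0 1 z -> mnorm z <= d%:R.
Proof.
move=> zQ; rewrite /mnorm big_ord1; apply: (@le_trans _ _ (\sum_(j < d) (1 : R))).
  by apply: ler_sum => j _; have := zQ j; rewrite mxE subr0 => /ltW.
by rewrite sumr_const card_ord.
Qed.

End mnorm.

Section bump_support.
Variables (R : realType) (d : nat).
Implicit Types y : 'rV[R]_d.

Lemma bump_weight_ge0 y : 0 <= bump_weight y.
Proof. by rewrite le_max lexx. Qed.

Lemma bump_weight_le1 y : bump_weight y <= 1.
Proof. by rewrite ge_max ler01 lerBlDl lerDr dotv_ge0. Qed.

Lemma bump_weight_out y : ~ cube 0 1 y -> bump_weight y = 0.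
Proof.
move=> yQ; apply/eqP; rewrite eq_le bump_weight_ge0 andbT ge_max lexx subr_le0.
have [i yi] : exists i, 1 <= `|y ord0 i|.
  apply: contrapT => h; apply: yQ => i; rewrite mxE subr0 ltNge; apply/negP => yi.
  by apply: h; exists i.
apply: (@le_trans _ _ (y ord0 i * y ord0 i)).
  by rewrite -expr2 -real_normK ?num_real // expr_ge1.
rewrite /dotv (bigD1 i) //= lerDl; apply: sumr_ge0 => j _; by rewrite -expr2 sqr_ge0.
Qed.

Lemma continuous_bump_weight : continuous (@bump_weight R d).
Proof.
have c1 : continuous (fun x : 'rV[R]_d => 1 - dotv x x).
  apply: contB; first exact: contC.
  by apply: cont_sum => k; apply: contM; exact: coord_continuous.
move=> x; exact: (@continuous_max R _ (fun=> 0) _ x (@contC _ _ _ x) (c1 x)).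
Qed.

Lemma bumpE (b : 'rV[R]_d) (C : 'M[R]_d) x : bumpfun b C x = bump_weight ((x - b) *m C) ^+ 2.
Proof. by []. Qed.

End bump_support.

(** * Square integrable functions on a bounded set *)

Section L2_functions.
Variables (R : realType) (d : nat) (Om : set 'rV[R]_d).
Hypotheses (mOm : measurable Om) (bOm : box_bounded Om).
Notation mu := (lebesgue_rV R d).
Implicit Types f g : 'rV[R]_d -> R.

Lemma L2_sq_integrable f : L2 Om f -> mu.-integrable Om (EFin \o (fun x => f x ^+ 2)).
Proof.
move=> [mf fi]; apply/integrableP; split.
  by apply/measurable_EFinP; apply: measurable_funX.
by under eq_integral => x _ do rewrite /= ger0_norm ?sqr_ge0 //.
Qed.

Lemma L2_mul_integrable f g : L2 Om f -> mbounded g -> mu.-integrable Om (EFin \o (fun x => f x * g x)).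
Proof.
move=> L2f mg; have [mf _] := L2f.
have mg2 : mbounded (fun x => g x * g x) by exact: mboundedM.
have i1 := L2_sq_integrable L2f.
have i2 := mbounded_integrable mOm bOm mg2.
apply: (@le_integrable _ _ _ mu _ mOm _ (EFin \o (fun x => f x ^+ 2 + g x * g x))).
- apply/measurable_EFinP; apply: measurable_funM => //.
  by apply: measurable_funTS; have [] := mg.
- move=> x _ /=; rewrite lee_fin [leRHS]ger0_norm; last by rewrite -expr2 addr_ge0 ?sqr_ge0.
  rewrite normrM -(real_normK (num_real (f x))) -expr2 -(real_normK (num_real (g x))).
  have := sqr_ge0 (`|f x| - `|g x|); have := normr_ge0 (f x); have := normr_ge0 (g x); nra.
- by have := integrableD mOm i1 i2; congr (_.-integrable _ _).
Qed.

Lemma L2_mbounded f : mbounded f -> L2 Om f.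
Proof.
move=> mf; split; first by apply: measurable_funTS; have [] := mf.
have : mu.-integrable Om (EFin \o (fun x => f x * f x)).
  by apply: mbounded_integrable => //; exact: mboundedM.
move=> /integrableP[_]; apply: le_lt_trans.
apply: ge0_le_integral => //=.
- by move=> x _; rewrite lee_fin sqr_ge0.
- apply/measurable_EFinP; apply: measurable_funX; apply: measurable_funTS; by have [] := mf.
- apply/measurable_EFinP; apply: measurableT_comp => //; apply: measurable_funTS.
  by have [] := mboundedM mf mf.
- by move=> x _; rewrite lee_fin expr2 ler_norm.
Qed.

Lemma L2D f g : L2 Om f -> L2 Om g -> L2 Om (fun x => f x + g x).
Proof.
move=> L2f L2g; have [mf _] := L2f; have [mg _] := L2g.
split; first exact: measurable_funD.
have i1 := L2_sq_integrable L2f; have i2 := L2_sq_integrable L2g.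
have : mu.-integrable Om (EFin \o (fun x => 2 * (f x ^+ 2 + g x ^+ 2))).
  have := integrableZl mOm 2 (integrableD mOm i1 i2).
  by congr (_.-integrable _ _); apply/funext => x.
move=> /integrableP[_]; apply: le_lt_trans.
apply: ge0_le_integral => //=.
- by move=> x _; rewrite lee_fin sqr_ge0.
- by apply/measurable_EFinP; apply: measurable_funX; exact: measurable_funD.
- apply/measurable_EFinP; apply: measurableT_comp => //; apply: measurable_funM => //.
  by apply: measurable_funD; exact: measurable_funX.
- move=> x _; rewrite lee_fin; apply: le_trans (ler_norm _).
  have := sqr_ge0 (f x - g x); nra.
Qed.

Lemma L2Z a f : L2 Om f -> L2 Om (fun x => a * f x).
Proof.
move=> L2f; have [mf _] := L2f.
split; first exact: measurable_funM.
have : mu.-integrable Om (EFin \o (fun x => a ^+ 2 * f x ^+ 2)).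
  have := integrableZl mOm (a ^+ 2) (L2_sq_integrable L2f).
  by congr (_.-integrable _ _); apply/funext => x.
move=> /integrableP[_]; apply: le_lt_trans.
rewrite le_eqVlt; apply/orP; left; apply/eqP; apply: eq_integral => x _ /=.
by rewrite ger0_norm ?exprMn // mulr_ge0 ?sqr_ge0.
Qed.

Lemma Linfty_L2 f : Linfty Om f -> L2 Om f.
Proof.
move=> [mf [C hC]]; split => //.
apply: le_lt_trans (_ : \int[mu]_(x in Om) (C ^+ 2)%:E < _)%E.
  apply: ae_ge0_le_integral => //.
  - by move=> x _; rewrite lee_fin sqr_ge0.
  - by apply/measurable_EFinP; apply: measurable_funX.
  - by move=> x _; rewrite lee_fin sqr_ge0.
  - apply: filterS hC => x hx Omx; rewrite lee_fin -real_normK ?num_real //.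
    have := hx Omx; have := normr_ge0 (f x); nra.
rewrite integral_cst // lte_mul_pinfty //; first by rewrite lee_fin sqr_ge0.
exact: box_bounded_lty.
Qed.

End L2_functions.

(** * Bumps concentrated at a point of a face: contribution of one side *)

Section anisotropic_frames.
Variables (R : realType) (n : nat).
Local Notation Rd := 'rV[R]_n.+1.
Local Notation Md := 'M[R]_n.+1.
Notation mu n := (lebesgue_rV R n).

Definition axis_col : 'cV[R]_n.+1 := col_mx (1%:M : 'M[R]_1) (0 : 'cV[R]_n).
Definition axis_row : 'rV[R]_n.+1 := row_mx (1%:M : 'M[R]_1) (0 : 'rV[R]_n).
Definition axis_proj : Md := axis_col *m axis_row.

Lemma axis_rowcol : axis_row *m axis_col = 1%:M.
Proof. by rewrite /axis_row /axis_col (@mul_row_col R 1 1 n 1) mulmx1 mulmx0 addr0. Qed.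

Lemma mul_axis_col (z : Rd) : z *m axis_col = (z ord0 ord0)%:M.
Proof.
rewrite /axis_col -[z](@hsubmxK _ 1 1 n) (@mul_row_col R 1 1 n 1) mulmx1 mulmx0 addr0 hsubmxK.
rewrite [LHS]mx11_scalar mxE; congr (z _ _)%:M; exact: val_inj.
Qed.

Lemma dotv_axis_row (z : Rd) : dotv z axis_row = z ord0 ord0.
Proof.
have -> : z ord0 ord0 = (z *m axis_col) ord0 ord0 by rewrite mul_axis_col mxE eqxx.
by rewrite dotvE /axis_row (@tr_row_mx _ 1 1 n) trmx1 trmx0.
Qed.

Lemma axis_proj_idem : axis_proj *m axis_proj = axis_proj.
Proof. by rewrite /axis_proj mulmxA -(mulmxA axis_col) axis_rowcol mulmx1. Qed.

Lemma axis_proj_block : axis_proj = block_mx (1%:M : 'M[R]_1) 0 0 (0 : 'M[R]_n).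
Proof. by rewrite /axis_proj /axis_col /axis_row (@mul_col_row _ 1 n 1 1 n) !mulmx0 !mul0mx mulmx1. Qed.

(* Scaling by r * dl along the first axis and by r along the others: the bumps
   are much thinner in the direction normal to the face, so that their gradient
   is almost normal. *)
Definition stretch (r dl : R) : Md := r *: (dl *: axis_proj + (1%:M - axis_proj)).
(** The inverse of [stretch] up to the scalar r * dl; keeping the scalar apart exposes the factor dl
    on the tangential part. *)
Definition costretch (dl : R) : Md := axis_proj + dl *: (1%:M - axis_proj).

Lemma stretchK r dl : stretch r dl *m costretch dl = (r * dl)%:M.
Proof.
have q : axis_proj *m (1%:M - axis_proj) = 0 by rewrite mulmxBr mulmx1 axis_proj_idem subrr.
have q' : (1%:M - axis_proj) *m axis_proj = 0 by rewrite mulmxBl mul1mx axis_proj_idem subrr.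
have q2 : (1%:M - axis_proj) *m (1%:M - axis_proj) = 1%:M - axis_proj.
  by rewrite mulmxBr mulmx1 q' subr0.
rewrite /stretch /costretch -scalemxAl mulmxDl !mulmxDr -!scalemxAl -!scalemxAr axis_proj_idem q q' q2.
rewrite !scaler0 addr0 add0r -scalerDr addrC subrK scalerA.
by rewrite scalemx1.
Qed.

Lemma det_stretch r dl : \det (stretch r dl) = dl * r ^+ n.+1.
Proof.
have -> : stretch r dl = block_mx ((r * dl)%:M : 'M[R]_1) 0 0 (r%:M : 'M[R]_n).
  rewrite /stretch axis_proj_block.
  have -> : (1%:M : Md) = block_mx (1%:M : 'M[R]_1) 0 0 (1%:M : 'M[R]_n) by rewrite -scalar_mx_block.
  rewrite (@opp_block_mx _ 1 n 1 n) (@add_block_mx _ 1 n 1 n) (@scale_block_mx _ 1 n 1 n).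
  rewrite (@add_block_mx _ 1 n 1 n) (@scale_block_mx _ 1 n 1 n) !oppr0 !addr0 subrr addr0 !scaler0 add0r.
  by rewrite scalerA !scalemx1.
by rewrite (@det_ublock _ 1 n) !det_scalar expr1 exprS mulrAC mulrC.
Qed.

Lemma mnorm_stretch r dl : 0 < r -> 0 < dl <= 1 ->
  mnorm (stretch r dl) <= r * (mnorm axis_proj + mnorm (1%:M - axis_proj)).
Proof.
move=> r0 /andP[d0 d1]; rewrite mnormZ gtr0_norm // ler_wpM2l ?(ltW r0) //.
apply: le_trans (mnormD _ _) _; rewrite lerD2r mnormZ gtr0_norm //.
by rewrite ler_piMl // mnorm_ge0.
Qed.

Variables (A : Md) (a b : Rd).
Hypotheses (uA : A \in unitmx) (Aa : A *m a^T = axis_col).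

(** Local coordinates x = b + z [zoom] around a face point b. The hypothesis [Aa] says that the last
    rows of A are tangential to the face with conormal a, and that the first row crosses it at
    height 1. [cozoom] is the inverse and serves as matrix of the bump. *)
Definition zoom r dl : Md := stretch r dl *m A.
Definition cozoom r dl : Md := (r * dl)^-1 *: (invmx A *m costretch dl).

Lemma zoomK r dl : r * dl != 0 -> zoom r dl *m cozoom r dl = 1%:M.
Proof.
move=> rd; rewrite /zoom /cozoom -scalemxAr mulmxA -(mulmxA _ A) mulmxV // mulmx1 stretchK.
by rewrite -[(r * dl)%:M]scalemx1 scalerA mulVf // scale1r.
Qed.

(* The part of the gradient of the bump, scaled by r * dl, that is not due to the
   normal component of the field at the center; it is O(r) if dl <= r. *)
Definition side_rem (u0 : Rd) (G : Md) r dl (z : Rd) : R :=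
  z ord0 ord0 * dotv (z *m zoom r dl *m G) a +
  dl * dotv z ((u0 + z *m zoom r dl *m G) *m invmx A *m (1%:M - axis_proj)).

(** [invmx A] maps the first axis to the conormal a, so the first component of the rescaled field is
    its product with a; the tangential part carries the factor dl and goes into the remainder. *)
Lemma side_decomp u0 G r dl z : r * dl != 0 ->
  r * dl * dotv z ((u0 + z *m zoom r dl *m G) *m cozoom r dl) =
  z ord0 ord0 * dotv u0 a + side_rem u0 G r dl z.
Proof.
move=> rd; rewrite /side_rem; set u := u0 + _.
have iAc : invmx A *m axis_col = a^T by rewrite -Aa mulKmx.
rewrite /cozoom -scalemxAr dotvZr mulrA divff // mul1r mulmxA /costretch [_ *m (axis_proj + _)]mulmxDr dotvDr.
rewrite -scalemxAr dotvZr addrA; congr (_ + _).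
rewrite /axis_proj mulmxA -(mulmxA u) iAc.
have -> : u *m a^T = (dotv u a)%:M by rewrite dotvE; exact: mx11_scalar.
by rewrite mul_scalar_mx dotvZr dotv_axis_row mulrC /u dotvDl mulrDr.
Qed.

Lemma side_rem_bound u0 G : exists K : R, 0 <= K /\ forall r dl z,
  0 < r <= 1 -> 0 < dl <= r -> cube 0 1 z -> `|side_rem u0 G r dl z| <= K * r.
Proof.
set KP := mnorm axis_proj + mnorm (1%:M - axis_proj).
have KP0 : 0 <= KP by rewrite addr_ge0 ?mnorm_ge0.
have N0 m p (M : 'M[R]_(m, p)) : 0 <= mnorm M by exact: mnorm_ge0.
pose L := n.+1%:R * (KP * mnorm A) * mnorm G.
have L0 : 0 <= L by rewrite /L !mulr_ge0 ?N0.
exists (L * mnorm a + n.+1%:R * ((mnorm u0 + L) * mnorm (invmx A) * mnorm (1%:M - axis_proj))).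
split; first by rewrite addr_ge0 ?mulr_ge0 ?addr_ge0 ?N0.
move=> r dl z /andP[r0 r1] /andP[d0 dr] zQ.
have zG : mnorm (z *m zoom r dl *m G) <= L * r.
  apply: le_trans (mnormM _ _) _; rewrite /L mulrAC ler_wpM2r //.
  apply: le_trans (mnormM _ _) _; rewrite -mulrA ler_pM //; first exact: mnorm_cube.
  apply: le_trans (mnormM _ _) _; rewrite mulrAC ler_wpM2r // mulrC; apply: mnorm_stretch => //.
  by rewrite d0 (le_trans dr).
have z0 : `|z ord0 ord0| <= 1 by have := zQ ord0; rewrite mxE subr0 => /ltW.
rewrite mulrDl; apply: le_trans (ler_normD _ _) _; apply: lerD.
  rewrite normrM -[leRHS]mul1r ler_pM //; apply: le_trans (dotv_mnorm _ _) _.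
  by rewrite mulrAC ler_wpM2r.
rewrite normrM gtr0_norm // mulrC ler_pM //; first exact: ltW.
apply: le_trans (dotv_mnorm _ _) _; rewrite ler_pM //; first exact: mnorm_cube.
apply: le_trans (mnormM _ _) _; rewrite ler_wpM2r //.
apply: le_trans (mnormM _ _) _; rewrite ler_wpM2r //.
apply: le_trans (mnormD _ _) _; rewrite lerD2l (le_trans zG) //.
by rewrite ler_piMr.
Qed.

Lemma measurable_halfcube (s : R) : measurable [set z : Rd | cube 0 1 z /\ 0 < s * z ord0 ord0].
Proof.
apply: (@eq_measurable _ _ _ (cube 0 1 `&` (fun z : Rd => s * z ord0 ord0) @^-1` `]0, +oo[%classic)).
  apply/seteqP; split => z /= [h1 h2]; split => //; by move: h2; rewrite in_itv /= andbT.
apply: measurableI; first exact: measurable_cube.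
apply: measurable_preimage; last exact: measurable_itv.
apply: measurable_funM => //; exact: measurable_coord.
Qed.

(** On either side of the face, selected by the sign of s, the rescaled integral of an affine field
    against the gradient of the bump retains in the limit r -> 0 only the normal component at b,
    times a fixed first moment. *)
Lemma side_integral u0 G s : exists K : R, forall r dl, 0 < r <= 1 -> 0 < dl <= r ->
  let S := [set z : Rd | cube 0 1 z /\ 0 < s * z ord0 ord0] in
  `|r * dl * \int[mu n.+1]_(z in S) (- 4 * bump_weight z *
       dotv z ((u0 + z *m zoom r dl *m G) *m cozoom r dl))
    + 4 * dotv u0 a * \int[mu n.+1]_(z in S) (bump_weight z * z ord0 ord0)| <= K * r.
Proof.
have [K [K0 hK]] := side_rem_bound u0 G.
pose S := [set z : Rd | cube 0 1 z /\ 0 < s * z ord0 ord0].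
exists (4 * K * fine (mu n.+1 S)) => r dl r01 d01 /=; rewrite -/S.
have mS : measurable S by exact: measurable_halfcube.
have bS : box_bounded S by exists 1 => z [].
have mw : mbounded (@bump_weight R n.+1) by apply/mbounded_continuous/continuous_bump_weight.
have mz := @mbounded_coord R n.+1 ord0.
have mrem : mbounded (side_rem u0 G r dl).
  have maff (v : Rd) (M : Md) k : mbounded (fun z : Rd => (v + z *m M) ord0 k).
    exact: (@mbounded_affine_comp R _ _ (fun x : Rd => x ord0 k) v M (@mbounded_coord R _ k)).
  have mlin (M : Md) k : mbounded (fun z : Rd => (z *m M) ord0 k).
    by have := maff 0 M k; congr mbounded; apply/funext => z; rewrite add0r.
  apply: mboundedD.
    apply: mboundedM => //; apply: mbounded_sum => k _; apply: mboundedM; last exact: mbounded_cst.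
    have := mlin (zoom r dl *m G) k; congr mbounded; by apply/funext => z; rewrite mulmxA.
  apply: mboundedZ; apply: mbounded_sum => k _; apply: mboundedM; first exact: mbounded_coord.
  have := maff (u0 *m (invmx A *m (1%:M - axis_proj))) (zoom r dl *m G *m invmx A *m (1%:M - axis_proj)) k.
  by congr mbounded; apply/funext => z; rewrite !mulmxDl !mulmxA.
have rd : r * dl != 0 by move: r01 d01 => /andP[r0 _] /andP[d0 _]; rewrite mulf_neq0 // lt0r_neq0.
have E z : r * dl * (- 4 * bump_weight z * dotv z ((u0 + z *m zoom r dl *m G) *m cozoom r dl)) =
   (- (4 * dotv u0 a)) * (bump_weight z * z ord0 ord0) + (- 4) * (bump_weight z * side_rem u0 G r dl z).
  set D := dotv z _.
  have -> : r * dl * (- 4 * bump_weight z * D) = - 4 * bump_weight z * (r * dl * D) by ring.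
  by rewrite side_decomp //; ring.
have i1 : (mu n.+1).-integrable S (EFin \o (fun z => bump_weight z * z ord0 ord0)).
  by apply: mbounded_integrable => //; exact: mboundedM.
have mwr : mbounded (fun z => bump_weight z * side_rem u0 G r dl z) by exact: mboundedM.
have i2 := mbounded_integrable mS bS mwr.
have mg : mbounded (fun z => - 4 * bump_weight z * dotv z ((u0 + z *m zoom r dl *m G) *m cozoom r dl)).
  have -> : (fun z => - 4 * bump_weight z * dotv z ((u0 + z *m zoom r dl *m G) *m cozoom r dl)) =
    fun z => (r * dl)^-1 * ((- (4 * dotv u0 a)) * (bump_weight z * z ord0 ord0) +
       (- 4) * (bump_weight z * side_rem u0 G r dl z)).
    by apply/funext => z; rewrite -E mulKf.
  apply: mboundedZ; apply: mboundedD; apply: mboundedZ => //; exact: mboundedM.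
rewrite -RintegralZl //; last exact: mbounded_integrable.
under eq_Rintegral do rewrite E.
rewrite RintegralD //; try by apply: mbounded_integrable => //; apply: mboundedZ => //; exact: mboundedM.
rewrite !RintegralZl // mulNr addrAC addNr add0r.
set J := \int[_]_(x in S) (bump_weight x * side_rem u0 G r dl x).
have JK : `|J| <= K * r * fine (mu n.+1 S).
  apply: le_trans (le_normr_Rintegral mS i2) _.
  rewrite -Rintegral_cst //.
  apply: le_Rintegral => //.
  - exact: integrable_norm.
  - by apply: mbounded_integrable => //; exact: mbounded_cst.
  - move=> z [zQ _]; rewrite normrM ger0_norm ?bump_weight_ge0 //.
    by rewrite -[leRHS]mul1r ler_pM ?bump_weight_ge0 ?bump_weight_le1 //; exact: hK.
rewrite normrM normrN [X in X * _]ger0_norm //.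
have -> : 4 * K * fine (mu n.+1 S) * r = 4 * (K * r * fine (mu n.+1 S)) by ring.
by rewrite ler_wpM2l.
Qed.

Lemma bump_moment_pos : 0 < \int[mu n.+1]_(z in [set z : Rd | cube 0 1 z /\ 0 < 1 * z ord0 ord0])
  (bump_weight z * z ord0 ord0).
Proof.
have d0 : 0 < (4 * n.+1%:R : R)^-1 by rewrite invr_gt0 mulr_gt0.
(* In the cube with centre (e, ..., e) and radius e/2 the coordinates are below 2e and below 1/2, so
   |z|^2 <= d e = 1/4 and the weight is at least 1/2. *)
set e := (4 * n.+1%:R)^-1 in d0.
have e1 : e * n.+1%:R = 4^-1 by rewrite /e invfM -mulrA mulVf ?mulr1 // pnatr_eq0.
have e4 : e <= 4^-1 by rewrite -e1 ler_peMr ?(ltW d0) // ler1n.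
have me : 0 < e / 2 by rewrite divr_gt0.
have he : e / 2 < e by rewrite ltr_pdivrMr // ltr_pMr // ltr1n.
apply: (@Rintegral_gt0 _ _ _ _ (const_mx e) (e / 2) (2^-1 * (e / 2))) => //.
- exact: measurable_halfcube.
- apply: mbounded_integrable; first exact: measurable_halfcube.
    by exists 1 => z [].
  by apply: mboundedM; [apply/mbounded_continuous/continuous_bump_weight|exact: mbounded_coord].
- move=> z [_]; rewrite mul1r => z0; by rewrite mulr_ge0 ?bump_weight_ge0 ?ltW.
- by rewrite mulr_gt0 // invr_gt0.
- move=> z zc.
  have zi i : e / 2 < z ord0 i < 2 * e.
    have := zc i; rewrite mxE ltr_distl => /andP[h1 h2]; apply/andP; split; lra.
  split; last by rewrite mul1r; have /andP[h _] := zi ord0; apply: lt_trans h.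
  move=> i; rewrite mxE subr0; have /andP[h1 h2] := zi i.
  rewrite gtr0_norm ?(lt_trans me) //; apply: lt_le_trans h2 _; lra.
- move=> z zc.
  have zi i : e / 2 < z ord0 i < 2 * e.
    have := zc i; rewrite mxE ltr_distl => /andP[h1 h2]; apply/andP; split; lra.
  rewrite ler_pM //; [exact: ltW| |by have /andP[/ltW] := zi ord0].
  rewrite le_max; apply/orP; right; rewrite lerBrDr -lerBrDl.
  apply: (@le_trans _ _ (\sum_(i < n.+1) 2 * e * (2 * 4^-1))).
    apply: ler_sum => i _; have /andP[h1 h2] := zi i.
    rewrite ler_pM ?(ltW h2) ?(le_trans (ltW me) (ltW h1)) //; apply: le_trans (ltW h2) _; lra.
  rewrite sumr_const card_ord -[_ *+ n.+1]mulr_natr.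
  have -> : 2 * e * (2 / 4) * n.+1%:R = e * n.+1%:R by field.
  by rewrite e1; lra.
Qed.

(** The weight is even and the coordinate odd. The opposite signs of the two moments turn the sum
    over both sides into the difference of the normal components. *)
Lemma bump_moment_reflect :
  \int[mu n.+1]_(z in [set z : Rd | cube 0 1 z /\ 0 < - 1 * z ord0 ord0]) (bump_weight z * z ord0 ord0) =
  - \int[mu n.+1]_(z in [set z : Rd | cube 0 1 z /\ 0 < 1 * z ord0 ord0]) (bump_weight z * z ord0 ord0).
Proof.
have mw : mbounded (fun z : Rd => bump_weight z * z ord0 ord0).
  by apply: mboundedM; [apply/mbounded_continuous/continuous_bump_weight|exact: mbounded_coord].
have mS := measurable_halfcube 1.
have i1 : (mu n.+1).-integrable [set z : Rd | cube 0 1 z /\ 0 < 1 * z ord0 ord0]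
    (EFin \o (fun z => bump_weight z * z ord0 ord0)).
  by apply: mbounded_integrable => //; exists 1 => z [].
have uN : (- 1%:M : Md) \in unitmx by rewrite -scaleN1r unitmxZ ?unitmx1 // unitrN unitr1.
have := Rintegral_affine 0 uN mS mw.1 i1.
rewrite -scaleN1r detZ det1 mulr1 normrX normrN1 expr1n invr1 mul1r => <-.
have zN (z : Rd) : 0 + z *m (-1 *: 1%:M) = - z by rewrite add0r scaleN1r mulmxN mulmx1.
have wN (z : Rd) : bump_weight (- z) = bump_weight z.
  by rewrite /bump_weight dotvNl dotvNr opprK.
have SE : [set z : Rd | [set z : Rd | cube 0 1 z /\ 0 < 1 * z ord0 ord0] (0 + z *m (-1 *: 1%:M))] =
    [set z : Rd | cube 0 1 z /\ 0 < -1 * z ord0 ord0].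
  apply/seteqP; split => z /=; rewrite zN !mxE mul1r mulN1r => -[h1 h2]; split => //;
    by move=> i; have := h1 i; rewrite !mxE !subr0 normrN.
rewrite SE -[RHS]mulN1r -RintegralZl; last 2 first.
- exact: measurable_halfcube.
- have : (mu n.+1).-integrable [set z : Rd | cube 0 1 z /\ 0 < -1 * z ord0 ord0]
    (EFin \o (fun z => - (bump_weight z * z ord0 ord0))).
    apply: mbounded_integrable; [exact: measurable_halfcube|by exists 1 => z []|exact: mboundedN].
  by congr (_.-integrable _ _); apply/funext => z /=; rewrite zN wN mxE mulrN.
by apply: eq_Rintegral => z _; rewrite zN wN mxE mulrN mulN1r opprK.
Qed.

End anisotropic_frames.

Lemma weighted_amgm (R : realFieldType) (eta w p c : R) : 0 < eta -> p ^+ 2 <= c ->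
  `|w * p| <= eta * w ^+ 2 + eta^-1 * c.
Proof.
move=> eta0 pc; rewrite normrM -(real_normK (num_real w)).
rewrite -(real_normK (num_real p)) in pc.
move: pc (normr_ge0 w) (normr_ge0 p); move: `|w| `|p| => x y pc x0 y0.
rewrite -(ler_pM2l eta0) mulrDr [X in _ <= _ + X]mulrA divff ?lt0r_neq0 // mul1r.
apply: (@le_trans _ _ (eta * (eta * x ^+ 2) + y ^+ 2)); last by rewrite lerD2l.
rewrite -subr_ge0.
have -> : eta * (eta * x ^+ 2) + y ^+ 2 - eta * (x * y) =
  (eta * x - y) ^+ 2 + eta * x * y by ring.
by rewrite addr_ge0 ?sqr_ge0 // !mulr_ge0 // ltW.
Qed.

Lemma jump_arith (R : realFieldType) (X Y al be kap Kp Km Kf r : R) :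
  `|X + 4 * al * kap| <= Kp * r -> `|Y + 4 * be * - kap| <= Km * r -> `|X + Y| <= Kf * r ->
  `|4 * kap * (al - be)| <= (Kp + Km + Kf) * r.
Proof.
move=> h1 h2 h3.
have -> : 4 * kap * (al - be) = (X + 4 * al * kap) + (Y + 4 * be * - kap) - (X + Y) by ring.
apply: le_trans (ler_normB _ _) _; rewrite [leRHS]mulrDl [X in _ <= X + _]mulrDl lerD //.
by apply: le_trans (ler_normD _ _) _; rewrite lerD.
Qed.

(** * Continuity of the normal component from Green's formula *)

Section jump.
Variables (R : realType) (n : nat).
Local Notation Rd := 'rV[R]_n.+1.
Local Notation Md := 'M[R]_n.+1.
Local Notation mu := (lebesgue_rV R n.+1).

Lemma measurable_null_plane : measurable [set z : Rd | z ord0 ord0 = 0] /\ mu [set z : Rd | z ord0 ord0 = 0] = 0%E.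
Proof.
have mZ : measurable [set z : Rd | z ord0 ord0 = 0].
  apply: (@eq_measurable _ _ _ ((fun z : Rd => z ord0 ord0) @^-1` [set 0])) => //.
  by apply: measurable_preimage; [exact: measurable_coord|exact: measurable_set1].
split => //; rewrite (lebesgue_rV_slice2 mZ) integral0_eq // => y _.
rewrite (_ : [set x | _] = [set 0]) ?lebesgue_measure_set1 //.
by apply/seteqP; split => x /=; rewrite row_mx0l.
Qed.

(** The weighted arithmetic-geometric inequality splits w times the bump into eta w^2 and the
    indicator of the support over eta, and the support has measure of order |det C|^-1. The weight
    eta is left free to be matched to the shape of the bump. *)
Lemma weak_term_bound (Om : set Rd) (w : Rd -> R) : measurable Om -> box_bounded Om -> L2 Om w ->
  exists K : R, 0 <= K /\ forall (b : Rd) (C : Md) (eta : R), C \in unitmx -> 0 < eta ->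
   `|\int[mu]_(x in Om) (w x * bumpfun b C x)| <= K * (eta + eta^-1 * `|\det C|^-1).
Proof.
move=> mOm bOm L2w.
pose W := \int[mu]_(x in Om) (w x ^+ 2).
pose V := fine (mu (cube (0 : Rd) 1)).
have W0 : 0 <= W by apply: Rintegral_ge0 => x _; rewrite sqr_ge0.
have V0 : 0 <= V by rewrite fine_ge0.
exists (W + V); split; first by rewrite addr_ge0.
move=> b C eta uC eta0.
have mb : mbounded (bumpfun b C).
  by apply: mbounded_continuous => x; apply: differentiable_continuous; exact: (bump_C1 b C).1.
have i1 := L2_mul_integrable mOm bOm L2w mb.
have iw := L2_sq_integrable L2w.
pose E := [set x : Rd | cube 0 1 (- (b *m C) + x *m C)].
have mE : measurable E by exact: measurable_affine_preimage (measurable_cube _ _).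
have muE : mu E = (`|\det C|^-1%:E * mu (cube (0 : Rd) 1))%E.
  by rewrite lebesgue_rV_affine //; exact: measurable_cube.
have fE : (mu E < +oo)%E.
  rewrite muE lte_mul_pinfty ?lee_fin ?invr_ge0 //.
  by apply: box_bounded_lty; [exact: measurable_cube|exact: box_bounded_cube].
have iE : mu.-integrable Om (EFin \o (\1_E : Rd -> R)).
  apply: mbounded_integrable => //; split; first exact: measurable_indic.
  by move=> r; exists 1 => z _; rewrite indicE; case: (_ \in _); rewrite ?normr1 ?normr0.
have ib : mu.-integrable Om (EFin \o (fun x => eta * w x ^+ 2 + eta^-1 * \1_E x)).
  have := integrableD mOm (integrableZl mOm eta iw) (integrableZl mOm eta^-1 iE).
  by congr (_.-integrable _ _).
apply: le_trans (le_normr_Rintegral mOm i1) _.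
apply: (@le_trans _ _ (\int[mu]_(x in Om) (eta * w x ^+ 2 + eta^-1 * \1_E x))).
  apply: le_Rintegral => //; first exact: integrable_norm.
  move=> x _.
  have phi2 : bumpfun b C x ^+ 2 <= \1_E x.
    rewrite bumpE -exprM indicE.
    have := bump_weight_ge0 ((x - b) *m C); have := bump_weight_le1 ((x - b) *m C).
    case: (boolP (x \in E)) => [_ h1 h0|/negP xE _ _]; first by rewrite exprn_ile1.
    rewrite bump_weight_out ?expr0n // => h; apply: xE; apply/mem_set; rewrite /E /=.
    by move: h; rewrite mulmxBl addrC.
  exact: weighted_amgm.
rewrite RintegralD //; last 2 first.
- by have := integrableZl mOm eta iw; congr (_.-integrable _ _).
- by have := integrableZl mOm eta^-1 iE; congr (_.-integrable _ _).
rewrite !RintegralZl // -/W.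
have I1 : \int[mu]_(x in Om) \1_E x <= `|\det C|^-1 * V.
  rewrite /Rintegral integral_indic //.
  rewrite -[X in X * V]/(fine (`|\det C|^-1)%:E) -fineM //; last first.
    by rewrite (lebesgue_cube 0 ltr01).
  rewrite -muE fine_le //.
  - rewrite ge0_fin_numE //; apply: le_lt_trans fE; apply: le_measure; rewrite ?inE //.
    exact: measurableI.
  - by rewrite ge0_fin_numE.
  - by apply: le_measure; rewrite ?inE //; exact: measurableI.
have ei : 0 <= eta^-1 by rewrite invr_ge0 ltW.
have D0 : 0 <= `|\det C|^-1 by rewrite invr_ge0.
apply: (@le_trans _ _ (eta * W + eta^-1 * (`|\det C|^-1 * V))).
  by rewrite lerD2l ler_wpM2l.
have -> : (W + V) * (eta + eta^-1 * `|\det C|^-1) = eta * W + eta^-1 * (`|\det C|^-1 * V)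
   + (eta * V + eta^-1 * (`|\det C|^-1 * W)) by ring.
by rewrite lerDl addr_ge0 // !mulr_ge0 // ltW.
Qed.

(* b is a point of the face {x | dotv a (x - b) = 0}. The second alternative on
   the side dotv a (x - b) < 0 is that of a boundary face. *)
Lemma jump_local (Om : set Rd) (v : Rd -> Rd) (A : Md) (a b up um : Rd) (Gp Gm : Md) :
  A \in unitmx -> A *m a^T = axis_col R n -> open Om -> box_bounded Om -> H0div Om v ->
  (forall i, mbounded (fun x => v x ord0 i)) ->
  (\forall x \near b,
    (0 < dotv a (x - b) -> Om x /\ v x = up + (x - b) *m Gp) /\
    (dotv a (x - b) < 0 -> (Om x /\ v x = um + (x - b) *m Gm) \/ (~ Om x /\ um + (x - b) *m Gm = 0))) ->
  dotv up a = dotv um a.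
Proof.
move=> uA Aa oOm bOm [_ [w L2w green]] mv /nbhs_rVP[rho rho0 hnear].
have mOm := open_measurable_rV oOm.
have [Kw [Kw0 hKw]] := weak_term_bound mOm bOm L2w.
have [Kp hKp] := side_integral uA Aa up Gp 1.
have [Km hKm] := side_integral uA Aa um Gm (-1).
set KP := mnorm (axis_proj R n) + mnorm (1%:M - axis_proj R n).
have KP0 : 0 <= KP by rewrite addr_ge0 ?mnorm_ge0.
pose kap := \int[mu]_(z in [set z : Rd | cube 0 1 z /\ 0 < 1 * z ord0 ord0]) (bump_weight z * z ord0 ord0).
have kap0 : 0 < kap by exact: bump_moment_pos.
have key r : 0 < r <= 1 -> r * (n.+1%:R * KP * mnorm A) < rho ->
   `|4 * kap * (dotv up a - dotv um a)| <= (Kp + Km + Kw * (`|\det A|^-1 + 1)) * r.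
  move=> r01 rrho; have /andP[r0 r1] := r01.
  (* With dl = r^d the determinant of [B] has size dl^2 |det A|. Choosing eta = dl below makes the w
     term O(dl), and the rescaling factor r dl / |det B| = r / (dl |det A|) turns this into O(r). *)
  pose dl := r ^+ n.+1.
  have dl0 : 0 < dl by exact: exprn_gt0.
  have dlr : dl <= r by rewrite /dl exprS ler_piMr ?(ltW r0) // exprn_ile1 // ltW.
  have d01 : 0 < dl <= r by rewrite dl0.
  have rd : r * dl != 0 by rewrite mulf_neq0 ?lt0r_neq0.
  set B := zoom A r dl; set C := cozoom A r dl.
  have BC : B *m C = 1%:M by exact: zoomK.
  have [uB uC] := mulmx1_unit BC.
  have dB : `|\det B| = dl * dl * `|\det A|.
    by rewrite det_mulmx det_stretch normrM gtr0_norm // mulr_gt0.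
  have dC : `|\det C|^-1 = dl * dl * `|\det A|.
    have h : `|\det B| * `|\det C| = 1 by rewrite -normrM -det_mulmx BC det1 normr1.
    have nz : `|\det C| != 0 by rewrite normr_eq0 -unitfE -unitmxE.
    by apply: (mulIf nz); rewrite mulVf // -dB h.
  pose phi := bumpfun b C.
  pose h x := dotv (v x) (grad phi x).
  have mh : mbounded h.
    apply: mbounded_sum => i _; apply: mboundedM => //.
    have := mbounded_continuous ((bump_C1 b C).2 i).
    by congr mbounded; apply/funext => x; rewrite mxE.
  have eq1 := green phi (bump_C1 b C).
  pose S := [set z : Rd | Om (b + z *m B)].
  have mS : measurable S by exact: measurable_affine_preimage.
  pose f z := h (b + z *m B).
  have mf : mbounded f by exact: mbounded_affine_comp.
  have eq2 : \int[mu]_(z in S) f z = `|\det B|^-1 * \int[mu]_(x in Om) h x.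
    by apply: Rintegral_affine => //; [exact: mh.1|exact: mbounded_integrable].
  have fE z : f z = - 4 * bump_weight z * dotv z (v (b + z *m B) *m C).
    by rewrite /f /h grad_bump (addrC b) addrK -mulmxA BC mulmx1.
  pose Qp := [set z : Rd | cube 0 1 z /\ 0 < 1 * z ord0 ord0].
  pose Qm := [set z : Rd | cube 0 1 z /\ 0 < - 1 * z ord0 ord0].
  have mQp : measurable Qp by exact: measurable_halfcube.
  have mQm : measurable Qm by exact: measurable_halfcube.
  have mQ := measurable_cube (0 : Rd) 1.
  have bQ := box_bounded_cube (0 : Rd) 1.
  pose gp z := - 4 * bump_weight z * dotv z ((up + z *m B *m Gp) *m C).
  pose gm z := - 4 * bump_weight z * dotv z ((um + z *m B *m Gm) *m C).
  have near z : cube 0 1 z ->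
      (0 < z ord0 ord0 -> Om (b + z *m B) /\ v (b + z *m B) = up + z *m B *m Gp) /\
      (z ord0 ord0 < 0 -> (Om (b + z *m B) /\ v (b + z *m B) = um + z *m B *m Gm) \/
        (~ Om (b + z *m B) /\ um + z *m B *m Gm = 0)).
    move=> zQ; have := hnear (b + z *m B); rewrite [b + _ - b]addrC addKr.
    have -> : dotv a (z *m B) = r * dl * z ord0 ord0.
      rewrite dotvC dotvE -mulmxA /B /zoom -[_ *m A *m _]mulmxA Aa.
      rewrite /stretch -scalemxAl mulmxDl mulmxBl mul1mx -scalemxAl.
      have -> : axis_proj R n *m axis_col R n = axis_col R n by rewrite /axis_proj -mulmxA axis_rowcol mulmx1.
      by rewrite subrr addr0 scalerA -scalemxAr mul_axis_col mxE [X in _ * X]mxE eqxx.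
    rewrite pmulr_rgt0 ?mulr_gt0 // pmulr_rlt0 ?mulr_gt0 //; apply => i.
    rewrite [X in `|X - _|]mxE (addrC (b ord0 i)) addrK; apply: le_lt_trans rrho.
    apply: le_trans (mnorm_entry _ _ _) _; apply: le_trans (mnormM _ _) _.
    have mB : mnorm B <= r * KP * mnorm A.
      apply: le_trans (mnormM _ _) _; rewrite ler_wpM2r ?mnorm_ge0 //.
      by apply: mnorm_stretch => //; rewrite dl0 (le_trans dlr).
    have -> : r * (n.+1%:R * KP * mnorm A) = n.+1%:R * (r * KP * mnorm A) by ring.
    by rewrite ler_pM ?mnorm_ge0 //; exact: mnorm_cube.
  (* The weight restricts the integral to the unit cube, the plane z_0 = 0 is null, and each half
     cube sees one affine field. At a boundary face the lower half lies outside Om, and there [gm]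
     vanishes, so the formula holds in both cases. *)
  have eq3 : \int[mu]_(z in S) f z = \int[mu]_(z in Qp) gp z + \int[mu]_(z in Qm) gm z.
    have [mN N0] := measurable_null_plane.
    transitivity (\int[mu]_(z in S `&` cube 0 1) f z).
      rewrite Rintegral_mkcond [RHS]Rintegral_mkcond; apply: eq_Rintegral => z _.
      rewrite /patch in_setI; case: (z \in S) => //=; case: (boolP (z \in cube 0 1)) => // /negP zQ.
      by rewrite fE bump_weight_out ?mulr0 ?mul0r // => zq; apply: zQ; exact/mem_set.
    have mSQ : measurable (S `&` cube 0 1) by exact: measurableI.
    have bSQ : box_bounded (S `&` cube 0 1) by exact: box_boundedS bQ.
    rewrite {1}/Rintegral (negligible_integral mN mSQ (mbounded_integrable mSQ bSQ mf) N0).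
    rewrite -[LHS]/(\int[mu]_(z in _) f z).
    have -> : (S `&` cube 0 1) `\` [set z | z ord0 ord0 = 0] = (S `&` Qp) `|` (S `&` Qm).
      apply/seteqP; split => z.
        move=> [[Sz Qz] /= z0]; case: (ltrgt0P (z ord0 ord0)) => h0.
        - by left; split => //; split => //; rewrite mul1r.
        - by right; split => //; split => //; rewrite mulN1r oppr_gt0.
        - by case: z0.
      move=> [[Sz [Qz]]|[Sz [Qz]]]; rewrite ?mul1r ?mulN1r ?oppr_gt0 => z0; split => //= zz;
        by move: z0; rewrite zz ltxx.
    have bSp : box_bounded (S `&` Qp) by apply: box_boundedS bQ => z [_ []].
    have bSm : box_bounded (S `&` Qm) by apply: box_boundedS bQ => z [_ []].
    have mSp : measurable (S `&` Qp) by exact: measurableI.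
    have mSm : measurable (S `&` Qm) by exact: measurableI.
    have iU : mu.-integrable ((S `&` Qp) `|` (S `&` Qm)) (EFin \o f).
      apply: mbounded_integrable => //; first exact: measurableU.
      by apply: box_boundedS bQ => z [[_ []]|[_ []]].
    have dis : [disjoint S `&` Qp & S `&` Qm].
      apply/disj_setPS => z [[_ [_ zp]] [_ [_ zm]]]; move: zp zm; rewrite mul1r mulN1r oppr_gt0 => zp.
      by rewrite ltNge ltW.
    rewrite (Rintegral_setU mSp mSm iU dis).
    congr (_ + _); rewrite Rintegral_mkcond [RHS]Rintegral_mkcond; apply: eq_Rintegral => z _;
      rewrite /patch in_setI.
    - case: (boolP (z \in Qp)) => [/set_mem[zQ zp]|]; last by rewrite andbF.
      rewrite mul1r in zp; have [/(_ zp)[Sz vz] _] := near z zQ.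
      by rewrite mem_set //= fE vz.
    - case: (boolP (z \in Qm)) => [/set_mem[zQ zp]|]; last by rewrite andbF.
      rewrite mulN1r oppr_gt0 in zp; have [_ /(_ zp)[[Sz vz]|[Sz vz]]] := near z zQ.
        by rewrite mem_set //= fE vz.
      by rewrite memNset //= /gm vz mul0mx dotv0r mulr0.
  have Hp : `|r * dl * \int[mu]_(z in Qp) gp z + 4 * dotv up a * kap| <= Kp * r.
    exact: (hKp r dl r01 d01).
  have Hm : `|r * dl * \int[mu]_(z in Qm) gm z + 4 * dotv um a * - kap| <= Km * r.
    by rewrite /kap -bump_moment_reflect; exact: (hKm r dl r01 d01).
  have Hf : `|r * dl * \int[mu]_(z in S) f z| <= Kw * (`|\det A|^-1 + 1) * r.
    rewrite eq2.
    have -> : \int[mu]_(x in Om) h x = - \int[mu]_(x in Om) (w x * phi x).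
      by apply/eqP; rewrite -addr_eq0; apply/eqP.
    have A0 : 0 < `|\det A| by rewrite normr_gt0 -unitfE -unitmxE.
    have := hKw b C dl uC dl0; rewrite -/phi dC => hw.
    rewrite !mulrN normrN mulrA normrM ger0_norm; last first.
      by rewrite mulr_ge0 ?invr_ge0 // ltW // mulr_gt0.
    apply: (@le_trans _ _ (r * dl * `|\det B|^-1 * (Kw * (dl + dl^-1 * (dl * dl * `|\det A|))))).
      by rewrite ler_wpM2l // mulr_ge0 ?invr_ge0 // ltW // mulr_gt0.
    rewrite dB le_eqVlt; apply/orP; left; apply/eqP; move: A0 dl0; set mA := `|\det A|; move=> A0 dl0'.
    by field; rewrite !lt0r_neq0.
  move: Hf; rewrite eq3 mulrDr => Hf; exact: jump_arith Hp Hm Hf.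
apply/eqP; rewrite -subr_eq0; apply/negPn/negP => ne.
pose D := `|4 * kap * (dotv up a - dotv um a)|.
have D0 : 0 < D by rewrite normr_gt0 mulf_neq0 // mulf_neq0 // lt0r_neq0.
pose L := n.+1%:R * KP * mnorm A.
have L0 : 0 <= L by rewrite !mulr_ge0 ?mnorm_ge0.
set K := Kp + Km + _ in key.
have K1 : 0 < `|K| + 1 by rewrite ltr_pwDr.
have L1 : 0 < L + 1 by rewrite ltr_pwDr.
(* Small enough for the bump to stay in the neighbourhood where the field is known, and for the
   bound K r to be at most D/2, which contradicts D <= K r. *)
pose r := Num.min 1 (Num.min (rho / (L + 1)) (D / (2 * (`|K| + 1)))).
have r0 : 0 < r by rewrite !lt_min ltr01 !divr_gt0 // mulr_gt0.
have r1 : r <= 1 by rewrite ge_min lexx.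
have rL : r <= rho / (L + 1) by rewrite !ge_min lexx orbT.
have rK : r <= D / (2 * (`|K| + 1)) by rewrite !ge_min lexx !orbT.
have := key r; rewrite r0 r1 -/L -/D => /(_ isT) h.
have rLr : r * L < rho.
  apply: (@lt_le_trans _ _ (r * (L + 1))); first by rewrite ltr_pM2l // ltrDl.
  by rewrite -ler_pdivlMr.
have := h rLr; apply/negP; rewrite -ltNge.
apply: (@le_lt_trans _ _ ((`|K| + 1) * r)).
  by rewrite ler_wpM2r ?(ltW r0) // (le_trans (ler_norm K)) // lerDl.
apply: (@le_lt_trans _ _ (D / 2)); last by rewrite ltr_pdivrMr // ltr_pMr // ltr1n.
rewrite -ler_pdivlMl // (le_trans rK) // invfM mulrA mulrC //.
Qed.

End jump.

(** * Polynomials of degree 0 and 1 as constants and affine maps *)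

Section affine_polynomials.
Variables (R : realType) (d : nat).
Implicit Types f g : 'rV[R]_d -> R.

Lemma poly_fun0P f : poly_fun 0 f <-> exists a : R, forall x, f x = a.
Proof.
have m0 (m : {ffun 'I_d -> 'I_1}) : m = [ffun=> ord0].
  by apply/ffunP => i; rewrite ffunE; exact: ord1.
split.
  move=> [c fE]; exists (c [ffun=> ord0]) => x; rewrite fE.
  rewrite (bigD1 [ffun=> ord0]) /=; last by rewrite big1 // => i _; rewrite ffunE.
  rewrite big1 ?mulr1 => [|i _]; last by rewrite ffunE expr0.
  by rewrite big1 ?addr0 // => m /andP[_]; rewrite (m0 m) eqxx.
move=> [a fE]; exists (fun=> a) => x; rewrite fE.
rewrite (bigD1 [ffun=> ord0]) /=; last by rewrite big1 // => i _; rewrite ffunE.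
rewrite big1 ?mulr1 => [|i _]; last by rewrite ffunE expr0.
by rewrite big1 ?addr0 // => m /andP[_]; rewrite (m0 m) eqxx.
Qed.

Lemma poly_funD k f g : poly_fun k f -> poly_fun k g -> poly_fun k (fun x => f x + g x).
Proof.
move=> [c fE] [c' gE]; exists (fun m => c m + c' m) => x; rewrite fE gE -big_split.
by apply: eq_bigr => m _ /=; rewrite mulrDl.
Qed.

Lemma poly_funZ k a f : poly_fun k f -> poly_fun k (fun x => a * f x).
Proof.
move=> [c fE]; exists (fun m => a * c m) => x; rewrite fE mulr_sumr.
by apply: eq_bigr => m _ /=; rewrite mulrA.
Qed.

Lemma poly_fun_monomial k (m : {ffun 'I_d -> 'I_k.+1}) : (\sum_i m i <= k)%N ->
  poly_fun k (fun x : 'rV[R]_d => \prod_i x ord0 i ^+ m i).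
Proof.
move=> mk; exists (fun m' => (m' == m)%:R) => x; rewrite (bigD1 m) //= eqxx mul1r.
by rewrite [X in _ + X]big1 ?addr0 // => m' /andP[_ /negbTE ->]; rewrite mul0r.
Qed.

Lemma poly_fun1P f : poly_fun 1 f <-> exists (a : 'rV[R]_d) (b : R), forall x, f x = b + dotv a x.
Proof.
split.
  move=> [c fE].
  have mono (m : {ffun 'I_d -> 'I_2}) : (\sum_i m i <= 1)%N ->
      exists (a : 'rV[R]_d) (b : R), forall x : 'rV[R]_d, \prod_i x ord0 i ^+ m i = b + dotv a x.
    move=> m1; have [[i mi]|h] := pselect (exists i, m i != ord0).
      have mi1 : m i = 1%N :> nat.
        by apply/eqP; rewrite eqn_leq -ltnS ltn_ord /= lt0n.
      have mj j : j != i -> m j = 0%N :> nat.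
        move=> ji; apply/eqP; rewrite -leqn0; move: m1.
        rewrite (bigD1 i) //= mi1 (bigD1 j) //= addnA add1n => h.
        by have := leq_trans (leq_addr _ _) h; rewrite ltnS.
      exists (delta_mx ord0 i), 0 => x; rewrite add0r (bigD1 i) //= mi1 expr1 big1 ?mulr1; last first.
        by move=> j /mj ->; rewrite expr0.
      rewrite /dotv (bigD1 i) //= mxE !eqxx mul1r big1 ?addr0 // => j /negbTE ji.
      by rewrite mxE ji andbF mul0r.
    exists 0, 1 => x; rewrite dotv0l addr0 big1 // => i _.
    have -> : m i = ord0 by apply: contrapT => /eqP mi; apply: h; exists i.
    by rewrite expr0.
  have [a [b h]] : exists (a : 'rV[R]_d) (b : R), forall x : 'rV[R]_d,
      \sum_(m : {ffun 'I_d -> 'I_2} | (\sum_i m i <= 1)%N) c m * \prod_i x ord0 i ^+ m i = b + dotv a x.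
    elim: (index_enum _) => [|m s [a [b IH]]].
      by exists 0, 0 => x; rewrite big_nil dotv0l addr0.
    have [m1|m1] := boolP (\sum_i m i <= 1)%N; last first.
      by exists a, b => x; rewrite big_cons (negbTE m1).
    have [a' [b' h']] := mono m m1.
    exists (c m *: a' + a), (c m * b' + b) => x; rewrite big_cons m1 IH h'.
    by rewrite dotvDl dotvZl; ring.
  by exists a, b => x; rewrite fE h.
move=> [a [b fE]].
have p1 : poly_fun 1 (fun _ : 'rV[R]_d => 1).
  have := @poly_fun_monomial 1 [ffun=> ord0].
  rewrite big1 => [|i _]; last by rewrite ffunE.
  move=> /(_ isT); congr poly_fun; apply/funext => x; rewrite big1 // => i _.
  by rewrite ffunE expr0.
have px i : poly_fun 1 (fun x : 'rV[R]_d => x ord0 i).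
  have := @poly_fun_monomial 1 [ffun j => if j == i then ord_max else ord0].
  rewrite (bigD1 i) //= ffunE eqxx big1 => [|j /negbTE ji]; last by rewrite ffunE ji.
  move=> /(_ isT); congr poly_fun; apply/funext => x; rewrite (bigD1 i) //= ffunE eqxx expr1 big1 ?mulr1 //.
  by move=> j /negbTE ji; rewrite ffunE ji expr0.
have pa : poly_fun 1 (fun x => dotv a x).
  rewrite /dotv; elim: (index_enum _) => [|i s IH].
    by have := poly_funZ 0 p1; congr poly_fun; apply/funext => x; rewrite big_nil mul0r.
  by have := poly_funD (poly_funZ (a ord0 i) (px i)) IH; congr poly_fun; apply/funext => x; rewrite big_cons.
have := poly_funD (poly_funZ b p1) pa.
by congr poly_fun; apply/funext => x; rewrite fE mulr1.
Qed.

Lemma poly_vfun1P (u : 'rV[R]_d -> 'rV[R]_d) :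
  poly_vfun 1 u <-> exists (p : 'rV[R]_d) (G : 'M[R]_d), forall x, u x = p + x *m G.
Proof.
split.
  move=> pu; have [a ha] := choice (fun i => (poly_fun1P _).1 (pu i)).
  have [b hb] := choice ha.
  exists (\row_i b i), (\matrix_(j, i) a i ord0 j) => x; apply/rowP => i; rewrite !mxE hb; congr (_ + _).
  by apply: eq_bigr => j _; rewrite mxE mulrC.
move=> [p [G uE]] i; apply/poly_fun1P; exists (\row_j G j i), (p ord0 i) => x.
by rewrite uE !mxE; congr (_ + _); apply: eq_bigr => j _; rewrite mxE mulrC.
Qed.

Lemma continuous_rV (V : topologicalType) (f : V -> 'rV[R]_d) x :
  (forall i, {for x, continuous (fun y => f y ord0 i)}) -> {for x, continuous f}.
Proof.
move=> cf U /nbhs_rVP[r r0 rU].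
have : \forall y \near x, forall i, `|f y ord0 i - f x ord0 i| < r.
  apply: (@filter_forall _ _ (fun i y => `|f y ord0 i - f x ord0 i| < r) (nbhs x)) => i.
  have := cf i; move=> /cvgrPdist_lt /(_ _ r0); apply: filterS => y.
  by rewrite distrC.
by apply: filterS => y h; apply: rU.
Qed.

Lemma differentiable_affine (p : 'rV[R]_d) (G : 'M[R]_d) x :
  differentiable (fun x : 'rV[R]_d => p + x *m G) x.
Proof.
apply: (@differentiableD _ _ _ (fun=> p) (mulmxr G)); first exact: differentiable_cst.
apply: linear_differentiable => y; apply: continuous_rV => i.
have -> : (fun y : 'rV[R]_d => mulmxr G y ord0 i) = fun y => dotv (\row_j G j i) y.
  by apply/funext => z; rewrite /= mxE; apply: eq_bigr => j _; rewrite mxE mulrC.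
exact: continuous_dotv.
Qed.

Lemma gradv_affine (p : 'rV[R]_d) (G : 'M[R]_d) x : gradv (fun x => p + x *m G) x = G^T.
Proof.
rewrite /gradv; congr trmx; apply/row_matrixP => i; rewrite !rowE.
rewrite -deriveEjacobian; last exact: differentiable_affine.
set v := delta_mx ord0 i.
apply: cvg_lim => //.
apply: cvg_near_cst; exists 1 => //= h _ h0.
by rewrite mulmxDl opprD addrACA subrr add0r addrK -scalemxAl scalerA mulVf // scale1r.
Qed.

End affine_polynomials.

(** * Normal traces on mesh faces, face integrals and fluxes *)

Section face_jumps.
Variables (R : realType) (n : nat) (K : mesh R n.+1).
Local Notation I := 'I_(nverts K).
Local Notation vset := {set I}.
Local Notation Rd := 'rV[R]_n.+1.
Notation mu := (lebesgue_rV R).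
Implicit Types (T F : vset) (x y b : Rd) (Om : set Rd) (u : vset -> Rd -> Rd).

Lemma mbounded_affine_coord (p : Rd) (G : 'M[R]_n.+1) i : mbounded (fun x : Rd => (p + x *m G) ord0 i).
Proof. exact: (@mbounded_affine_comp R _ _ (fun x : Rd => x ord0 i) p G (@mbounded_coord R _ i)). Qed.

Lemma broken_coord u x i : (broken u x) ord0 i = broken (fun T x => u T x ord0 i) x.
Proof. by rewrite !brokenE summxE; apply: eq_bigr => T _; case: ifP; rewrite ?mxE. Qed.

Lemma mbounded_poly_vfun (v : Rd -> Rd) i : poly_vfun 1 v -> mbounded (fun x => v x ord0 i).
Proof.
move=> /poly_vfun1P[p [G vE]]; have := mbounded_affine_coord p G i.
by congr mbounded; apply/funext => x; rewrite vE.
Qed.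

Lemma mbounded_broken_coord Om u i : triangulation K Om ->
  (forall T, T \in cells K -> poly_vfun 1 (u T)) -> mbounded (fun x => broken u x ord0 i).
Proof.
move=> tri pu.
have := mbounded_broken tri (fun T TK => mbounded_poly_vfun i (pu T TK)).
by congr mbounded; apply/funext => x; rewrite broken_coord.
Qed.

Lemma face_frame T F : cell_like T -> F \in faces_of T ->
  exists o, [/\ #|F| = n.+1, o \in T, o \notin F & T = o |: F].
Proof. by move=> cT /(facesP cT.1)[cF [q [qT qF TF]]]; exists q. Qed.

(** [jump_local] is applied with the frame of F and with a the gradient of the barycentric
    coordinate of the opposite vertex q. Then dotv a (x - b) is that coordinate, so its sign tells
    the two sides of F apart. *)
Lemma face_jump Om u T F b : lipschitz_domain Om -> triangulation K Om ->
  (forall T, T \in cells K -> poly_vfun 1 (u T)) -> H0div Om (broken u) ->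
  T \in cells K -> F \in faces_of T -> relint F b ->
  (forall T', T' \in cells K -> F \in faces_of T' -> T' <> T ->
     dotv (u T b) (outer_normal T F) = dotv (u T' b) (outer_normal T F)) /\
  ((forall T', T' \in cells K -> F \in faces_of T' -> T' = T) ->
     dotv (u T b) (outer_normal T F) = 0).
Proof.
move=> lip tri pu divu TK FT bF.
have cT := triangulation_cell tri TK.
have [q [cF qT qF TF]] := face_frame cT FT.
have [oOm _ _ bOm _] := lip.
have bOm' := bounded_set_box bOm.
set a := bary_grad T q.
have [uA _] := frame_inverse cT cF qT qF TF.
have Aa : frame q F *m a^T = axis_col R n.
  rewrite frame_mul dotvC (bary_grad_opp cT cF TF qF) face_jac_orth // => i j iF jF.
  exact: bary_grad_orth cT TF qF iF jF.
have FT0 : F \subset T by rewrite TF finset.subsetUr.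
have [_ bq] := relint_bary cT FT0 bF qT.
have ab x : dotv a (x - b) = bary T q x by rewrite -bary_affine bq // subr0.
have mv i : mbounded (fun x => broken u x ord0 i) by exact: mbounded_broken_coord i tri pu.
have [NE _] := outer_normalP cT cF TF qF.
have g0 : 0 < norm2 (bary_grad T q) by rewrite norm2_gt0; exact: bary_grad_neq0 cT cF TF qF.
have toN (w w' : Rd) : dotv w a = dotv w' a -> dotv w (outer_normal T F) = dotv w' (outer_normal T F).
  by move=> h; rewrite NE !dotvZr -/a h.
have affine T' : T' \in cells K -> exists G, forall x, u T' x = u T' b + (x - b) *m G.
  move=> T'K; have [p [G uE]] := (poly_vfun1P _).1 (pu _ T'K); exists G => x.
  by rewrite !uE mulmxBl addrA addrAC addrK.
have [G uE] := affine T TK.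
have nearT := near_relint_in cT TF qF bF.
split.
  move=> T' T'K FT' T'T; apply: toN.
  have cT' := triangulation_cell tri T'K.
  have [q' [_ q'T q'F TF']] := face_frame cT' FT'.
  have [G' uE'] := affine T' T'K.
  apply: (jump_local uA Aa oOm bOm' divu mv (Gp := G) (Gm := G')(b := b)).
  apply: filterS2 nearT (near_relint_in cT' TF' q'F bF) => x xT xT'.
  rewrite ab; split.
    move=> /xT xin; split; first exact: interior_simplex_sub lip tri TK _ xin.
    by rewrite (broken_in _ tri TK xin) uE.
  move=> xq; left.
  have xin : (simplex T')° x.
    apply: xT'; rewrite (bary_outer_normal x cT' cF TF' q'F) mulr_gt0 //.
      by rewrite norm2_gt0; exact: bary_grad_neq0 cT' cF TF' q'F.
    rewrite (opposite_normals tri TK T'K FT FT' (nesym T'T)) dotvNl oppr_gt0.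
    by move: xq; rewrite (bary_outer_normal x cT cF TF qF) pmulr_rlt0.
  split; first exact: interior_simplex_sub lip tri T'K _ xin.
  by rewrite (broken_in _ tri T'K xin) uE'.
move=> T1; rewrite -[RHS](dotv0l (outer_normal T F)); apply: toN.
(* On a boundary face the other side is outside Om and the field is continued by 0. *)
apply: (jump_local uA Aa oOm bOm' divu mv (Gp := G) (Gm := 0)(b := b)).
have far : \forall x \near b, forall T', T' \in cells K -> T' != T -> ~ simplex T' x.
  apply: (@filter_forall _ _ (fun T' x => T' \in cells K -> T' != T -> ~ simplex T' x) (nbhs b)) => T'.
  have [T'K|T'K] := boolP (T' \in cells K); last by apply: nearW.
  have [->|T'T] := eqVneq T' T; first by apply: nearW.
  have FT' : ~~ (F \subset T').
    apply/negP => FT'; move/eqP: T'T; apply; apply: T1 => //.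
    by rewrite inE FT' cF eqxx.
  by apply: filterS (near_relint_out tri TK T'K FT0 bF FT') => x.
apply: filterS2 nearT far => x xT xfar; rewrite ab; split.
  move=> /xT xin; split; first exact: interior_simplex_sub lip tri TK _ xin.
  by rewrite (broken_in _ tri TK xin) uE.
move=> xq; right; split; last by rewrite mulmx0 addr0.
move=> /(@subset_closure _ Om); have [-> _ _ _] := tri; move=> [T' /= T'K].
have [->|/(xfar _ T'K)//] := eqVneq T' T.
by rewrite simplexE // => /(_ q qT); rewrite leNgt xq.
Qed.

(** The midpoint of x and a relative interior point b is again in the relative interior; vanishing
    there and at b forces vanishing at x. *)
Lemma affine_relint F (a : Rd) (c : R) : #|F| = n.+1 ->
  (forall b, relint F b -> c + dotv a b = 0) -> forall x, simplex F x -> c + dotv a x = 0.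
Proof.
move=> cF h x [c' [c'0 c'1 xE]].
have [b [k [k0 k1 bE]]] := relint_nonempty cF.
have : relint F (2^-1 *: (x + b)).
  exists (fun i => 2^-1 * (c' i + k i)); split.
  - by move=> i iF; rewrite mulr_gt0 ?invr_gt0 // ltr_wpDl // k0.
  - by rewrite -mulr_sumr big_split /= c'1 k1 mulVf.
  - rewrite xE bE -big_split scaler_sumr; apply: eq_bigr => i _.
    by rewrite /= -scalerDl scalerA.
move=> /h; rewrite dotvZr dotvDr.
have := h b; rewrite bE => /(_ _) hb.
have {}hb : c + dotv a b = 0 by apply: h; exists k.
move: hb; rewrite -bE; lra.
Qed.

Lemma face_jump_simplex Om u T F x : lipschitz_domain Om -> triangulation K Om ->
  (forall T, T \in cells K -> poly_vfun 1 (u T)) -> H0div Om (broken u) ->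
  T \in cells K -> F \in faces_of T -> simplex F x ->
  (forall T', T' \in cells K -> F \in faces_of T' -> T' <> T ->
     dotv (u T x) (outer_normal T F) = dotv (u T' x) (outer_normal T F)) /\
  ((forall T', T' \in cells K -> F \in faces_of T' -> T' = T) ->
     dotv (u T x) (outer_normal T F) = 0).
Proof.
move=> lip tri pu divu TK FT xF.
have cT := triangulation_cell tri TK.
have [q [cF qT qF TF]] := face_frame cT FT.
set N := outer_normal T F.
have aff (v : Rd -> Rd) : poly_vfun 1 v -> exists (a : Rd) c, forall y, dotv (v y) N = c + dotv a y.
  move=> /poly_vfun1P[p [G vE]]; exists (N *m G^T), (dotv p N) => y.
  by rewrite vE dotvDl; congr (_ + _); rewrite [in RHS]dotvC !dotvE trmx_mul trmxK mulmxA.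
have [a [c aE]] := aff _ (pu T TK).
split.
  move=> T' T'K FT' T'T; have [a' [c' aE']] := aff _ (pu T' T'K).
  rewrite aE aE'; apply/eqP; rewrite -subr_eq0 opprD addrACA -dotvBl; apply/eqP.
  apply: affine_relint xF => // b bF.
  have [/(_ T' T'K FT' T'T) + _] := face_jump lip tri pu divu TK FT bF.
  by rewrite -/N aE aE' dotvBl => h; lra.
move=> T1; rewrite aE; apply: affine_relint xF => // b bF.
have [_ /(_ T1)] := face_jump lip tri pu divu TK FT bF.
by rewrite -/N aE.
Qed.

Lemma face_param F t : #|F| = n.+1 -> @ref_simplex R n.+1 t ->
  simplex F (face_pt F 0 + t *m face_jac F).
Proof.
move=> cF [t0 t1]; have [e [e_inj eF pe sumF]] := face_enum cF.
pose s (k : 'I_n.+1) := match unlift ord0 k with Some l => t ord0 l | None => 1 - \sum_l t ord0 l end.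
pose c i := \sum_k if e k == i then s k else 0.
have s0 k : 0 <= s k by rewrite /s; case: unliftP => [l _|_]; rewrite ?subr_ge0.
have ce k : c (e k) = s k.
  rewrite /c (bigD1 k) //= eqxx big1 ?addr0 // => l lk.
  by rewrite (negbTE (contraNneq _ lk)) // => /e_inj ->.
have s1 l : s (lift ord0 l) = t ord0 l by rewrite /s liftK.
have s00 : s ord0 = 1 - \sum_l t ord0 l by rewrite /s unlift_none.
exists c; split.
- by move=> i; apply: sumr_ge0 => k _; case: ifP.
- rewrite sumF (eq_bigr _ (fun k _ => ce k)) big_ord_recl s00.
  by rewrite [X in _ + X](eq_bigr (fun l => t ord0 l)) ?subrK // => l _.
- rewrite sumF (eq_bigr (fun k => s k *: vtx (e k))); last by move=> k _; rewrite ce.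
  rewrite big_ord_recl s00 [X in _ = _ + X](eq_bigr (fun l => t ord0 l *: vtx (e (lift ord0 l)))); last first.
    by move=> l _; rewrite s1.
  have -> : face_pt F 0 = vtx (e ord0) by exact: (pe ord0).
  rewrite mulmx_sum_row (eq_bigr (fun l => t ord0 l *: vtx (e (lift ord0 l)) - t ord0 l *: vtx (e ord0))).
    by rewrite big_split /= sumrN -scaler_suml scalerBl scale1r -addrA; congr (_ + _); exact: addrC.
  move=> l _; rewrite -scalerBr; congr (_ *: _); apply/rowP => j.
  by rewrite !mxE (pe (lift ord0 l)) (pe ord0).
Qed.

Lemma eq_face_int F (f g : Rd -> R) : #|F| = n.+1 -> (forall x, simplex F x -> f x = g x) ->
  face_int F f = face_int F g.
Proof.
move=> cF fg; congr (_ * _); apply: eq_Rintegral => t /set_mem tS.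
by rewrite fg //; exact: face_param.
Qed.

Lemma face_integrable F (f : Rd -> R) : mbounded f ->
  (mu n).-integrable (@ref_simplex R n.+1) (EFin \o (fun t => f (face_pt F 0 + t *m face_jac F))).
Proof.
move=> mf; apply: mbounded_integrable; [exact: measurable_ref_simplex|exact: box_bounded_ref_simplex|].
exact: mbounded_affine_comp.
Qed.

Lemma face_intD F (f g : Rd -> R) : mbounded f -> mbounded g ->
  face_int F (fun x => f x + g x) = face_int F f + face_int F g.
Proof.
move=> mf mg; rewrite /face_int -mulrDr; congr (_ * _); apply: RintegralD.
- exact: measurable_ref_simplex.
- exact: face_integrable.
- exact: face_integrable.
Qed.

Lemma face_intZ F a (f : Rd -> R) : mbounded f ->
  face_int F (fun x => a * f x) = a * face_int F f.
Proof.
move=> mf; rewrite /face_int [RHS]mulrCA; congr (_ * _); apply: RintegralZl.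
  exact: measurable_ref_simplex.
exact: face_integrable.
Qed.

Lemma face_int_cst F a : face_int F (fun _ : Rd => a) = a * area F.
Proof.
rewrite /face_int /area mulrCA; congr (_ * _); apply: Rintegral_cst; exact: measurable_ref_simplex.
Qed.

Lemma le_face_int F (f g : Rd -> R) : mbounded f -> mbounded g -> (forall x, f x <= g x) ->
  face_int F f <= face_int F g.
Proof.
move=> mf mg fg; rewrite /face_int ler_wpM2l ?sqrtr_ge0 //; apply: le_Rintegral.
- exact: measurable_ref_simplex.
- exact: face_integrable.
- exact: face_integrable.
- by move=> t _; exact: fg.
Qed.

Lemma area_gt0 T F : cell_like T -> F \in faces_of T -> 0 < area F.
Proof.
move=> cT FT; have [q [cF qT qF TF]] := face_frame cT FT.
have := vol_gt0 cT; rewrite (frame_height cT cF TF qF).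
rewrite pmulr_lgt0 ?divr_gt0 ?ref_vol_gt0 // pmulr_rgt0 // invr_gt0 norm2_gt0.
exact: bary_grad_neq0 cT cF TF qF.
Qed.

Definition flux u T F := face_int F (fun x => dotv (u T x) (outer_normal T F)).

Lemma flux_opp Om u T T' F : lipschitz_domain Om -> triangulation K Om ->
  (forall T, T \in cells K -> poly_vfun 1 (u T)) -> H0div Om (broken u) ->
  T \in cells K -> T' \in cells K -> F \in faces_of T -> F \in faces_of T' -> T' <> T ->
  flux u T' F = - flux u T F.
Proof.
move=> lip tri pu divu TK T'K FT FT' T'T.
have cT := triangulation_cell tri TK.
have [q [cF qT qF TF]] := face_frame cT FT.
have md v N : poly_vfun 1 v -> mbounded (fun x => dotv (v x) N).
  move=> pv; apply: mbounded_sum => i _; apply: mboundedM; last exact: mbounded_cst.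
  exact: mbounded_poly_vfun.
rewrite /flux -mulN1r -face_intZ; last exact/md/pu.
apply: eq_face_int => // x xF.
rewrite (opposite_normals tri TK T'K FT FT' (nesym T'T)) dotvNr mulN1r.
by have [/(_ T' T'K FT' T'T) -> _] := face_jump_simplex lip tri pu divu TK FT xF.
Qed.

Lemma flux_bdry Om u T F : lipschitz_domain Om -> triangulation K Om ->
  (forall T, T \in cells K -> poly_vfun 1 (u T)) -> H0div Om (broken u) ->
  T \in cells K -> F \in faces_of T -> (forall T', T' \in cells K -> F \in faces_of T' -> T' = T) ->
  flux u T F = 0.
Proof.
move=> lip tri pu divu TK FT T1.
have cT := triangulation_cell tri TK.
have [q [cF qT qF TF]] := face_frame cT FT.
rewrite /flux (@eq_face_int _ _ (fun=> 0)) ?face_int_cst ?mul0r // => x xF.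
by have [_ /(_ T1)] := face_jump_simplex lip tri pu divu TK FT xF.
Qed.

End face_jumps.

Lemma double_eq0 (R : realFieldType) d (v : 'rV[R]_d) : v + v = 0 -> v = 0.
Proof.
rewrite -mulr2n -scaler_nat => /eqP; by rewrite scaler_eq0 pnatr_eq0 => /eqP.
Qed.

(** * The density equation *)

Section density.
Variables (R : realType) (n : nat) (K : mesh R n.+1) (Om : set 'rV[R]_n.+1).
Local Notation I := 'I_(nverts K).
Local Notation vset := {set I}.
Local Notation Rd := 'rV[R]_n.+1.
Notation mu := (lebesgue_rV R).
Hypotheses (lip : lipschitz_domain Om) (tri : triangulation K Om).
Variable u : vset -> Rd -> Rd.
Hypotheses (pu : forall T, T \in cells K -> poly_vfun 1 (u T)) (divu : H0div Om (broken u)).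
Implicit Types (T F : vset) (r : vset -> R).

(** Outer normals of distinct cells at F are opposite to each other; with three cells this would
    give N = -N for a unit vector. *)
Lemma face_cells T F : T \in cells K -> F \in faces_of T ->
  (forall T', T' \in cells K -> F \in faces_of T' -> T' = T) \/
  exists T', [/\ T' \in cells K, F \in faces_of T', T' != T &
    forall T'', T'' \in cells K -> F \in faces_of T'' -> T'' = T \/ T'' = T'].
Proof.
move=> TK FT; have cT := triangulation_cell tri TK.
have [q [cF qT qF TF]] := face_frame cT FT.
have [h|h] := pselect (exists T', [/\ T' \in cells K, F \in faces_of T' & T' != T]); last first.
  left => T' T'K FT'; apply: contrapT => T'T; apply: h; exists T'; split => //; exact/eqP.
right; have [T' [T'K FT' T'T]] := h; exists T'; split => // T'' T''K FT''.
have [->|T''T] := eqVneq T'' T; first by left.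
have [->|T''T'] := eqVneq T'' T'; first by right.
exfalso.
have [_ [N1 _]] := outer_normalP cT cF TF qF.
have E1 := opposite_normals tri TK T'K FT FT' (nesym (elimN eqP T'T)).
have E2 := opposite_normals tri TK T''K FT FT'' (nesym (elimN eqP T''T)).
have E3 := opposite_normals tri T'K T''K FT' FT'' (nesym (elimN eqP T''T')).
move: N1; have -> : outer_normal T F = 0.
  apply: double_eq0; by rewrite -[X in X + _]opprK -E1 -E3 E2 addNr.
by rewrite dotv0l => /esym/eqP; rewrite oner_eq0.
Qed.

Lemma cells_with_face_sum (V : nmodType) (g : vset -> V) T F : T \in cells K -> F \in faces_of T ->
  (forall T', T' \in cells K -> F \in faces_of T' -> T' = T) ->
  \sum_(T' in cells K | F \in faces_of T') g T' = g T.
Proof.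
move=> TK FT T1; rewrite (bigD1 T) /= ?TK // big1 ?addr0 // => T' /andP[/andP[T'K FT']].
by rewrite (T1 T') // eqxx.
Qed.

Lemma cells_with_face_sum2 (V : nmodType) (g : vset -> V) T T' F : T \in cells K -> F \in faces_of T ->
  T' \in cells K -> F \in faces_of T' -> T' != T ->
  (forall T'', T'' \in cells K -> F \in faces_of T'' -> T'' = T \/ T'' = T') ->
  \sum_(T'' in cells K | F \in faces_of T'') g T'' = g T + g T'.
Proof.
move=> TK FT T'K FT' T'T T2; rewrite (bigD1 T) /= ?TK //; congr (_ + _).
rewrite (bigD1 T') /= ?T'K ?FT' // big1 ?addr0 // => T'' /andP[/andP[/andP[T''K FT''] n1] n2].
by have [E|E] := T2 T'' T''K FT''; [rewrite E eqxx in n1|rewrite E eqxx in n2].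
Qed.

(** [nrm F] is the outer normal of T up to sign, and distinct cells at F have distinct outer
    normals, so the choice in [upwind_cell] has one candidate at most. For zero flux only membership
    in the mesh is recorded: the upwind value is then multiplied by 0. *)
Lemma upwindP T F : T \in cells K -> F \in faces_of T ->
  upwind_cell u T F \in cells K /\
  (0 < flux u T F -> upwind_cell u T F = T) /\
  (forall T', T' \in cells K -> F \in faces_of T' -> T' != T -> flux u T F < 0 ->
     upwind_cell u T F = T').
Proof.
move=> TK FT; have cT := triangulation_cell tri TK.
have [q [cF qT qF TF]] := face_frame cT FT.
have [_ un] := outer_normalP cT cF TF qF.
have FTs : F \subset T by move: FT; rewrite inE => /andP[].
have FK : F \in faces K by apply/bigcupP; exists T.
have [_ _ _ /(_ F FK) unF] := tri.
have md N : mbounded (fun x => dotv (u T x) N).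
  apply: mbounded_sum => i _; apply: mboundedM; last exact: mbounded_cst.
  exact/mbounded_poly_vfun/pu.
have faceI T' : F \subset T' -> F \in faces_of T' by move=> h; rewrite inE h cF eqxx.
have uniq T1 T2 : T1 \in cells K -> T2 \in cells K -> F \in faces_of T1 -> F \in faces_of T2 ->
    outer_normal T1 F = outer_normal T2 F -> T1 = T2.
  move=> T1K T2K F1 F2 E; apply: contrapT => T12.
  have := opposite_normals tri T1K T2K F1 F2 T12; rewrite -E => /eqP.
  rewrite -addr_eq0 => /eqP/double_eq0 z.
  have c1 := triangulation_cell tri T1K.
  have [q1 [_ q1T q1F TF1]] := face_frame c1 F1.
  have [_ [+ _]] := outer_normalP c1 cF TF1 q1F.
  by rewrite z dotv0l => /esym/eqP; rewrite oner_eq0.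
have pickE s T' : T' \in cells K -> F \in faces_of T' -> outer_normal T' F = s ->
    odflt T [pick T' in cells K | (F \subset T') && (outer_normal T' F == s)] = T'.
  move=> T'K FT' sE; case: pickP => [T1 /andP[T1K /andP[F1 /eqP E1]] /=|/(_ T')].
    by apply: uniq => //; [exact: faceI|rewrite E1 sE].
  by move: FT'; rewrite inE => /andP[-> _]; rewrite T'K sE eqxx.
set s := if 0 <= face_int F (fun x => dotv (u T x) (nrm F)) then nrm F else - nrm F.
have upE : upwind_cell u T F = odflt T [pick T' in cells K | (F \subset T') && (outer_normal T' F == s)] by [].
have nrmE : nrm F = outer_normal T F \/ nrm F = - outer_normal T F.
  have [NE _] := outer_normalP cT cF TF qF.
  have [s' [] -> ->] := unit_normal_face cT cF TF qF unF; rewrite NE.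
    by right; rewrite scaleNr opprK div1r.
  by left; rewrite mulN1r.
have fN : face_int F (fun x => dotv (u T x) (- outer_normal T F)) = - flux u T F.
  rewrite -mulN1r -face_intZ //; apply: eq_face_int => // x _; by rewrite dotvNr mulN1r.
split; last split.
- by rewrite upE; case: pickP => [T1 /andP[T1K _]|_].
- move=> fpos; rewrite upE; apply: pickE => //; rewrite /s; case: nrmE => ->.
    by rewrite -/(flux u T F) ltW.
  by rewrite fN oppr_ge0 leNgt fpos /= opprK.
- move=> T' T'K FT' T'T fneg; rewrite upE; apply: pickE => //.
  rewrite (opposite_normals tri TK T'K FT FT' (nesym (elimN eqP T'T))) /s; case: nrmE => ->.
    by rewrite -/(flux u T F) leNgt fneg.
  by rewrite fN oppr_ge0 ltW.
Qed.

Variable tau : R.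
Hypothesis tau0 : 0 < tau.

(** The left side of (B) tested with the indicator of the cell T, in terms of the cell values of the
    density. *)
Definition upwind_op r T : R :=
  tau^-1 * vol T * r T + \sum_(F in faces_of T) flux u T F * r (upwind_cell u T F).

(* S is the set of cells with negative density. *)
Lemma upwind_face_sum (S : {set vset}) r F :
  (forall T, T \in S -> r T <= 0) -> (forall T, T \notin S -> 0 <= r T) ->
  \sum_(T in cells K | F \in faces_of T) (if T \in S then flux u T F * r (upwind_cell u T F) else 0) <= 0.
Proof.
move=> Sneg Spos.
have [[T [TK FT]]|h] := pselect (exists T, T \in cells K /\ F \in faces_of T); last first.
  by rewrite big1 // => T /andP[TK FT]; case: h; exists T.
have [T1|[T' [T'K FT' T'T T2]]] := face_cells TK FT.
  rewrite (cells_with_face_sum _ TK FT T1) (flux_bdry lip tri pu divu TK FT T1) mul0r.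
  by case: ifP.
rewrite (cells_with_face_sum2 _ TK FT T'K FT' T'T T2).
have fE := flux_opp lip tri pu divu TK T'K FT FT' (elimN eqP T'T).
have [_ [upT /(_ T' T'K FT' T'T) upT']] := upwindP TK FT.
have [_ [up'T' /(_ T TK FT) up'T]] := upwindP T'K FT'.
rewrite eq_sym in up'T; have {}up'T := up'T T'T.
rewrite fE in up'T' up'T *; rewrite oppr_gt0 oppr_lt0 in up'T' up'T.
(* Both terms carry the same upwind value. If both cells are in S they cancel; if only the upwind
   cell is, a positive flux meets a nonpositive value; if only the downwind cell is, a negative flux
   meets a nonnegative value. *)
case: (ltrgt0P (flux u T F)) => f0.
- rewrite (upT f0) (up'T f0); case: ifP => TS; case: ifP => T'S; rewrite ?addr0 ?add0r ?mulNr.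
  + by rewrite subrr.
  + by apply: mulr_ge0_le0; [exact: ltW|exact: Sneg].
  + by rewrite oppr_le0 mulr_ge0 //; [exact: ltW|rewrite Spos // TS].
  + by [].
- rewrite (upT' f0) (up'T' f0); case: ifP => TS; case: ifP => T'S; rewrite ?addr0 ?add0r ?mulNr.
  + by rewrite subrr.
  + by apply: mulr_le0_ge0; [exact: ltW|rewrite Spos // T'S].
  + by rewrite oppr_le0; apply: mulr_le0; [exact: ltW|exact: Sneg].
  + by [].
- by rewrite f0 oppr0 !mul0r; do 2 case: ifP => _; rewrite ?addr0.
Qed.

Lemma sum_cells_faces (g : vset -> vset -> R) :
  \sum_(T in cells K) \sum_(F in faces_of T) g T F =
  \sum_F \sum_(T in cells K | F \in faces_of T) g T F.
Proof.
by rewrite (exchange_big_dep xpredT).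
Qed.

Lemma upwind_op_ge0 r : (forall T, T \in cells K -> 0 <= upwind_op r T) ->
  forall T, T \in cells K -> 0 <= r T.
Proof.
move=> Lr T TK; rewrite leNgt; apply/negP => rT.
(* Set to 0 off the mesh, so that the sign conditions of [upwind_face_sum] hold for all vertex
   sets. *)
pose r' T := if T \in cells K then r T else 0.
pose S := [set T in cells K | r T < 0]%SET.
have h1 : 0 <= \sum_(T in cells K) (if T \in S then upwind_op r T else 0).
  by apply: sumr_ge0 => T' T'K; case: ifP => // _; exact: Lr.
have h2 : \sum_(T in cells K) (if T \in S then upwind_op r T else 0) =
   \sum_(T in cells K) (if T \in S then tau^-1 * vol T * r T else 0) +
   \sum_(T in cells K) \sum_(F in faces_of T) (if T \in S then flux u T F * r' (upwind_cell u T F) else 0).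
  rewrite -big_split; apply: eq_bigr => T' T'K /=.
  case: ifP => _; last by rewrite big1 ?addr0.
  rewrite /upwind_op; congr (_ + _); apply: eq_bigr => F FT'.
  by have [upK _] := upwindP T'K FT'; rewrite /r' upK.
have h3 : \sum_(T in cells K) \sum_(F in faces_of T) (if T \in S then flux u T F * r' (upwind_cell u T F) else 0) <= 0.
  rewrite sum_cells_faces; apply: sumr_le0 => F _; apply: upwind_face_sum.
  - by move=> T'; rewrite inE /r' => /andP[-> /ltW].
  - move=> T'; rewrite inE /r'; case: ifP => //= _; by rewrite -leNgt.
have h4 : \sum_(T in cells K) (if T \in S then tau^-1 * vol T * r T else 0) < 0.
  rewrite (bigD1 T) //= inE TK rT /=.
  have tv T' : T' \in cells K -> 0 < tau^-1 * vol T'.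
    move=> T'K; rewrite mulr_gt0 ?invr_gt0 //; exact: vol_gt0 (triangulation_cell tri T'K).
  rewrite ltr_wnDr //; last by rewrite pmulr_rlt0 // tv.
  apply: sumr_le0 => T' /andP[T'K _]; rewrite inE; case: ifP => // /andP[_ /ltW].
  by rewrite pmulr_rle0 // tv.
by move: h1; rewrite h2 leNgt ltr_wnDr.
Qed.

(** At a cell with value 0 the mass and outflow terms vanish, and inflow contributes a negative flux
    times a nonnegative value, so the operator could not be positive there. *)
Lemma upwind_op_gt0 r : (forall T, T \in cells K -> 0 < upwind_op r T) ->
  forall T, T \in cells K -> 0 < r T.
Proof.
move=> Lr; have r0 := upwind_op_ge0 (fun T TK => ltW (Lr T TK)).
move=> T TK; rewrite lt_def r0 // andbT; apply/negP => /eqP rT.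
have := Lr T TK; rewrite /upwind_op rT mulr0 add0r ltNge => /negP; apply.
apply: sumr_le0 => F FT; have [upK [upT upT']] := upwindP TK FT.
case: (ltrgt0P (flux u T F)) => f0.
- by rewrite (upT f0) rT mulr0.
- by rewrite mulr_le0_ge0 ?r0 // ltW.
- by rewrite f0 mul0r.
Qed.

Lemma upwind_op_sum r : \sum_(T in cells K) upwind_op r T = \sum_(T in cells K) tau^-1 * vol T * r T.
Proof.
rewrite /upwind_op big_split /= sum_cells_faces -[RHS]addr0; congr (_ + _).
rewrite big1 // => F _.
have [[T [TK FT]]|h] := pselect (exists T, T \in cells K /\ F \in faces_of T); last first.
  by rewrite big1 // => T /andP[TK FT]; case: h; exists T.
have [T1|[T' [T'K FT' T'T T2]]] := face_cells TK FT.
  by rewrite (cells_with_face_sum _ TK FT T1) (flux_bdry lip tri pu divu TK FT T1) mul0r.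
rewrite (cells_with_face_sum2 _ TK FT T'K FT' T'T T2).
have fE := flux_opp lip tri pu divu TK T'K FT FT' (elimN eqP T'T).
have [_ [upT /(_ T' T'K FT' T'T) upT']] := upwindP TK FT.
have [_ [up'T' /(_ T TK FT) up'T]] := upwindP T'K FT'.
rewrite eq_sym in up'T; have {}up'T := up'T T'T.
rewrite fE in up'T' up'T *; rewrite oppr_gt0 oppr_lt0 in up'T' up'T.
case: (ltrgt0P (flux u T F)) => f0.
- by rewrite (upT f0) (up'T f0) mulNr subrr.
- by rewrite (upT' f0) (up'T' f0) mulNr subrr.
- by rewrite f0 oppr0 !mul0r addr0.
Qed.

(** The matrix is indexed by all vertex sets and acts as the identity on those that are not cells.
    It is injective since positivity applies to a kernel element and to its negative. *)
Lemma upwind_op_solve (b : vset -> R) : exists r, forall T, T \in cells K -> upwind_op r T = b T.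
Proof.
pose N := #|{: vset}|.
pose op r T := if T \in cells K then upwind_op r T else r T.
pose M : 'M[R]_N := \matrix_(k, j) op (fun T => (T == enum_val k)%:R) (enum_val j).
pose fn (x : 'rV[R]_N) T := x ord0 (enum_rank T).
have xM (x : 'rV[R]_N) T : (x *m M) ord0 (enum_rank T) = op (fn x) T.
  rewrite mxE.
  have sx T' : \sum_k x ord0 k * (T' == enum_val k)%:R = fn x T'.
    rewrite (bigD1 (enum_rank T')) //= enum_rankK eqxx mulr1 big1 ?addr0 // => k kT.
    case: eqP => [E|]; last by rewrite mulr0.
    by rewrite E enum_valK eqxx in kT.
  under eq_bigr do rewrite mxE enum_rankK.
  rewrite /op; case: ifP => _; last exact: sx.
  rewrite /upwind_op -sx mulr_sumr.
  under [X in _ = _ + X]eq_bigr => F _ do rewrite -sx mulr_sumr.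
  rewrite exchange_big -big_split; apply: eq_bigr => k _ /=.
  rewrite mulrDr mulr_sumr; congr (_ + _); first by rewrite mulrCA.
  by apply: eq_bigr => F _; rewrite mulrCA.
have uM : M \in unitmx.
  rewrite -row_free_unit -kermx_eq0; apply/eqP/row_matrixP => k.
  have : row k (kermx M) *m M = 0 by apply/sub_kermxP; exact: row_sub.
  move: (row k (kermx M)) => x x0; rewrite row0; apply/rowP => j; rewrite [RHS]mxE.
  have opx T : op (fn x) T = 0 by rewrite -xM x0 mxE.
  have fn0 T : fn x T = 0.
    have := opx T; rewrite /op; case: ifP => // TK _.
    have z T' : T' \in cells K -> upwind_op (fn x) T' = 0 by move=> T'K; have := opx T'; rewrite /op T'K.
    apply/eqP; rewrite eq_le; apply/andP; split; last first.
      by apply: (@upwind_op_ge0 (fn x)) TK => T' T'K; rewrite z.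
    rewrite -oppr_ge0; apply: (@upwind_op_ge0 (fun T => - fn x T)) TK => T' T'K.
    rewrite -(oppr0) -(z T' T'K) /upwind_op mulrN opprD lerD2l -sumrN.
    by rewrite le_eqVlt (eq_bigr (fun F => flux u T' F * - fn x (upwind_cell u T' F))) ?eqxx // => F _; rewrite mulrN.
  by have := fn0 (enum_val j); rewrite /fn enum_valK.
exists (fn ((\row_j b (enum_val j)) *m invmx M)) => T TK.
by have := xM ((\row_j b (enum_val j)) *m invmx M) T; rewrite mulmxKV // /op TK mxE enum_rankK.
Qed.

End density.

(** * Reduction of (B) to cell values *)

Section density_step.
Variables (R : realType) (n : nat) (K : mesh R n.+1) (Om : set 'rV[R]_n.+1).
Local Notation I := 'I_(nverts K).
Local Notation vset := {set I}.
Local Notation Rd := 'rV[R]_n.+1.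
Notation mu := (lebesgue_rV R).
Hypotheses (lip : lipschitz_domain Om) (tri : triangulation K Om).
Implicit Types (T F : vset) (q rho : vset -> Rd -> R).

Lemma Qh1E q T x : in_Qh 1 q -> T \in cells K -> q T x = q T 0.
Proof. by move=> hq TK; have [a aE] := (poly_fun0P _).1 (hq T TK); rewrite !aE. Qed.

Lemma Qh1_cst (r : vset -> R) : in_Qh (K := K) 1 (fun T _ => r T).
Proof. by move=> T TK; apply/poly_fun0P; exists (r T). Qed.

Lemma cell_int_cst T (a : R) : cell_like T -> cell_int T (fun _ : Rd => a) = a * vol T.
Proof. by move=> cT; apply: Rintegral_cst; exact: measurable_simplex. Qed.

Lemma Rintegral_broken_cst (r : vset -> R) (q : vset -> Rd -> R) :
  (forall T x, T \in cells K -> q T x = r T) ->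
  \int[mu n.+1]_(x in Om) broken q x = \sum_(T in cells K) r T * vol T.
Proof.
move=> qE; rewrite Rintegral_broken //; last first.
  move=> T TK; have := @mbounded_cst R n.+1 (r T).
  by congr mbounded; apply/funext => x; rewrite qE.
apply: eq_bigr => T TK; rewrite -cell_int_cst; last exact: triangulation_cell tri TK.
by congr (cell_int T _); apply/funext => x; rewrite qE.
Qed.

Lemma Rintegral_Qh1_mul q rho : in_Qh 1 q -> in_Qh 1 rho ->
  \int[mu n.+1]_(x in Om) (broken rho x * broken q x) = \sum_(T in cells K) rho T 0 * q T 0 * vol T.
Proof.
move=> hq hr.
rewrite -(@Rintegral_broken_cst _ (fun T x => rho T x * q T x)); last first.
  by move=> T x TK; rewrite (Qh1E x hr TK) (Qh1E x hq TK).
apply: eq_Rintegral => x _; apply: (@broken_op2 _ _ _ _ _ _ *%R Om) => //.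
by rewrite mul0r.
Qed.

Variable u : vset -> Rd -> Rd.
Hypotheses (pu : forall T, T \in cells K -> poly_vfun 1 (u T)) (divu : H0div Om (broken u)).

(** For k = 1 densities and test functions are cellwise constant: the volume term has zero gradient,
    and constants come out of the face integrals, leaving the fluxes. *)
Lemma form_cE q rho : in_Qh 1 q -> in_Qh 1 rho ->
  form_c rho u q = \sum_(T in cells K) \sum_(F in faces_of T)
     flux u T F * rho (upwind_cell u T F) 0 * q T 0.
Proof.
move=> hq hr; apply: eq_bigr => T TK.
have cT := triangulation_cell tri TK.
have gq x : grad (q T) x = 0.
  have -> : q T = cst (q T 0) by apply/funext => y; rewrite (Qh1E y hq TK).
  by apply/rowP => i; rewrite !mxE /partial derive_cst.
have -> : cell_int T (fun x => dotv (rho T x *: u T x) (grad (q T) x)) = 0.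
  have -> : (fun x => dotv (rho T x *: u T x) (grad (q T) x)) = fun=> 0.
    by apply/funext => x; rewrite gq dotv0r.
  by rewrite cell_int_cst // mul0r.
rewrite oppr0 add0r /bdry_int; apply: eq_bigr => F FT.
have [cF _] := facesP cT.1 FT.
have [upK _] := upwindP tri pu TK FT.
rewrite -mulrA mulrC /flux -face_intZ; last first.
  apply: mbounded_sum => i _; apply: mboundedM; last exact: mbounded_cst.
  exact/mbounded_poly_vfun/pu.
by apply: eq_face_int => // x _; rewrite (Qh1E x hr upK) (Qh1E x hq TK) -mulrA mulrC.
Qed.

Variables (tau : R) (rhon : vset -> Rd -> R).
Hypotheses (tau0 : 0 < tau) (hn : in_Qh 1 rhon).

(** The indicators of the cells span Q_h, so the variational equation is equivalent to one scalar
    equation per cell. *)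
Lemma density_stepP rho : density_step 1 Om tau u rhon rho <->
  in_Qh 1 rho /\ forall T, T \in cells K ->
    upwind_op u tau (fun T => rho T 0) T = tau^-1 * vol T * rhon T 0.
Proof.
split=> -[hr h]; split => //.
  move=> T TK; pose q T' (_ : Rd) : R := (T' == T)%:R.
  have hq : in_Qh 1 q by exact: Qh1_cst.
  have := h q hq; rewrite !Rintegral_Qh1_mul // form_cE //.
  rewrite !(bigD1 T TK) /= /q eqxx !mulr1 ![\sum_(i in cells K | i != T) _]big1; last 3 first.
  - by move=> T' /andP[_ /negbTE ->]; rewrite mulr0 mul0r.
  - by move=> T' /andP[_ /negbTE ->]; rewrite big1 // => F _; rewrite mulr0.
  - by move=> T' /andP[_ /negbTE ->]; rewrite mulr0 mul0r.
  rewrite !addr0 /upwind_op => E.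
  rewrite -[RHS]mulrA [vol T * rhon T 0]mulrC -E mulrA mulrAC -mulrA; congr (_ + _).
  by apply: eq_bigr => F _; rewrite mulr1.
move=> q hq; rewrite !Rintegral_Qh1_mul // form_cE // !mulr_sumr -big_split.
apply: eq_bigr => T TK /=.
have := congr1 (fun z => z * q T 0) (h T TK); rewrite /= /upwind_op mulrDl mulr_suml => E.
transitivity (tau^-1 * vol T * rhon T 0 * q T 0); last by ring.
by rewrite -E; congr (_ + _); ring.
Qed.

Lemma simplex_nonempty T : cell_like T -> exists x, simplex T x.
Proof.
move=> cT; have [i iT] := card_gt0_witness cT.1; exists (vtx i).
by rewrite simplexE // => j jT; rewrite bary_vtx // ler0n.
Qed.

Lemma density_step_solve : exists rho, density_step 1 Om tau u rhon rho.
Proof.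
have [r rE] := upwind_op_solve lip tri pu divu tau0 (fun T => tau^-1 * vol T * rhon T 0).
exists (fun T _ => r T); apply/density_stepP; split; first exact: Qh1_cst.
by move=> T TK; rewrite -rE.
Qed.

Lemma density_step_pos rho : density_step 1 Om tau u rhon rho ->
  positive_density rhon -> positive_density rho.
Proof.
move=> /density_stepP[hr h] pn T x TK xT; rewrite (Qh1E x hr TK).
apply: (upwind_op_gt0 lip tri pu divu tau0 (r := fun T => rho T 0)) => // T' T'K.
have cT' := triangulation_cell tri T'K.
rewrite h // !mulr_gt0 ?invr_gt0 ?vol_gt0 //.
by have [y yT] := simplex_nonempty cT'; rewrite -(Qh1E y hn T'K) pn.
Qed.

Lemma mass_Qh1 rho : in_Qh 1 rho -> mass Om rho = \sum_(T in cells K) rho T 0 * vol T.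
Proof. by move=> hr; apply: Rintegral_broken_cst => T x TK; exact: Qh1E. Qed.

Lemma density_step_mass rho : density_step 1 Om tau u rhon rho -> mass Om rho = mass Om rhon.
Proof.
move=> /density_stepP[hr h]; rewrite !mass_Qh1 //.
have := upwind_op_sum lip tri pu divu tau (fun T => rho T 0).
rewrite (eq_bigr _ h) => E.
have ti : tau^-1 != 0 by rewrite invr_eq0 lt0r_neq0.
apply: (mulfI ti); rewrite !mulr_sumr; transitivity (\sum_(T in cells K) tau^-1 * vol T * rho T 0).
  by apply: eq_bigr => T _; rewrite -mulrA [vol T * _]mulrC.
by rewrite -E; apply: eq_bigr => T _; rewrite -mulrA [vol T * _]mulrC.
Qed.

End density_step.

(** * The momentum equation *)

Section galerkin.
Variables (F : fieldType) (E : vectType F) (W : E -> Prop).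
Hypotheses (W0 : W 0) (WD : forall c x y, W x -> W y -> W (c *: x + y)).

(** A subspace of largest dimension among those contained in W is all of W: a vector of W outside it
    would enlarge it. *)
Lemma vspace_of_prop : exists V : {vspace E}, forall x, x \in V <-> W x.
Proof.
pose P k := `[< exists V : {vspace E}, (forall x, x \in V -> W x) /\ \dim V = k >].
have P0 : exists k, P k.
  exists 0%N; apply/asboolP; exists 0%VS; split; last exact: dimv0.
  by move=> x; rewrite memv0 => /eqP ->.
have Pb k : P k -> (k <= \dim {:E})%N.
  by move=> /asboolP[V [_ <-]]; apply: dimvS; exact: subvf.
case: (ex_maxnP P0 Pb) => k /asboolP[V [VW dV]] kmax; exists V => x; split; first exact: VW.
move=> Wx; apply: contrapT => /negP xV.
have : P (\dim (V + <[x]>)%VS).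
  apply/asboolP; exists (V + <[x]>)%VS; split => // y /memv_addP[v vV [_ /vlineP[c ->] ->]].
  by rewrite addrC; apply: WD => //; exact: VW.
move/kmax; rewrite -dV; apply/negP; rewrite -ltnNge.
have x0 : x != 0 by apply: contraNneq xV => ->; exact: mem0v.
rewrite dimv_disjoint_sum ?dim_vline ?x0 ?addn1 //.
apply/eqP; rewrite -subv0; apply/subvP => y; rewrite memv_cap => /andP[yV /vlineP[c yE]].
rewrite memv0 yE; apply/eqP; have [->|c0] := eqVneq c 0; first by rewrite scale0r.
move: xV; have -> : x = c^-1 *: y by rewrite yE scalerA mulVf // scale1r.
by rewrite memvZ.
Qed.

Variables (a : E -> E -> F) (L : E -> F).
Hypotheses
  (al : forall c x y z, W x -> W y -> W z -> a (c *: x + y) z = c * a x z + a y z)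
  (ar : forall c x y z, W x -> W y -> W z -> a z (c *: x + y) = c * a z x + a z y)
  (Ll : forall c x y, W x -> W y -> L (c *: x + y) = c * L x + L y)
  (ker : forall v, W v -> a v v = 0 -> L v = 0).

(** The form may be degenerate on W; existence, without uniqueness, requires only that L vanish
    wherever a(v, v) = 0. *)
Lemma galerkin : exists2 u, W u & forall v, W v -> a u v = L v.
Proof.
have [V VW] := vspace_of_prop.
pose m := \dim V; pose b : m.-tuple E := vbasis V.
have bW (i : 'I_m) : W b`_i.
  by apply/VW; apply: vbasis_mem; rewrite mem_nth // size_tuple.
have a0l z : W z -> a 0 z = 0.
  move=> Wz; have := al 0 W0 W0 Wz; rewrite scale0r addr0 mul0r add0r => E0.
  by have := al (-1) W0 W0 Wz; rewrite scaleN1r oppr0 addr0 mulN1r addNr.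
have a0r z : W z -> a z 0 = 0.
  by move=> Wz; have := ar (-1) W0 W0 Wz; rewrite scaleN1r oppr0 addr0 mulN1r addNr.
have L0 : L 0 = 0 by have := Ll (-1) W0 W0; rewrite scaleN1r oppr0 addr0 mulN1r addNr.
have lin (phi : E -> F) : phi 0 = 0 ->
    (forall c x y, W x -> W y -> phi (c *: x + y) = c * phi x + phi y) ->
    forall (s : seq 'I_m) (c : 'I_m -> F), W (\sum_(i <- s) c i *: b`_i) /\
      phi (\sum_(i <- s) c i *: b`_i) = \sum_(i <- s) c i * phi b`_i.
  move=> phi0 phiD s c; elim: s => [|i s [IH1 IH2]]; first by rewrite !big_nil.
  by rewrite !big_cons; split; [exact: WD|rewrite phiD // IH2].
pose lc (c : 'rV[F]_m) := \sum_i c ord0 i *: b`_i.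
have Wlc c : W (lc c) by have [] := lin (fun=> 0) erefl (fun _ _ _ _ _ => esym (etrans (congr1 (+%R^~ 0) (mulr0 _)) (addr0 _))) (index_enum _) (fun i => c ord0 i).
have alc c z : W z -> a (lc c) z = \sum_i c ord0 i * a b`_i z.
  move=> Wz; have [] := lin (a^~ z) (a0l z Wz) (fun k x y Wx Wy => al k Wx Wy Wz) (index_enum _) (fun i => c ord0 i).
  by [].
have arc c z : W z -> a z (lc c) = \sum_i c ord0 i * a z b`_i.
  move=> Wz; have [] := lin (a z) (a0r z Wz) (fun k x y Wx Wy => ar k Wx Wy Wz) (index_enum _) (fun i => c ord0 i).
  by [].
have Llc c : L (lc c) = \sum_i c ord0 i * L b`_i.
  by have [] := lin L L0 Ll (index_enum _) (fun i => c ord0 i).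
pose A : 'M[F]_m := \matrix_(i, j) a b`_i b`_j.
pose be : 'rV[F]_m := \row_j L b`_j.
have alcc c c' : a (lc c) (lc c') = (c *m A *m c'^T) ord0 ord0.
  rewrite alc // mxE; under [RHS]eq_bigr do rewrite mxE mulr_suml.
  rewrite exchange_big; apply: eq_bigr => i _ /=; rewrite arc // mulr_sumr; apply: eq_bigr => j _.
  by rewrite !mxE mulrCA mulrC -!mulrA; congr (_ * _); rewrite mulrC.
have Lbe c : L (lc c) = (be *m c^T) ord0 ord0.
  by rewrite Llc mxE; apply: eq_bigr => i _; rewrite !mxE mulrC.
(* A row lies in the row space of A when it annihilates the cokernel. A cokernel column c satisfies
   A c^T = 0, hence a(c, c) = 0, and the kernel assumption gives L(c) = 0. *)
have : (be <= A)%MS.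
  rewrite submxE; apply/eqP/rowP => k; rewrite [RHS]mxE.
  pose c := (col k (cokermx A))^T.
  have Ac : A *m c^T = 0 by rewrite trmxK colE mulmxA mulmx_coker mul0mx.
  have avv : a (lc c) (lc c) = 0 by rewrite alcc -mulmxA Ac mulmx0 mxE.
  have := ker (Wlc c) avv; rewrite Lbe /c trmxK colE mulmxA -colE mxE => <-.
  by congr (fun_of_matrix _ _ _); exact: val_inj.
move=> /submxP[D beE]; exists (lc D) => // v Wv.
have vV : v \in V by apply/VW.
have -> : v = lc (\row_i coord b i v).
  rewrite [LHS](coord_vbasis vV); apply: eq_bigr => i _; by rewrite mxE.
by rewrite alcc -beE Lbe.
Qed.

End galerkin.

(** * Affine vector fields by their coefficients *)

Section affine_fields.
Variables (R : realType) (n : nat).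
Local Notation Rd := 'rV[R]_n.+1.
Local Notation dof := 'M[R]_(1 + n.+1, n.+1).
Implicit Types (P Q : dof) (x N : Rd).

(* An affine field is encoded by its value at 0 (first row) and its linear part. *)
Definition affv P x : Rd := usubmx P + x *m dsubmx P.

Lemma affvD c P Q x : affv (c *: P + Q) x = c *: affv P x + affv Q x.
Proof.
rewrite /affv; have -> : usubmx (c *: P + Q) = c *: usubmx P + usubmx Q by rewrite linearP.
have -> : dsubmx (c *: P + Q) = c *: dsubmx P + dsubmx Q by rewrite linearP.
rewrite mulmxDr -scalemxAr scalerDr; exact: addrACA.
Qed.

Lemma dsub_dofD c P Q : dsubmx (c *: P + Q) = c *: dsubmx P + dsubmx Q.
Proof. by rewrite linearP. Qed.

Lemma poly_affv P : poly_vfun 1 (affv P).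
Proof. by apply/poly_vfun1P; exists (usubmx P), (dsubmx P). Qed.

Lemma poly_vfun_affv (v : Rd -> Rd) : poly_vfun 1 v -> exists P, v = affv P.
Proof.
move=> /poly_vfun1P[p [G vE]]; exists (col_mx p G); apply/funext => x.
by rewrite vE /affv col_mxKu col_mxKd.
Qed.

Lemma gradv_affv P x : gradv (affv P) x = (dsubmx P)^T.
Proof. exact: gradv_affine. Qed.

Lemma gradv_mul_affv P x N : gradv_mul (affv P) x N = N *m dsubmx P.
Proof. by rewrite /gradv_mul gradv_affv trmx_mul !trmxK. Qed.

Lemma tangentialD N c (v w : Rd) : tangential N (c *: v + w) = c *: tangential N v + tangential N w.
Proof.
rewrite /tangential dotvDl dotvZl scalerDl scalerBr scalerA opprD; exact: addrACA.
Qed.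

(** P encodes the cell field u_h and Q the face field, so this is the term (uhat_h - u_h)_t of
    a_h. *)
Definition affine_jump P Q N x := tangential N (affv Q x - affv P x).

Lemma affine_jumpD N c P Q P' Q' x :
  affine_jump (c *: P + P') (c *: Q + Q') N x = c *: affine_jump P Q N x + affine_jump P' Q' N x.
Proof.
rewrite /affine_jump !affvD -tangentialD; congr tangential.
by rewrite opprD addrACA scalerBr.
Qed.

Lemma mbounded_affine_jump P Q N i : mbounded (fun x => affine_jump P Q N x ord0 i).
Proof.
have mv k : mbounded (fun x => (affv Q x - affv P x) ord0 k).
  have := mboundedB (mbounded_poly_vfun k (poly_affv Q)) (mbounded_poly_vfun k (poly_affv P)).
  by congr mbounded; apply/funext => x; rewrite !mxE.
have md : mbounded (fun x => dotv (affv Q x - affv P x) N).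
  by apply: mbounded_sum => k _; apply: mboundedM; [exact: mv|exact: mbounded_cst].
have := mboundedB (mv i) (mboundedM md (mbounded_cst _ (N ord0 i))).
by congr mbounded; apply/funext => x; rewrite /affine_jump /tangential !mxE.
Qed.

Lemma mbounded_dotv (v w : Rd -> Rd) : (forall i, mbounded (fun x => v x ord0 i)) ->
  (forall i, mbounded (fun x => w x ord0 i)) -> mbounded (fun x => dotv (v x) (w x)).
Proof. by move=> mv mw; apply: mbounded_sum => i _; apply: mboundedM. Qed.

Lemma continuous_affine_jump P Q N i : continuous (fun x => affine_jump P Q N x ord0 i).
Proof.
have ca (P' : dof) k : continuous (fun x => affv P' x ord0 k).
  have -> : (fun x => affv P' x ord0 k) = fun x => usubmx P' ord0 k + dotv (\row_j dsubmx P' j k) x.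
    by apply/funext => x; rewrite !mxE; congr (_ + _); apply: eq_bigr => j _; rewrite !mxE mulrC.
  move=> x; apply: (@continuousD _ _ _ (fun=> _) (dotv _)); first exact: cst_continuous.
  exact: continuous_dotv.
have cv k : continuous (fun x => (affv Q x - affv P x) ord0 k).
  have -> : (fun x => (affv Q x - affv P x) ord0 k) = fun x => affv Q x ord0 k - affv P x ord0 k.
    by apply/funext => x; rewrite !mxE.
  exact: contB.
have -> : (fun x => affine_jump P Q N x ord0 i) =
    fun x => (affv Q x - affv P x) ord0 i - dotv (affv Q x - affv P x) N * N ord0 i.
  by apply/funext => x; rewrite /affine_jump /tangential !mxE.
apply: contB; first exact: cv.
apply: contM; last exact: contC.
by apply: cont_sum => k; apply: contM; [exact: cv|exact: contC].
Qed.

End affine_fields.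

(** * The form a_h on coefficients *)

Section bilinear_form.
Variables (R : realType) (n : nat) (K : mesh R n.+1).
Local Notation I := 'I_(nverts K).
Local Notation vset := {set I}.
Local Notation Rd := 'rV[R]_n.+1.
Local Notation dof := 'M[R]_(1 + n.+1, n.+1).
Notation mu := (lebesgue_rV R).
Implicit Types (T F : vset) (P Q : dof) (x N : Rd) (p q : vset -> dof).

(** The three boundary terms of a_h on one face without the factor nu; kap stands for alpha / h, as
    k = 1. *)
Definition face_form (kap : R) F N P Q (P' Q' : dof) : R :=
  face_int F (fun x => dotv (N *m dsubmx P) (affine_jump P' Q' N x))
  + face_int F (fun x => dotv (N *m dsubmx P') (affine_jump P Q N x))
  + kap * face_int F (fun x => dotv (affine_jump P Q N x) (affine_jump P' Q' N x)).

Definition cell_form (kap : R) p q (p' q' : vset -> dof) T : R :=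
  ddot (dsubmx (p T))^T (dsubmx (p' T))^T * vol T
  + \sum_(F in faces_of T) face_form kap F (outer_normal T F) (p T) (q F) (p' T) (q' F).

Lemma form_aE Om alpha nu (u uh v vh : vset -> Rd -> Rd) p q p' q' : triangulation K Om ->
  (forall T, T \in cells K -> u T = affv (p T)) -> (forall T, T \in cells K -> v T = affv (p' T)) ->
  (forall F x, F \in faces K -> simplex F x -> uh F x = affv (q F) x) ->
  (forall F x, F \in faces K -> simplex F x -> vh F x = affv (q' F) x) ->
  form_a 1 alpha nu u uh v vh =
  nu * \sum_(T in cells K) cell_form (alpha / mesh_size K) p q p' q' T.
Proof.
move=> tri uE vE uhE vhE; congr (_ * _); apply: eq_bigr => T TK.
have cT := triangulation_cell tri TK.
rewrite (uE T TK) (vE T TK) /cell_form expr1n mulr1 -!addrA; congr (_ + _).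
  rewrite -cell_int_cst //; congr (cell_int T _); apply/funext => x.
  by rewrite !gradv_affv.
rewrite /bdry_int mulr_sumr -[X in _ + X]big_split -big_split; apply: eq_bigr => F FT /=.
have [cF _] := facesP cT.1 FT.
have FK : F \in faces K by apply/bigcupP; exists T.
have eq3 (a b e a1 b1 e1 k : R) : a = a1 -> b = b1 -> e = e1 -> a + (b + k * e) = a1 + b1 + k * e1.
  by move=> -> -> ->; rewrite addrA.
apply: eq3; apply: (eq_face_int cF) => x xF.
- by rewrite gradv_mul_affv /affine_jump (vhE _ _ FK xF).
- by rewrite gradv_mul_affv /affine_jump (uhE _ _ FK xF).
- by rewrite /affine_jump (vhE _ _ FK xF) (uhE _ _ FK xF).
Qed.

Lemma face_int_lin F c (f g h : Rd -> R) : mbounded g -> mbounded h ->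
  (forall x, f x = c * g x + h x) -> face_int F f = c * face_int F g + face_int F h.
Proof.
move=> mg mh fE; rewrite -face_intZ // -face_intD //; last exact: mboundedZ.
by congr (face_int F _); apply/funext => x; rewrite fE.
Qed.

Lemma face_form_linr kap F N c P Q P1 Q1 P2 Q2 :
  face_form kap F N P Q (c *: P1 + P2) (c *: Q1 + Q2) =
  c * face_form kap F N P Q P1 Q1 + face_form kap F N P Q P2 Q2.
Proof.
have mJ (P' Q' : dof) := mbounded_affine_jump P' Q' N.
have mc (w : Rd) i : mbounded (fun _ : Rd => w ord0 i) by exact: mbounded_cst.
have md w P' Q' : mbounded (fun x => dotv w (affine_jump P' Q' N x)).
  exact: (@mbounded_dotv _ _ (fun=> w) _ (mc w) (mJ P' Q')).
have lin3 (a b e a1 b1 e1 a2 b2 e2 : R) : a = c * a1 + a2 -> b = c * b1 + b2 -> e = c * e1 + e2 ->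
    a + b + kap * e = c * (a1 + b1 + kap * e1) + (a2 + b2 + kap * e2).
  by move=> -> -> ->; ring.
have J12 x := affine_jumpD N c P1 Q1 P2 Q2 x.
apply: lin3.
- apply: face_int_lin; [exact: md|exact: md|].
  by move=> x; rewrite J12 dotvDr dotvZr.
- apply: face_int_lin; [exact: md|exact: md|].
  by move=> x; rewrite dsub_dofD mulmxDr -scalemxAr dotvDl dotvZl.
- apply: face_int_lin; [exact: (mbounded_dotv (mJ _ _) (mJ _ _))|exact: (mbounded_dotv (mJ _ _) (mJ _ _))|].
  by move=> x; rewrite J12 dotvDr dotvZr.
Qed.

Lemma face_formC kap F N P Q P' Q' : face_form kap F N P Q P' Q' = face_form kap F N P' Q' P Q.
Proof.
have eqC (a b e e1 : R) : e = e1 -> a + b + kap * e = b + a + kap * e1.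
  by move=> ->; rewrite [a + b]addrC.
by apply: eqC; congr (face_int F _); apply/funext => x; rewrite dotvC.
Qed.

Lemma ddotC (A B : 'M[R]_n.+1) : ddot A B = ddot B A.
Proof. by apply: eq_bigr => i _; apply: eq_bigr => j _; rewrite mulrC. Qed.

Lemma ddotDr c (A B C : 'M[R]_n.+1) : ddot A (c *: B + C) = c * ddot A B + ddot A C.
Proof.
rewrite /ddot mulr_sumr -big_split; apply: eq_bigr => i _ /=; rewrite mulr_sumr -big_split.
by apply: eq_bigr => j _ /=; rewrite !mxE; ring.
Qed.

Lemma ddot_ge0 (A : 'M[R]_n.+1) : 0 <= ddot A A.
Proof. by apply: sumr_ge0 => i _; apply: sumr_ge0 => j _; rewrite -expr2 sqr_ge0. Qed.

Lemma ddot_eq0 (A : 'M[R]_n.+1) : ddot A A = 0 -> A = 0.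
Proof.
move=> A0; apply/matrixP => i j; rewrite mxE.
move/eqP: A0; rewrite psumr_eq0 => [/allP /(_ i (mem_index_enum _)) /=|k _]; last first.
  by apply: sumr_ge0 => l _; rewrite -expr2 sqr_ge0.
rewrite psumr_eq0 => [/allP /(_ j (mem_index_enum _)) /=|k _]; last by rewrite -expr2 sqr_ge0.
by rewrite mulf_eq0 orbb => /eqP.
Qed.

(** Cauchy-Schwarz with the unit vector N, one column of G at a time. *)
Lemma dotv_mulmx_le (N : Rd) (G : 'M[R]_n.+1) : dotv N N = 1 ->
  dotv (N *m G) (N *m G) <= ddot G^T G^T.
Proof.
move=> N1; rewrite /ddot /dotv; apply: ler_sum => j _.
have -> : (N *m G) ord0 j = dotv N (row j G^T).
  by rewrite mxE; apply: eq_bigr => i _; rewrite !mxE.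
set g := row j G^T; have -> : \sum_k G^T j k * G^T j k = dotv g g.
  by apply: eq_bigr => k _; rewrite !mxE.
have := dotv_ge0 (g - dotv N g *: N).
rewrite dotvBl !dotvBr !dotvZl !dotvZr N1 [dotv g N]dotvC -subr_ge0.
by rewrite mulr1 subrr subr0.
Qed.

(** Young's inequality 2 g.w >= -(kap/2) |w|^2 - (2/kap) |g|^2 for the two consistency terms. The
    normal derivative g is constant on the face, so its share is a multiple of the area. *)
Lemma face_form_coercive (kap : R) F N P Q : 0 < kap -> dotv N N = 1 ->
  kap / 2 * face_int F (fun x => dotv (affine_jump P Q N x) (affine_jump P Q N x))
  - 2 / kap * ddot (dsubmx P)^T (dsubmx P)^T * area F <= face_form kap F N P Q P Q.
Proof.
move=> k0 N1.
have mJ := mbounded_affine_jump P Q N.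
set g := N *m dsubmx P.
have mc (w : Rd) i : mbounded (fun _ : Rd => w ord0 i) by exact: mbounded_cst.
have mg : mbounded (fun x => dotv g (affine_jump P Q N x)).
  exact: (@mbounded_dotv _ _ (fun=> g) _ (mc g) mJ).
have mw : mbounded (fun x => dotv (affine_jump P Q N x) (affine_jump P Q N x)) by exact: mbounded_dotv.
have gG : dotv g g <= ddot (dsubmx P)^T (dsubmx P)^T by exact: dotv_mulmx_le.
pose X := face_int F (fun x => dotv g (affine_jump P Q N x)).
pose Y := face_int F (fun x => dotv (affine_jump P Q N x) (affine_jump P Q N x)).
have -> : face_form kap F N P Q P Q = X + X + kap * Y by [].
rewrite -/Y.
set D := ddot _ _ in gG *.
have : - (2 / kap * D) * area F <= 2 * X + kap / 2 * Y.
  have -> : 2 * X + kap / 2 * Y = face_int F (fun x => 2 * dotv g (affine_jump P Q N x) +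
      kap / 2 * dotv (affine_jump P Q N x) (affine_jump P Q N x)).
    have E1 := face_intZ F 2 mg; have E2 := face_intZ F (kap / 2) mw.
    have E3 := face_intD F (mboundedZ 2 mg) (mboundedZ (kap / 2) mw).
    exact: (esym (etrans E3 (f_equal2 +%R E1 E2))).
  rewrite -face_int_cst.
  apply: le_face_int; first exact: mbounded_cst.
    exact: (mboundedD (mboundedZ 2 mg) (mboundedZ (kap / 2) mw)).
  move=> x; cbv beta; move: (affine_jump P Q N x) => w.
  (* The square that yields Young's inequality after multiplication by 2 / kap. *)
  have h := dotv_ge0 (g + (kap / 2) *: w).
  have e0 : 0 <= 2 / kap by rewrite divr_ge0 // ltW.
  have h' := mulr_ge0 e0 h; rewrite dotvDl !dotvDr !dotvZl !dotvZr [dotv w g]dotvC in h'.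
  have h2 : 2 / kap * dotv g g <= 2 / kap * D by rewrite ler_wpM2l.
  have E : 2 / kap * (dotv g g + kap / 2 * dotv g w + (kap / 2 * dotv g w + kap / 2 * (kap / 2 * dotv w w))) =
    2 / kap * dotv g g + (2 * dotv g w + kap / 2 * dotv w w) by field; exact: lt0r_neq0.
  rewrite E in h'; lra.
have -> : kap * Y = kap / 2 * Y + kap / 2 * Y by field.
rewrite -subr_ge0 => h; rewrite -subr_ge0; apply: le_trans h _.
rewrite le_eqVlt; apply/orP; left; apply/eqP; ring.
Qed.

Lemma cell_formC kap p q p' q' T : cell_form kap p q p' q' T = cell_form kap p' q' p q T.
Proof.
rewrite /cell_form; apply: f_equal2; first by rewrite ddotC.
apply: eq_bigr => F _.
have E := face_formC kap F (outer_normal T F) (p T) (q F) (p' T) (q' F).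
rewrite E; reflexivity.
Qed.

Lemma cell_form_linr kap c p q p1 q1 p2 q2 T :
  cell_form kap p q (fun T => c *: p1 T + p2 T) (fun F => c *: q1 F + q2 F) T =
  c * cell_form kap p q p1 q1 T + cell_form kap p q p2 q2 T.
Proof.
have lin2 (a a1 a2 s s1 s2 V : R) : a = c * a1 + a2 -> s = c * s1 + s2 ->
    a * V + s = c * (a1 * V + s1) + (a2 * V + s2).
  by move=> -> ->; ring.
apply: lin2; first by rewrite dsub_dofD (linearP trmx) /= ddotDr.
rewrite mulr_sumr -big_split; apply: eq_bigr => F _.
have E := face_form_linr kap F (outer_normal T F) c (p T) (q F) (p1 T) (q1 F) (p2 T) (q2 F).
rewrite E; reflexivity.
Qed.

End bilinear_form.

(** * Shape regularity and coercivity for large alpha *)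

Section mesh_regularity.
Variables (R : realType) (n : nat) (K : mesh R n.+1).
Local Notation I := 'I_(nverts K).
Local Notation vset := {set I}.
Local Notation Rd := 'rV[R]_n.+1.
Implicit Types (T F : vset) (x y z : Rd).

Lemma bary_le1 T i x : cell_like T -> i \in T -> simplex T x -> bary T i x <= 1.
Proof.
move=> cT iT; rewrite simplexE // => /= b0.
have [<- _] := bary_sum x cT; rewrite (bigD1 i) //= lerDl.
by apply: sumr_ge0 => j /andP[jT _]; exact: b0.
Qed.

(** Along the diameter of the ball parallel to the gradient, the barycentric coordinate changes by 2
    r times the gradient norm, while it stays between 0 and 1. So each height is at least the
    diameter of an inscribed ball. *)
Lemma ball_height T o z (r : R) : cell_like T -> o \in T -> 0 <= r ->
  [set y | norm2 (y - z) <= r] `<=` simplex T -> 2 * r * norm2 (bary_grad T o) <= 1.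
Proof.
move=> cT oT r0 rT; set g := bary_grad T o.
have [->|g0] := eqVneq g 0; first by rewrite /norm2 dotv0l sqrtr0 mulr0.
have ng : 0 < norm2 g by rewrite norm2_gt0.
pose N := (norm2 g)^-1 *: g.
have N1 : dotv N N = 1.
  by rewrite dotvZl dotvZr -norm2_sqr expr2 mulKf ?gt_eqF // mulVf // gt_eqF.
have inT s : s ^+ 2 = r ^+ 2 -> simplex T (z + s *: N).
  move=> sr; apply: rT => /=.
  by rewrite addrC addKr /norm2 dotvZl dotvZr N1 mulr1 -expr2 sr sqrtr_sqr ger0_norm.
have h1 := bary_le1 cT oT (inT r erefl).
have h2 : 0 <= bary T o (z + (- r) *: N).
  by have := inT (- r) (sqrrN r); rewrite simplexE //; apply.
have := bary_affine T o (z + r *: N) (z + (- r) *: N); rewrite -/g.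
have -> : z + r *: N - (z + (- r) *: N) = (2 * r) *: N.
  by rewrite scaleNr opprD opprK addrACA subrr add0r -scalerDl mulr_natl mulr2n.
rewrite dotvZr /N dotvZr -norm2_sqr expr2 mulKf ?gt_eqF // => <-.
by rewrite lerBlDr (le_trans h1) // lerDl.
Qed.

Lemma has_sup_diam T : cell_like T ->
  has_ubound [set r | exists x y, [/\ simplex T x, simplex T y & r = norm2 (x - y)]].
Proof.
move=> cT; have [M bM] := box_bounded_simplex T.
exists (Num.sqrt (\sum_(i < n.+1) (2 * M) ^+ 2)) => _ [x [y [xT yT ->]]].
rewrite ler_wsqrtr //; apply: ler_sum => i _; rewrite -expr2.
have := bM x xT i; have := bM y yT i; rewrite !mxE !subr0 => hy hx.
have h : `|x ord0 i - y ord0 i| <= 2 * M.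
  by apply: le_trans (ler_normB _ _) _; lra.
by rewrite -[X in X <= _]real_normK ?num_real // lerXn2r ?nnegrE // (le_trans _ h).
Qed.

Lemma diam_gt0 T : cell_like T -> 0 < diam (simplex T).
Proof.
move=> cT; have [i iT] := card_gt0_witness cT.1.
have [j] : exists j, j \in T :\ i.
  apply: (@card_gt0_witness _ _ _ _ n); have := cardsD1 i T.
  by rewrite iT cT.1 => /eqP; rewrite add1n eqSS => /eqP.
rewrite !inE => /andP[ji jT].
have vT k : k \in T -> simplex T (vtx k).
  move=> kT; rewrite simplexE // => l lT /=; by rewrite bary_vtx // ler0n.
have ij : vtx i != vtx j.
  apply/eqP => E; have := bary_vtx cT iT jT; rewrite -E bary_vtx // eqxx eq_sym (negbTE ji).
  by move/eqP; rewrite oner_eq0.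
have : 0 < norm2 (vtx i - vtx j) by rewrite norm2_gt0 subr_eq0.
move/lt_le_trans; apply; apply: (ub_le_sup (has_sup_diam cT)).
by exists (vtx i), (vtx j); split => //; exact: vT.
Qed.

Variables (Om : set Rd) (sigma : R).
Hypotheses (tri : triangulation K Om) (sr : shape_regular K sigma) (qu : quasi_uniform K sigma).

Lemma mesh_size_gt0 T : T \in cells K -> 0 < mesh_size K.
Proof.
move=> TK; apply: lt_le_trans (diam_gt0 (triangulation_cell tri TK)) _.
rewrite /mesh_size (bigD1 T) //=; by rewrite le_max lexx.
Qed.

(** Chain h <= sigma diam T <= sigma^2 2r, then bound 2r by the height; one factor sigma comes from
    quasi-uniformity and one from shape regularity. *)
Lemma mesh_size_height T o : T \in cells K -> o \in T ->
  mesh_size K * norm2 (bary_grad T o) <= sigma ^+ 2.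
Proof.
move=> TK oT; have cT := triangulation_cell tri TK.
have [z [r [r0 rT dr]]] := sr TK.
have d0 := diam_gt0 cT; have := ball_height cT oT r0 rT.
have H0 : 0 <= norm2 (bary_grad T o) by rewrite sqrtr_ge0.
have s0 : 0 <= sigma.
  rewrite leNgt; apply/negP => s0; have := lt_le_trans d0 dr; rewrite ltNge.
  by rewrite mulr_le0_ge0 // ?mulr_ge0 // ltW.
move: (norm2 _) H0 => H H0 h.
apply: le_trans (ler_wpM2r H0 (qu TK)) _.
apply: le_trans (ler_wpM2r H0 (ler_wpM2l s0 dr)) _.
rewrite -!mulrA mulrA -expr2 -[leRHS]mulr1 ler_wpM2l ?sqr_ge0 //.
by rewrite mulrA.
Qed.

Lemma card_faces_of T : cell_like T -> (#|faces_of T| <= 2 ^ n.+2)%N.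
Proof.
move=> cT; rewrite -cT.1 -card_powerset; apply: subset_leq_card.
by apply/fintype.subsetP => F; rewrite !inE => /andP[].
Qed.

(* 2 ^ (d + 1) bounds the number of faces of a cell; the last factor is the
   constant c of |T| = c * height * |F|. *)
Definition stab_bound : R := 4 * (2 ^ n.+2)%:R * (sigma ^+ 2 + 1) / (ref_vol R n.+1 / ref_vol R n).

(** The summand 1 next to sigma^2 keeps the constant positive for sigma = 0. *)
Lemma stab_bound_gt0 : 0 < stab_bound.
Proof.
rewrite /stab_bound divr_gt0 ?divr_gt0 ?ref_vol_gt0 //.
rewrite mulr_gt0 ?mulr_gt0 ?ltr0n ?expn_gt0 //.
by rewrite ltr_wpDl // sqr_ge0.
Qed.

(** [frame_height] turns |F| into |T| times a gradient norm, which [mesh_size_height] bounds by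
    sigma^2 / h. In the factor 4 of [stab_bound], one 2 comes from Young's inequality and the other
    leaves half of the cell energy. *)
Lemma area_le alpha T F : stab_bound <= alpha -> T \in cells K -> F \in faces_of T ->
  2 / (alpha / mesh_size K) * area F <= (2 ^ n.+2)%:R^-1 * (vol T / 2).
Proof.
move=> ab TK FT; have cT := triangulation_cell tri TK.
have m0 := mesh_size_gt0 TK.
have a0 := lt_le_trans stab_bound_gt0 ab.
have [q [cF qT qF TF]] := face_frame cT FT.
have mh := mesh_size_height TK qT.
have vE := frame_height cT cF TF qF.
have ng : 0 < norm2 (bary_grad T q) by rewrite norm2_gt0 (bary_grad_neq0 cT cF TF).
have A0 := area_gt0 cT FT.
move: vE ab mh ng; rewrite /stab_bound.
have rho0 : 0 < ref_vol R n.+1 / ref_vol R n by rewrite divr_gt0 ?ref_vol_gt0.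
have c0 : 0 < (2 ^ n.+2)%:R :> R by rewrite ltr0n expn_gt0.
move: (ref_vol R n.+1 / ref_vol R n) rho0 (norm2 _) (2 ^ n.+2)%:R c0 => rho rho0 H c c0 vE ab mh H0.
rewrite ler_pdivrMr // in ab.
rewrite vE.
have -> : 2 / (alpha / mesh_size K) * area F =
  (c^-1 * ((H^-1 * area F * rho) / 2)) * ((4 * c * (mesh_size K * H)) / (alpha * rho)).
  by field; rewrite !gt_eqF.
rewrite -[leRHS]mulr1 ler_wpM2l //.
  have ci : 0 < c^-1 by rewrite invr_gt0.
  have Hi : 0 < H^-1 by rewrite invr_gt0.
  by apply: ltW; apply: mulr_gt0 => //; apply: divr_gt0 => //; apply: mulr_gt0 => //; exact: mulr_gt0.
rewrite ler_pdivrMr ?mulr_gt0 // mul1r; apply: le_trans ab.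
by rewrite ler_wpM2l // ?(le_trans mh) ?lerDl //; apply: mulr_ge0 => //; exact: ltW.
Qed.

(** Each face costs at most the fraction 2^-(d+1) of half the gradient energy, and a cell has at
    most 2^(d+1) faces, so the other half survives together with half of the penalty. *)
Lemma cell_form_coercive alpha p q T : stab_bound <= alpha -> T \in cells K ->
  ddot (dsubmx (p T))^T (dsubmx (p T))^T * vol T / 2 + alpha / mesh_size K / 2 *
    \sum_(F in faces_of T) face_int F (fun x =>
      dotv (affine_jump (p T) (q F) (outer_normal T F) x) (affine_jump (p T) (q F) (outer_normal T F) x))
  <= cell_form (alpha / mesh_size K) p q p q T.
Proof.
move=> ab TK; have cT := triangulation_cell tri TK.
have m0 := mesh_size_gt0 TK.
have a0 := lt_le_trans stab_bound_gt0 ab.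
set kap := alpha / mesh_size K; have k0 : 0 < kap by rewrite divr_gt0.
rewrite /cell_form; set D := ddot _ _; have D0 : 0 <= D by exact: ddot_ge0.
pose c : R := (2 ^ n.+2)%:R; have c0 : 0 < c by rewrite ltr0n expn_gt0.
have v0 := vol_gt0 cT.
have cardS : \sum_(F in faces_of T) D * (c^-1 * (vol T / 2)) <= D * vol T / 2.
  have -> : D * vol T / 2 = c * (D * (c^-1 * (vol T / 2))) by field; rewrite gt_eqF.
  rewrite sumr_const -[_ *+ #|_|]mulr_natl; apply: ler_wpM2r.
    apply: mulr_ge0 => //; apply: ltW; apply: mulr_gt0; first by rewrite invr_gt0.
    exact: divr_gt0.
  by rewrite ler_nat; exact: card_faces_of.
have -> : D * vol T / 2 = D * vol T - D * vol T / 2 by field.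
rewrite -addrA lerD2l; move: cardS; rewrite -lerN2 => cardS.
apply: le_trans (lerD cardS (lexx _)) _.
rewrite -sumrN mulr_sumr -big_split; apply: ler_sum => F FT /=.
have [q0 [cF oT oF TF]] := face_frame cT FT.
have [_ [N1 _]] := outer_normalP cT cF TF oF.
apply: le_trans (face_form_coercive F (p T) (q F) k0 N1).
rewrite -/D addrC lerD2l lerN2 mulrAC mulrC ler_wpM2l //.
exact: area_le.
Qed.

End mesh_regularity.

(** * The kernel of a_h *)

Section kernel.
Variables (R : realType) (n : nat) (K : mesh R n.+1).
Local Notation I := 'I_(nverts K).
Local Notation vset := {set I}.
Local Notation Rd := 'rV[R]_n.+1.
Implicit Types (T F : vset) (x : Rd).

Lemma face_int_ge0 F (f : Rd -> R) : mbounded f -> (forall x, 0 <= f x) -> 0 <= face_int F f.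
Proof.
move=> mf f0; have := le_face_int F (mbounded_cst _ 0) mf f0.
by rewrite face_int_cst mul0r.
Qed.

(** One point b serves for all f, so the jumps of both cells at F vanish at the same point. It is
    the image of the centre of a cube in the reference simplex; a positive value there would stay
    positive on a smaller cube. *)
Lemma face_int_eq0 T F : cell_like T -> F \in faces_of T ->
  exists2 b, simplex F b & forall f : Rd -> R, continuous f -> (forall x, 0 <= f x) ->
    face_int F f = 0 -> f b = 0.
Proof.
move=> cT FT; have [q [cF qT qF TF]] := face_frame cT FT.
have [c [r [r0 cr]]] := cube_ref_simplex R n.
pose X (t : 'rV[R]_n) : Rd := face_pt F 0 + t *m face_jac F.
exists (X c); first by apply: face_param => //; apply: cr => i; rewrite subrr normr0.
move=> f cf f0 I0; apply: contrapT => /eqP fb.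
have {fb} fb : 0 < f (X c) by rewrite lt_def fb f0.
have cX : continuous X.
  move=> t; apply: continuous_rV => i.
  have -> : (fun y => X y ord0 i) = fun y => face_pt F 0 ord0 i + dotv (\row_j face_jac F j i) y.
    by apply/funext => z; rewrite !mxE; congr (_ + _); apply: eq_bigr => j _; rewrite !mxE mulrC.
  apply: (@continuousD _ _ _ (fun=> _) (dotv _)); first exact: cst_continuous.
  exact: continuous_dotv.
have cfX : {for c, continuous (f \o X)} by apply: continuous_comp; [exact: cX|exact: cf].
have f2 : 0 < f (X c) / 2 by rewrite divr_gt0.
have /nbhs_rVP[r' r'0 r'f] : \forall t \near c, f (X c) / 2 <= f (X t).
  move/cvgrPdist_lt: cfX => /(_ _ f2); apply: filterS => t /=.
  rewrite ltr_distlC => /andP[h _]; apply/ltW; apply: le_lt_trans h.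
  by rewrite le_eqVlt; apply/orP; left; apply/eqP; field.
have mr0 : 0 < Order.min r r' by rewrite lt_min r0.
have P : 0 < \int[lebesgue_rV R n]_(t in @ref_simplex R n.+1) f (X t).
  apply: (@Rintegral_gt0 _ _ _ _ c (Order.min r r') (f (X c) / 2)) => //.
  - exact: measurable_ref_simplex.
  - exact/face_integrable/mbounded_continuous.
  - move=> t tc; apply: cr => i; apply: lt_le_trans (tc i) _; by rewrite ge_min lexx.
  - move=> t tc; apply: r'f => i; apply: lt_le_trans (tc i) _; by rewrite ge_min lexx orbT.
have := area_gt0 cT FT; rewrite /area pmulr_lgt0 ?ref_vol_gt0 // => D0.
have := mulr_gt0 D0 P; rewrite -/(face_int F f) I0 ltxx //.
Qed.

Lemma faces_of_opp T : cell_like T -> faces_of T = [set T :\ i | i in T]%SET.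
Proof.
move=> cT; apply/finset.setP => F; apply/idP/imsetP.
  move=> /(face_frame cT)[q [cF qT qF TF]]; exists q => //.
  by rewrite TF setU1K.
move=> [q qT ->]; rewrite inE subD1set /=; have := cardsD1 q T.
by rewrite qT cT.1 add1n => /eqP; rewrite eqSS eq_sym.
Qed.

(* The divergence theorem for the field x on the cell T. *)
Lemma sum_area_normal T : cell_like T ->
  \sum_(F in faces_of T) area F * dotv (outer_normal T F) (face_pt F 0) =
  vol T / (ref_vol R n.+1 / ref_vol R n).
Proof.
move=> cT; have [b1 _] := bary_sum 0 cT.
(* The term of the face opposite to q is the right side times the barycentric coordinate of q at the
   origin, and these coordinates sum to 1. *)
rewrite -[RHS]mulr1 -b1 mulr_sumr faces_of_opp // big_imset /=; last first.
  move=> i j iT jT /(congr1 (fun A : vset => i \in A)).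
  by rewrite !inE eqxx iT andbT /=; case: (eqVneq i j).
apply: eq_bigr => q qT; set F := T :\ q.
have FT : F \in faces_of T by rewrite faces_of_opp //; apply: imset_f.
have [cF _] := facesP cT.1 FT.
have qF : q \notin F by rewrite !inE eqxx.
have TF : T = q |: F by rewrite finset.setD1K.
rewrite (bary_outer_normal 0 cT cF TF qF) subr0 (frame_height cT cF TF qF).
have ng : norm2 (bary_grad T q) != 0.
  by rewrite gt_eqF // norm2_gt0 (bary_grad_neq0 cT cF TF).
have r1 := ref_vol_gt0 R n; have r2 := ref_vol_gt0 R n.+1.
by field; rewrite ng !gt_eqF.
Qed.

Variable Om : set Rd.
Hypotheses (lip : lipschitz_domain Om) (tri : triangulation K Om).

Lemma constant_cells_eq0 (c : vset -> Rd) :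
  (forall T T' F, T \in cells K -> T' \in cells K -> F \in faces_of T -> F \in faces_of T' ->
     c T = c T') ->
  (forall T F, T \in cells K -> F \in faces_of T ->
     (forall T', T' \in cells K -> F \in faces_of T' -> T' = T) -> c T = 0) ->
  forall T, T \in cells K -> c T = 0.
Proof.
move=> ceq cbd T0 T0K; apply/eqP/negPn/negP => c0.
pose S T := c T == c T0.
pose g T F : R := if S T then area F * dotv (outer_normal T F) (face_pt F 0) else 0.
have E : \sum_(T in cells K) \sum_(F in faces_of T) g T F = 0.
  rewrite sum_cells_faces big1 // => F _.
  have [[T [TK FT]]|h] := pselect (exists T, T \in cells K /\ F \in faces_of T); last first.
    by rewrite big1 // => T /andP[TK FT]; case: h; exists T.
  have [T1|[T' [T'K FT' T'T T2]]] := face_cells tri TK FT.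
    rewrite (cells_with_face_sum _ TK FT T1) /g /S (cbd T F TK FT T1) eq_sym.
    by rewrite (negbTE c0).
  rewrite (cells_with_face_sum2 _ TK FT T'K FT' T'T T2) /g /S (ceq T T' F) //.
  case: ifP => _; last by rewrite addr0.
  rewrite (opposite_normals tri TK T'K FT FT' (nesym (elimN eqP T'T))) dotvNl.
  by rewrite mulrN subrr.
have rho0 : 0 < ref_vol R n.+1 / ref_vol R n by rewrite divr_gt0 ?ref_vol_gt0.
have gE : forall T, T \in cells K -> \sum_(F in faces_of T) g T F =
    if S T then vol T / (ref_vol R n.+1 / ref_vol R n) else 0.
  move=> T TK; rewrite /g; case: ifP => // _; last by rewrite big1.
  exact/sum_area_normal/(triangulation_cell tri).
have : 0 < \sum_(T in cells K) \sum_(F in faces_of T) g T F.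
  rewrite (bigD1 T0) //= gE // /S eqxx ltr_wpDr //.
    apply: sumr_ge0 => T /andP[TK _]; rewrite gE //; case: ifP => // _.
    by rewrite divr_ge0 ?ltW // vol_gt0 //; exact: (triangulation_cell tri).
  by rewrite divr_gt0 // vol_gt0 //; exact: (triangulation_cell tri).
by rewrite E ltxx.
Qed.

Variables (sigma alpha : R).
Hypotheses (sr : shape_regular K sigma) (qu : quasi_uniform K sigma).
Hypothesis ab : stab_bound n sigma <= alpha.

Lemma form_kernel (p q : vset -> 'M[R]_(1 + n.+1, n.+1)) :
  H0div Om (broken (fun T => affv (p T))) -> in_Vhat 1 Om (fun F => affv (q F)) ->
  \sum_(T in cells K) cell_form (alpha / mesh_size K) p q p q T = 0 ->
  forall T, T \in cells K -> affv (p T) = fun=> 0.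
Proof.
move=> divp hq sum0.
pose Y T F := face_int F (fun x =>
  dotv (affine_jump (p T) (q F) (outer_normal T F) x) (affine_jump (p T) (q F) (outer_normal T F) x)).
pose D T := ddot (dsubmx (p T))^T (dsubmx (p T))^T.
have mw T F : mbounded (fun x => dotv (affine_jump (p T) (q F) (outer_normal T F) x)
    (affine_jump (p T) (q F) (outer_normal T F) x)).
  exact: (mbounded_dotv (mbounded_affine_jump _ _ _) (mbounded_affine_jump _ _ _)).
have Y0 T F : 0 <= Y T F by apply: face_int_ge0; [exact: mw|move=> x; exact: dotv_ge0].
have a0 := lt_le_trans (stab_bound_gt0 n sigma) ab.
have k0 T : T \in cells K -> 0 < alpha / mesh_size K / 2.
  by move=> TK; rewrite !divr_gt0 // (mesh_size_gt0 tri TK).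
have lb T : T \in cells K -> D T * vol T / 2 + alpha / mesh_size K / 2 *
    \sum_(F in faces_of T) Y T F <= cell_form (alpha / mesh_size K) p q p q T.
  exact: (cell_form_coercive tri sr qu p q ab).
have v0 T : T \in cells K -> 0 < vol T by move=> TK; exact/vol_gt0/(triangulation_cell tri).
have SY T : 0 <= \sum_(F in faces_of T) Y T F by apply: sumr_ge0.
have DV T : T \in cells K -> 0 <= D T * vol T / 2.
  by move=> TK; rewrite divr_ge0 // mulr_ge0 ?ddot_ge0 // ltW // v0.
have cf0 T : T \in cells K -> cell_form (alpha / mesh_size K) p q p q T = 0.
  move=> TK; move/eqP: sum0; rewrite psumr_eq0 => [/allP/(_ T (mem_index_enum _))|T' T'K].
    by rewrite TK => /eqP.
  by apply: le_trans (lb _ T'K); rewrite addr_ge0 ?DV // mulr_ge0 // ltW // (k0 T').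
have D0 T : T \in cells K -> dsubmx (p T) = 0.
  move=> TK; have := lb T TK; rewrite cf0 // => h.
  have DT0 : D T = 0.
    have := v0 T TK; have := ddot_ge0 (dsubmx (p T))^T; rewrite -/(D T).
    have := mulr_ge0 (ltW (k0 T TK)) (SY T) => h1 h2 h3.
    apply/eqP; rewrite eq_le h2 andbT -(pmulr_lle0 _ h3); lra.
  by rewrite -[dsubmx _]trmxK (ddot_eq0 DT0) trmx0.
have Yeq0 T F : T \in cells K -> F \in faces_of T -> Y T F = 0.
  move=> TK FT; have := lb T TK; rewrite cf0 // => h.
  have h1 := DV T TK.
  have : \sum_(F in faces_of T) Y T F = 0.
    apply/eqP; rewrite eq_le SY andbT -(pmulr_rle0 _ (k0 T TK)); lra.
  move/eqP; rewrite psumr_eq0 // => /allP/(_ F (mem_index_enum _)).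
  by rewrite FT => /eqP.
pose c T := usubmx (p T).
have affc T x : T \in cells K -> affv (p T) x = c T.
  by move=> TK; rewrite /affv D0 // mulmx0 addr0.
have pp T : T \in cells K -> poly_vfun 1 (affv (p T)) by move=> _; exact: poly_affv.
(* At b the tangential jump vanishes from every cell at F. The face field has no normal component,
   so its value is the tangential part of each neighbouring constant. *)
have onF T F : T \in cells K -> F \in faces_of T -> exists2 b, simplex F b &
    forall T', T' \in cells K -> F \in faces_of T' ->
      affv (q F) b = c T' - dotv (c T') (outer_normal T' F) *: outer_normal T' F.
  move=> TK FT; have cT := triangulation_cell tri TK.
  have [b bF bP] := face_int_eq0 cT FT; exists b => // T' T'K FT'.
  have cT' := triangulation_cell tri T'K; have [q0 [cF oT oF TF]] := face_frame cT' FT'.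
  have FK : F \in faces K by apply/bigcupP; exists T'.
  have [NE _] := outer_normalP cT' cF TF oF.
  have [_ _ _ /(_ F FK) unF] := tri.
  have nrmE : nrm F = outer_normal T' F \/ nrm F = - outer_normal T' F.
    have [s' [] -> ->] := unit_normal_face cT' cF TF oF unF; rewrite NE.
      by right; rewrite scaleNr opprK div1r.
    by left; rewrite mulN1r.
  have qN : dotv (affv (q F) b) (outer_normal T' F) = 0.
    have [_ /(_ b bF) h _] := hq F FK.
    by case: nrmE h => ->; rewrite ?dotvNr // => /eqP; rewrite oppr_eq0 => /eqP.
  have cw : continuous (fun x => dotv (affine_jump (p T') (q F) (outer_normal T' F) x)
      (affine_jump (p T') (q F) (outer_normal T' F) x)).
    by apply: cont_sum => i; apply: contM; exact: continuous_affine_jump.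
  have /eqP := bP _ cw (fun x => dotv_ge0 _) (Yeq0 T' F T'K FT').
  rewrite dotv_eq0 /affine_jump /tangential (affc _ _ T'K) dotvBl qN sub0r scaleNr opprK.
  by rewrite addrAC subr_eq0 => /eqP E; rewrite -{1}E addrK.
have c0 : forall T, T \in cells K -> c T = 0.
  apply: constant_cells_eq0 => [T T' F TK T'K FT FT'|T F TK FT T1].
    have [->//|T'T] := eqVneq T' T.
    have [b bF bE] := onF T F TK FT.
    have [/(_ T' T'K FT' (elimN eqP T'T)) + _] := face_jump_simplex lip tri pp divp TK FT bF.
    rewrite !affc // => cN; have := bE T TK FT; rewrite (bE T' T'K FT').
    rewrite (opposite_normals tri TK T'K FT FT' (nesym (elimN eqP T'T))) dotvNr scaleNr scalerN opprK.
    by rewrite -cN => /addIr.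
  have [b bF bE] := onF T F TK FT.
  have [_ /(_ T1)] := face_jump_simplex lip tri pp divp TK FT bF.
  rewrite affc // => cN; have := bE T TK FT; rewrite cN scale0r subr0 => <-.
  have FK : F \in faces K by apply/bigcupP; exists T.
  (* A face of a single cell lies on the boundary of Om, where the face field is 0; this value is
     the tangential part of the constant, and the normal part vanishes too. *)
  have [_ _ h] := hq F FK; apply: h => //.
  exact: (simplex_face_bdry lip tri TK FT T1).
by move=> T TK; apply/funext => x; rewrite affc // c0.
Qed.

End kernel.

(** * Linearity of the load integrals and of H_0(div) *)

Section linear_functionals.
Variables (R : realType) (d : nat) (Om : set 'rV[R]_d).
Hypotheses (mOm : measurable Om) (bOm : box_bounded Om).
Local Notation mu := (lebesgue_rV R d).
Local Notation Rd := 'rV[R]_d.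

Lemma Rintegral_lin (F1 F2 F3 : Rd -> R) c : mu.-integrable Om (EFin \o F1) ->
  mu.-integrable Om (EFin \o F2) -> (forall x, F3 x = c * F1 x + F2 x) ->
  \int[mu]_(x in Om) F3 x = c * \int[mu]_(x in Om) F1 x + \int[mu]_(x in Om) F2 x.
Proof.
move=> i1 i2 FE; rewrite -RintegralZl // -RintegralD //.
  by apply: eq_Rintegral => x _; rewrite FE.
by have := integrableZl mOm c i1; congr (_.-integrable _ _).
Qed.

Lemma L2_dotv_integrable (f v : Rd -> Rd) : vL2 Om f -> (forall i, mbounded (fun x => v x ord0 i)) ->
  mu.-integrable Om (EFin \o (fun x => dotv (f x) (v x))).
Proof.
move=> L2f mv.
have := @integrable_sum _ _ _ mu Om mOm _ (index_enum _) xpredT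
  (fun i => EFin \o (fun x => f x ord0 i * v x ord0 i))
  (fun i _ => L2_mul_integrable mOm bOm (L2f i) (mv i)).
by congr (_.-integrable _ _); apply/funext => x /=; rewrite sumEFin.
Qed.

Lemma H0divD c (u v : Rd -> Rd) : H0div Om u -> H0div Om v -> H0div Om (fun x => c *: u x + v x).
Proof.
move=> [L2u [wu L2wu uE]] [L2v [wv L2wv vE]]; split.
  move=> i; have := L2D mOm (L2Z mOm c (L2u i)) (L2v i).
  by congr L2; apply/funext => x; rewrite !mxE.
exists (fun x => c * wu x + wv x).
  exact: (L2D mOm (L2Z mOm c L2wu) L2wv).
move=> phi C1phi; have [dphi cphi] := C1phi.
have mphi : mbounded phi.
  by apply: mbounded_continuous => x; exact: differentiable_continuous.
have mg i : mbounded (fun x => grad phi x ord0 i).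
  have := mbounded_continuous (cphi i).
  by congr mbounded; apply/funext => x; rewrite mxE.
have E1 : \int[mu]_(x in Om) dotv (c *: u x + v x) (grad phi x) =
    c * \int[mu]_(x in Om) dotv (u x) (grad phi x) + \int[mu]_(x in Om) dotv (v x) (grad phi x).
  by apply: Rintegral_lin => [||x]; [exact: L2_dotv_integrable|exact: L2_dotv_integrable|rewrite dotvDl dotvZl].
have E2 : \int[mu]_(x in Om) ((c * wu x + wv x) * phi x) =
    c * \int[mu]_(x in Om) (wu x * phi x) + \int[mu]_(x in Om) (wv x * phi x).
  by apply: Rintegral_lin => [||x]; [exact: L2_mul_integrable|exact: L2_mul_integrable|rewrite mulrDl mulrA].
by rewrite E1 E2 addrACA -mulrDr uE // vE // mulr0 addr0.
Qed.

End linear_functionals.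

(** * Solving the momentum equation *)

Section momentum.
Variables (R : realType) (n : nat) (K : mesh R n.+1) (Om : set 'rV[R]_n.+1).
Local Notation I := 'I_(nverts K).
Local Notation vset := {set I}.
Local Notation Rd := 'rV[R]_n.+1.
Local Notation dof := 'M[R]_(1 + n.+1, n.+1).
Local Notation mu := (lebesgue_rV R n.+1).
Implicit Types (T F : vset) (v w : vset -> Rd -> Rd).

Lemma eq_broken (V : nmodType) (v w : vset -> Rd -> V) :
  (forall T, T \in cells K -> v T = w T) -> broken v = broken w.
Proof. by move=> vw; apply/funext => x; rewrite !brokenE; apply: eq_bigr => T /vw ->. Qed.

Lemma broken_lin (V : lmodType R) c (u v w : vset -> Rd -> V) :
  (forall T x, u T x = c *: v T x + w T x) ->
  forall x, broken u x = c *: broken v x + broken w x.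
Proof.
by move=> uE x; rewrite /broken scaler_sumr -big_split; apply: eq_bigr => T _ /=; rewrite uE.
Qed.

Lemma broken_lin1 c (u v w : vset -> Rd -> R) : (forall T x, u T x = c * v T x + w T x) ->
  forall x, broken u x = c * broken v x + broken w x.
Proof. exact: (@broken_lin R^o). Qed.

Hypotheses (lip : lipschitz_domain Om) (tri : triangulation K Om).
Variables (sigma alpha nu cM : R) (f g : Rd -> Rd) (rhon : vset -> Rd -> R).
Hypotheses (sr : shape_regular K sigma) (qu : quasi_uniform K sigma).
Hypotheses (ab : stab_bound n sigma <= alpha) (nu0 : 0 < nu).
Hypotheses (L2f : vL2 Om f) (Lg : vLinfty Om g) (hn : in_Qh 1 rhon).

Definition load v : R :=
  \int[mu]_(x in Om) dotv (f x) (broken v x)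
  + \int[mu]_(x in Om) dotv (g x) (broken rhon x *: broken v x)
  + \int[mu]_(x in Om) (cM * broken rhon x * broken (fun T => divergence (v T)) x).

(** A field for every vertex set, in the role of a cell ([inl]) and of a face ([inr]), gives a fixed
    finite-dimensional space. Coefficients off the mesh, and values of face fields off their face,
    do not influence the form. *)
Definition unknowns := {ffun vset + vset -> dof}.
Definition cell_field (e : unknowns) T : Rd -> Rd := affv (e (inl T)).
Definition face_field (e : unknowns) F : Rd -> Rd := affv (e (inr F)).

Lemma cell_fieldD c x y T z :
  cell_field (c *: x + y) T z = c *: cell_field x T z + cell_field y T z.
Proof. by rewrite /cell_field !ffunE affvD. Qed.

Lemma face_fieldD c x y T z :
  face_field (c *: x + y) T z = c *: face_field x T z + face_field y T z.
Proof. by rewrite /face_field !ffunE affvD. Qed.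

Lemma divergence_affv (P : dof) x : divergence (affv P) x = \tr (dsubmx P).
Proof. by rewrite /divergence gradv_affv mxtrace_tr. Qed.

Let mOm : measurable Om.
Proof. by apply: open_measurable_rV; have [] := lip. Qed.

Let bOm : box_bounded Om.
Proof. by apply: bounded_set_box; have [] := lip. Qed.

Lemma load_lin c x y :
  load (cell_field (c *: x + y)) = c * load (cell_field x) + load (cell_field y).
Proof.
have mb (e : unknowns) i : mbounded (fun x => broken (cell_field e) x ord0 i).
  by apply: mbounded_broken_coord tri _ => T _; exact: poly_affv.
have mr : mbounded (broken rhon).
  apply: (mbounded_broken tri) => T TK.
  have -> : rhon T = fun=> rhon T 0 by apply/funext => z; rewrite (Qh1E z hn TK).
  exact: mbounded_cst.
have mrb (e : unknowns) i : mbounded (fun x => (broken rhon x *: broken (cell_field e) x) ord0 i).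
  have := mboundedM mr (mb e i).
  by congr mbounded; apply/funext => z; rewrite !mxE.
have md (e : unknowns) : mbounded (fun x => cM * broken rhon x *
    broken (fun T => divergence (cell_field e T)) x).
  apply: mboundedM; first exact: mboundedZ.
  apply: (mbounded_broken tri) => T TK.
  have -> : divergence (cell_field e T) = fun=> \tr (dsubmx (e (inl T))).
    by apply/funext => z; rewrite divergence_affv.
  exact: mbounded_cst.
have bE := broken_lin (cell_fieldD c x y).
have dE : forall z, broken (fun T => divergence (cell_field (c *: x + y) T)) z =
    c * broken (fun T => divergence (cell_field x T)) z + broken (fun T => divergence (cell_field y T)) z.
  apply: broken_lin1 => T z; rewrite !divergence_affv !ffunE dsub_dofD.
  by rewrite linearD linearZ.
have lin3 (a b e a1 b1 e1 a2 b2 e2 : R) : a = c * a1 + a2 -> b = c * b1 + b2 -> e = c * e1 + e2 ->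
    a + b + e = c * (a1 + b1 + e1) + (a2 + b2 + e2).
  by move=> -> -> ->; ring.
apply: lin3; apply: Rintegral_lin.
- exact: mOm.
- exact: (L2_dotv_integrable mOm bOm L2f (mb x)).
- exact: (L2_dotv_integrable mOm bOm L2f (mb y)).
- by move=> z; rewrite bE dotvDr dotvZr.
- exact: mOm.
- exact: (L2_dotv_integrable mOm bOm (fun i => Linfty_L2 mOm bOm (Lg i)) (mrb x)).
- exact: (L2_dotv_integrable mOm bOm (fun i => Linfty_L2 mOm bOm (Lg i)) (mrb y)).
- by move=> z; rewrite bE scalerDr dotvDr !dotvZr; ring.
- exact: mOm.
- exact: (mbounded_integrable mOm bOm (md x)).
- exact: (mbounded_integrable mOm bOm (md y)).
- move=> z; apply: etrans (congr1 (fun t => cM * broken rhon z * t) (dE z)) _.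
  by rewrite mulrDr mulrCA.
Qed.

Lemma eq_load v w : (forall T, T \in cells K -> v T = w T) -> load v = load w.
Proof.
move=> vw; rewrite /load (eq_broken vw).
have E : broken (fun T => divergence (v T)) = broken (fun T => divergence (w T)).
  by apply: eq_broken => T /vw ->.
exact: (congr1 (fun b : Rd -> R => _ + \int[mu]_(x in Om) (cM * broken rhon x * b x)) E).
Qed.

Lemma cell_field0 T : cell_field 0 T = fun=> 0.
Proof. by apply/funext => x; rewrite /cell_field /affv ffunE !linear0 addr0. Qed.

Lemma face_field0 T : face_field 0 T = fun=> 0.
Proof. by apply/funext => x; rewrite /face_field /affv ffunE !linear0 addr0. Qed.

Lemma load0 : load (cell_field 0) = 0.
Proof.
by have := load_lin (-1) 0 0; rewrite scaler0 addr0 mulN1r addNr.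
Qed.

Definition admissible (e : unknowns) :=
  H0div Om (broken (cell_field e)) /\ in_Vhat 1 Om (face_field e).

Lemma admissible0 : admissible 0.
Proof.
have b0 : broken (cell_field 0) = fun=> 0.
  by apply/funext => x; rewrite brokenE big1 // => T _; rewrite cell_field0; case: ifP.
have L20 : L2 Om (fun _ : Rd => 0 : R) by apply: L2_mbounded => //; exact: mbounded_cst.
split.
  rewrite b0; split; first by move=> i; move: L20; congr L2; apply/funext => x; rewrite mxE.
  exists (fun=> 0) => // phi _.
  rewrite (@eq_Rintegral _ _ _ _ _ (fun=> 0)) => [|x _]; last by rewrite dotv0l.
  rewrite [X in _ + X](@eq_Rintegral _ _ _ _ _ (fun=> 0)) => [|x _]; last by rewrite mul0r.
  by rewrite Rintegral_cst // mul0r addr0.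
move=> F _; rewrite face_field0; split => [|x _|_ x _] //; last by rewrite dotv0l.
exists (face_field 0 F); first exact: poly_affv.
by move=> x _; rewrite face_field0.
Qed.

Lemma admissibleD c x y : admissible x -> admissible y -> admissible (c *: x + y).
Proof.
move=> [dx hx] [dy hy]; split.
  have -> : broken (cell_field (c *: x + y)) =
      fun z => c *: broken (cell_field x) z + broken (cell_field y) z.
    by apply/funext => z; exact: broken_lin (cell_fieldD c x y) z.
  exact: H0divD.
move=> F FK; have [_ x2 x3] := hx F FK; have [_ y2 y3] := hy F FK.
split.
- by exists (face_field (c *: x + y) F); first exact: poly_affv.
- by move=> z zF; rewrite face_fieldD dotvDl dotvZl x2 // y2 // mulr0 addr0.
- by move=> FOm z zF; rewrite face_fieldD x3 // y3 // scaler0 addr0.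
Qed.

Definition unknowns_form (x y : unknowns) : R := nu * \sum_(T in cells K)
  cell_form (alpha / mesh_size K) (x \o inl) (x \o inr) (y \o inl) (y \o inr) T.

Lemma unknowns_formC x y : unknowns_form x y = unknowns_form y x.
Proof.
apply: (congr1 ( *%R nu)); apply: eq_bigr => T _.
have E := cell_formC (alpha / mesh_size K) (x \o inl) (x \o inr) (y \o inl) (y \o inr) T.
rewrite E; reflexivity.
Qed.

Lemma unknowns_form_linr c x y z :
  unknowns_form z (c *: x + y) = c * unknowns_form z x + unknowns_form z y.
Proof.
rewrite /unknowns_form mulrCA -mulrDr; apply: (congr1 ( *%R nu)).
rewrite mulr_sumr -big_split; apply: eq_bigr => T _.
have E := cell_form_linr (alpha / mesh_size K) c (z \o inl) (z \o inr)
  (x \o inl) (x \o inr) (y \o inl) (y \o inr) T.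
apply: etrans E; set kap := alpha / _.
have E1 : (c *: x + y) \o inl = fun A => c *: (x \o inl) A + (y \o inl) A by apply/funext => A; rewrite /= !ffunE.
have E2 : (c *: x + y) \o inr = fun A => c *: (x \o inr) A + (y \o inr) A by apply/funext => A; rewrite /= !ffunE.
exact: (f_equal2 (fun p q => cell_form kap (z \o inl) (z \o inr) p q T) E1 E2).
Qed.

(** [form_kernel] makes the cell fields of a kernel element vanish, and the load depends on these
    alone, so [galerkin] applies despite the redundant coefficients. *)
Lemma momentum_step_solve : exists u uh, momentum_step 1 Om alpha nu cM f g rhon u uh.
Proof.
have ker e : admissible e -> unknowns_form e e = 0 -> load (cell_field e) = 0.
  move=> [de he] /eqP; rewrite mulf_eq0 (gt_eqF nu0) /= => /eqP e0.
  rewrite -load0; apply: eq_load => T TK; rewrite cell_field0.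
  exact: (form_kernel lip tri sr qu ab de he e0).
have [e [de he] eE] : exists2 e, admissible e & forall e', admissible e' ->
    unknowns_form e e' = load (cell_field e').
  apply: (@galerkin _ unknowns) => //.
  - exact: admissible0.
  - exact: admissibleD.
  - by move=> c x y z _ _ _; rewrite unknowns_formC unknowns_form_linr ![unknowns_form z _]unknowns_formC.
  - by move=> c x y z _ _ _; exact: unknowns_form_linr.
  - by move=> c x y _ _; exact: load_lin.
exists (cell_field e), (face_field e); split => //.
  by split => // T _; exact: poly_affv.
move=> v vh [pv dv] hv.
(* A test pair is given by functions, so coefficients are chosen for it: on cells it is affine
   everywhere, on a face it agrees with an affine field only on the face itself. *)
have [P PE] : {P : vset -> dof & forall T, T \in cells K -> v T = affv (P T)}.
  apply: (@choice _ _ (fun T P => T \in cells K -> v T = affv P)) => T.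
  have [TK|_] := boolP (T \in cells K); last by exists 0.
  by have [P PE] := poly_vfun_affv (pv T TK); exists P.
have [Q QE] : {Q : vset -> dof & forall F, F \in faces K ->
    forall x, simplex F x -> vh F x = affv (Q F) x}.
  apply: (@choice _ _ (fun F Q => F \in faces K -> forall x, simplex F x -> vh F x = affv Q x)) => F.
  have [FK|_] := boolP (F \in faces K); last by exists 0.
  have [[p pp pE] _ _] := hv F FK; have [Q QE] := poly_vfun_affv pp.
  by exists Q => _ x xF; rewrite pE // QE.
pose e' : unknowns := [ffun k => match k with inl T => P T | inr F => Q F end].
have ve T : T \in cells K -> v T = cell_field e' T by move=> TK; rewrite /cell_field ffunE PE.
have vhe F x : F \in faces K -> simplex F x -> vh F x = face_field e' F x.
  by move=> FK xF; rewrite /face_field ffunE QE.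
have adm : admissible e'.
  split; first by rewrite -(eq_broken ve).
  move=> F FK; have [_ h2 h3] := hv F FK; split.
  - by exists (face_field e' F); first exact: poly_affv.
  - by move=> x xF; rewrite -vhe // h2.
  - by move=> FOm x xF; rewrite -vhe // h3.
apply: etrans (_ : _ = unknowns_form e e') _.
  exact: (@form_aE _ _ _ Om alpha nu (cell_field e) (face_field e) v vh (e \o inl) (e \o inr)
    (e' \o inl) (e' \o inr)).
by apply: etrans (eE e' adm) _; rewrite -(eq_load ve) /load.
Qed.

End momentum.

(* alpha0 depends only on d and on the bound sigma for the shape regularity and
   quasi-uniformity of the mesh. *)
Theorem lemma4p4 (R : realType) (d : nat) (sigma : R)
    (d23 : d = 2%N \/ d = 3%N) :
  exists2 alpha0 : R, 0 < alpha0 &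
  forall alpha : R, alpha0 <= alpha ->
  forall (Om : set 'rV[R]_d) (K : mesh R d) (nu cM M tau : R)
    (f g : 'rV[R]_d -> 'rV[R]_d)
    (rhon : {set 'I_(nverts K)} -> 'rV[R]_d -> R),
  lipschitz_domain Om ->
  triangulation K Om -> shape_regular K sigma -> quasi_uniform K sigma ->
  0 < nu -> 0 < cM -> 0 < M -> 0 < tau ->
  vL2 Om f -> vLinfty Om g ->
  in_Qh 1 rhon ->
  (exists u uh, momentum_step 1 Om alpha nu cM f g rhon u uh) /\
  (forall u uh, momentum_step 1 Om alpha nu cM f g rhon u uh ->
    (exists rho, density_step 1 Om tau u rhon rho) /\
    (forall rho, density_step 1 Om tau u rhon rho ->
       positive_density rhon -> mass Om rhon = M ->
       positive_density rho /\ mass Om rho = M)).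
Proof.
have [n ->] : exists n, d = n.+1 by case: d23 => ->; [exists 1%N|exists 2%N].
exists (stab_bound n sigma); first exact: stab_bound_gt0.
move=> alpha ab Om K nu cM M tau f g rhon lip tri sr qu nu0 _ _ tau0 L2f Lg hn.
split; first exact: (momentum_step_solve lip tri cM sr qu ab nu0 L2f Lg hn).
move=> u uh [[pu divu] _ _].
split; first exact: (density_step_solve lip tri pu divu tau0 hn).
move=> rho hrho pos <-; split; first exact: (density_step_pos lip tri pu divu tau0 hn hrho pos).
exact: (density_step_mass lip tri pu divu tau0 hn hrho).
Qed.
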